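(* Let $1\le p<\infty$ and let $g_1,g_2\in\mathrm{BMOA}$ be non-constant. The following conditions are equivalent: (a) $(T_{g_1},H^p)=(T_{g_2},H^p)$. (b) There exist two functions $k_1,k_2\in H^\infty$ such that $g_1=T_{g_2}(k_1)+g_1(0)$ and $g_2=T_{g_1}(k_2)+g_2(0)$. Moreover, in this case $k_2=1/k_1$.
   Context: $\mathbb{D}$ is the open unit disc of $\mathbb{C}$; $\mathrm{Hol}(\mathbb{D})$ and $\mathrm{Mer}(\mathbb{D})$ are the sets of holomorphic and meromorphic functions on $\mathbb{D}$. $H^p$ ($0<p<\infty$) is the Hardy space of $f\in\mathrm{Hol}(\mathbb{D})$ with $\|f\|_{H^p}^p=\sup_{0\le r<1}\int_0^{2\pi}|f(re^{it})|^p\frac{dt}{2\pi}<\infty$; $H^\infty$ is the space of bounded holomorphic functions on $\mathbb{D}$. $\mathrm{BMOA}$ consists of all $f\in H^2$ with $\|f\|_*:=\sup_{a\in\mathbb{D}}\|f\circ\varphi_a-f(a)\|_{H^2}<\infty$, where $\varphi_a(z)=\frac{z-a}{1-\overline{a}z}$. For $g\in\mathrm{BMOA}$ and $f\in\mathrm{Mer}(\mathbb{D})$ such that $fg'\in\mathrm{Hol}(\mathbb{D})$ (after removing removable singularities), $T_g(f)(z)=\int_0^z f(\zeta)g'(\zeta)\,d\zeta$. The meromorphic optimal domain is $(T_g,H^p)=\{f\in\mathrm{Mer}(\mathbb{D}): fg'\in\mathrm{Hol}(\mathbb{D}),\ T_g(f)\in H^p\}$. Equality in (a) is equality of sets. 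*)

(* Defs.v *)
From Stdlib Require Import Reals.
From Coquelicot Require Import Coquelicot.

Open Scope R_scope.

Definition unit_disc (z : C) : Prop := Cmod z < 1.

Definition holo (f : C -> C) : Prop := forall z : C, unit_disc z -> ex_derive f z.

Definition nonconstant (f : C -> C) : Prop :=
  ~ exists c : C, forall z : C, unit_disc z -> f z = c.

(* A meromorphic function on the disc is represented by a total function
   [C -> C]: its values at poles (and, more generally, at isolated points)
   are junk, which none of the notions below depends on. *)
Definition mero (f : C -> C) : Prop :=
  forall z0, unit_disc z0 ->
  exists (n : nat) (h : C -> C),
    locally z0 (fun z => ex_derive h z) /\
    locally' z0 (fun z => f z = (h z / (z - z0) ^ n)%C).

(* Stdlib's [Rpower 0 p] is 1, because [ln 0 = 0]. *)
Definition rpow (x p : R) : R := if Req_EM_T x 0 then 0 else Rpower x p.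

Definition circle_pt (r t : R) : C := (r * cos t, r * sin t).

Definition hardy_mean (p : R) (f : C -> C) (r : R) : R :=
  RInt (fun t => rpow (Cmod (f (circle_pt r t))) p / (2 * PI)) 0 (2 * PI).

(* [||f||_{H^p} <= M], for [f] holomorphic on the disc. *)
Definition hardy_norm_le (p : R) (f : C -> C) (M : R) : Prop :=
  0 <= M /\ forall r, 0 <= r < 1 -> hardy_mean p f r <= rpow M p.

Definition Hp (p : R) (f : C -> C) : Prop :=
  holo f /\ exists M, hardy_norm_le p f M.

Definition Hinf (f : C -> C) : Prop :=
  holo f /\ exists M : R, forall z : C, unit_disc z -> Cmod (f z) <= M.

Definition mobius (a z : C) : C := ((z - a) / (1 - Cconj a * z))%C.

(* The constant subtracted is the value [f (mobius a 0)] of [f \o mobius a]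
   at 0. With this sign in [mobius] it is [f (- a)]: subtracting [f a] instead
   would also force [f a - f (- a)] to be bounded, and exclude for example
   [log (1 - z)] from BMOA. *)
Definition BMOA (f : C -> C) : Prop :=
  Hp 2 f /\
  exists M, forall a, unit_disc a ->
    hardy_norm_le 2 (fun z => (f (mobius a z) - f (mobius a 0))%C) M.

(* [f * g'] is holomorphic on the disc, up to removable singularities. *)
Definition holo_prod (g f : C -> C) : Prop :=
  exists h, holo h /\
    forall z0, unit_disc z0 -> locally' z0 (fun z => h z = (f z * C_derive g z)%C).

(* The integral runs over the segment from 0 to [z]. When [holo_prod g f]
   holds, the integrand agrees with the holomorphic extension of [f * g'] off
   finitely many points of the segment, which do not affect the integral. *)
Definition Tg (g f : C -> C) (z : C) : C :=
  RInt (V := C_R_CompleteNormedModule)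
    (fun t : R => (z * (f (t * z) * C_derive g (t * z)))%C) 0 1.

Definition opt_dom (g : C -> C) (p : R) (f : C -> C) : Prop :=
  mero f /\ holo_prod g f /\ Hp p (Tg g f).

(* Main.v *)
(** Membership of [f] in the optimal domain says exactly that [f g'] is the
    derivative of some [F] in H^p, so the equality of the domains of [T_{g_1}]
    and [T_{g_2}] says that [F' |-> k F'], with [k = g_2' / g_1'], maps
    derivatives of H^p functions to derivatives of H^p functions, in both
    directions.

    If [k] is bounded this holds because [|G'| <= K |F'|] with [F] in H^p forces
    [G] in H^p. The proof replaces the area theorem by a Burkholder-type
    function. Rescale so that [K] is small, put [x = |F|^2],
    [s = 1 + |F|^2 + |G|^2], [q = p / 2]: for a suitable constant [c] depending
    on [p] only, [s^q - c x s^(q-1)] is superharmonic, so its circular means are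
    bounded by its value at 0, while [c x s^(q-1) <= s^q / 2 + C x^q].

    Conversely every [G] in H^p satisfies
    [|G'(a)| <= C (1 - |a|)^(-1-1/p)]. If [k] were unbounded, a sum [F] of
    normalised multiples of [(1 - conj a_n z)^(-2)], with [a_n] tending to the
    circle very fast and [|k(a_n)| >= 4^n], would be in H^p with [k F'] violating
    this estimate. *)
Require Import Defs.
From Stdlib Require Import Reals Lra Lia Classical IndefiniteDescription.
From Coquelicot Require Import Coquelicot.
Open Scope R_scope.

(** * Complex derivatives, curves and integrals *)

(** [holo] gives a derivative at each point and nothing about its continuity, so Cauchy's formulas
    have to start from Goursat's theorem for triangles. The inclusion of domains is a statement
    about sets: for each F it yields a growth constant depending on F. The sum of peaks is a gliding
    hump that makes this uniform without the closed graph theorem: its n-th summand has weight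
    2^-(n+1), against which the values 4^n of k leave an unbounded 2^n. That k is holomorphic across
    the zeros of g_1' comes from testing the inclusion on f = 1/g_1', that is F(z) = z. In the
    superharmonic function, the summand 1 in s keeps every power smooth at common zeros of F and G.
    By itself s^q is subharmonic; the subtracted term supplies the negative Laplacian. The mean
    inequality is read off the polar Laplacian r^2 u_rr + r u_r + u_tt, whose last term integrates
    to 0 over a period. *)

Notation cderiv f z l := (@is_derive C_AbsRing C_NormedModule f z l).
Notation curve_deriv f t l := (@is_derive R_AbsRing C_R_NormedModule f t l).
Notation is_CInt f a b l := (@is_RInt C_R_NormedModule f a b l).
Notation CInt f a b := (@RInt C_R_CompleteNormedModule f a b).
Notation ccontinuous f z := (@continuous C_UniformSpace C_UniformSpace f z).

Lemma cderiv_eps (f : C -> C) (z l : C) :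
  cderiv f z l <->
  forall eps, 0 < eps -> exists del, 0 < del /\
    forall w, Cmod (w - z) < del ->
      Cmod (f w - f z - l * (w - z)) <= eps * Cmod (w - z).
Proof.
split.
- intros [_ H] eps He.
  destruct (H z (fun P HP => HP) (mkposreal eps He)) as [d Hd].
  exists d; split; [apply cond_pos|]; intros w Hw.
  specialize (Hd w Hw). simpl in Hd.
  refine (Rle_trans _ _ _ _ Hd). right.
  change (Cmod (f w - f z - l * (w - z)) = Cmod (f w - f z - (w - z) * l)).
  f_equal. ring.
- intros H; split. apply is_linear_scal_l.
  intros x Hx.
  assert (Hxz : z = x) by (apply (@is_filter_lim_locally_unique C_AbsRing (AbsRing_NormedModule C_AbsRing)), Hx).
  subst x. intros eps.
  destruct (H eps (cond_pos eps)) as [d [Hd Hw]].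
  exists (mkposreal d Hd). intros w Hw'.
  specialize (Hw w Hw').
  refine (Rle_trans _ _ _ _ Hw). right.
  change (Cmod (f w - f z - (w - z) * l) = Cmod (f w - f z - l * (w - z))).
  f_equal. ring.
Qed.

(** The balls of [C_UniformSpace] are squares. Passing from them to discs of [Cmod] costs a factor
    sqrt 2, for which the halved radii in [ccontinuous_eps] leave room. *)
Lemma sqrt_2_le : sqrt 2 <= 2.
Proof. rewrite <- (sqrt_Rsqr 2) at 2 by lra. apply sqrt_le_1; unfold Rsqr; lra. Qed.

Lemma ccontinuous_eps (f : C -> C) (z : C) :
  ccontinuous f z <->
  forall eps, 0 < eps -> exists del, 0 < del /\
    forall w, Cmod (w - z) < del -> Cmod (f w - f z) < eps.
Proof.
split.
- intros H eps He.
  assert (He2 : 0 < eps / 2) by lra.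
  destruct (proj1 (filterlim_locally _ _) H (mkposreal _ He2)) as [d Hd].
  exists d; split; [apply cond_pos|]; intros w Hw.
  specialize (Hd w (C_NormedModule_mixin_compat1 z w d Hw)).
  apply C_NormedModule_mixin_compat2 in Hd. simpl in Hd.
  eapply Rlt_le_trans. exact Hd.
  pose proof sqrt_2_le.
  nra.
- intros H. apply filterlim_locally. intros eps.
  destruct (H eps (cond_pos eps)) as [d [Hd Hw]].
  assert (Hd2 : 0 < d / 2) by lra.
  exists (mkposreal _ Hd2). intros w Hb.
  apply (C_NormedModule_mixin_compat1 (f z) (f w) eps).
  apply Hw. apply C_NormedModule_mixin_compat2 in Hb.
  eapply Rlt_le_trans. exact Hb. simpl.
  pose proof sqrt_2_le.
  nra.
Qed.

Lemma locally_Cmod (z : C) (P : C -> Prop) :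
  @locally C_UniformSpace z P <->
  exists del, 0 < del /\ forall w, Cmod (w - z) < del -> P w.
Proof.
rewrite locally_C. split.
- intros [d Hd]. exists d. split. apply cond_pos. exact Hd.
- intros [d [Hd Hw]]. exists (mkposreal d Hd). exact Hw.
Qed.

Lemma locally'_Cmod (z : C) (P : C -> Prop) :
  @locally' C_UniformSpace z P <->
  exists del, 0 < del /\ forall w, Cmod (w - z) < del -> w <> z -> P w.
Proof.
unfold locally', within. rewrite locally_Cmod. reflexivity.
Qed.

Lemma cderiv_continuous (f : C -> C) (z l : C) : cderiv f z l -> ccontinuous f z.
Proof.
intros H. apply ccontinuous_eps. intros eps He.
destruct (proj1 (cderiv_eps f z l) H 1 Rlt_0_1) as [d [Hd Hw]].
pose proof (Cmod_ge_0 l).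
exists (Rmin d (eps / (2 + Cmod l))); split.
- apply Rmin_pos; trivial. apply Rdiv_lt_0_compat; lra.
- intros w Hw'.
  assert (H1 : Cmod (w - z) < d) by (eapply Rlt_le_trans; [exact Hw'|apply Rmin_l]).
  assert (H2 : Cmod (w - z) < eps / (2 + Cmod l)) by (eapply Rlt_le_trans; [exact Hw'|apply Rmin_r]).
  specialize (Hw w H1).
  replace (f w - f z)%C with ((f w - f z - l * (w - z)) + l * (w - z))%C by ring.
  eapply Rle_lt_trans. apply Cmod_triangle. rewrite Cmod_mult.
  assert (Cmod (w - z) * (2 + Cmod l) < eps).
  { apply (Rmult_lt_compat_r (2 + Cmod l)) in H2; [|lra].
    replace (eps / (2 + Cmod l) * (2 + Cmod l)) with eps in H2 by (field; lra). exact H2. }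
  pose proof (Cmod_ge_0 (w - z)). nra.
Qed.

Lemma cderiv_unique (f : C -> C) (z l1 l2 : C) : cderiv f z l1 -> cderiv f z l2 -> l1 = l2.
Proof.
intros H1 H2. rewrite <- (is_C_derive_unique _ _ _ H1). apply is_C_derive_unique, H2.
Qed.

Lemma cderiv_ext_loc (f g : C -> C) (z l : C) del : 0 < del ->
  (forall w, Cmod (w - z) < del -> f w = g w) -> cderiv f z l -> cderiv g z l.
Proof.
intros Hd H. apply is_derive_ext_loc. exists (mkposreal del Hd). exact H.
Qed.

Lemma cderiv_const (c z : C) : cderiv (fun _ => c) z (RtoC 0).
Proof. apply (@is_derive_const C_AbsRing C_NormedModule). Qed.

Lemma cderiv_id (z : C) : cderiv (fun w => w) z (RtoC 1).
Proof.
apply cderiv_eps. intros eps He. exists 1. split. lra. intros w _.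
replace (w - z - RtoC 1 * (w - z))%C with (RtoC 0) by ring.
rewrite Cmod_0. pose proof (Cmod_ge_0 (w - z)). nra.
Qed.

Lemma cderiv_plus (f g : C -> C) (z a b : C) : cderiv f z a -> cderiv g z b ->
  cderiv (fun w => f w + g w)%C z (a + b)%C.
Proof. apply (@is_derive_plus C_AbsRing C_NormedModule). Qed.

Lemma cderiv_minus (f g : C -> C) (z a b : C) : cderiv f z a -> cderiv g z b ->
  cderiv (fun w => f w - g w)%C z (a - b)%C.
Proof. apply (@is_derive_minus C_AbsRing C_NormedModule). Qed.

(* [C_NormedModule] and [AbsRing_NormedModule C_AbsRing] carry different
   uniform structures but the same norm. *)
Lemma cderiv_AbsRing (f : C -> C) (z l : C) :
  cderiv f z l <-> @is_derive C_AbsRing (AbsRing_NormedModule C_AbsRing) f z l.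
Proof.
split; intros [H1 H2]; (split; [apply is_linear_scal_l | exact H2]).
Qed.

Lemma cderiv_mult (f g : C -> C) (z a b : C) : cderiv f z a -> cderiv g z b ->
  cderiv (fun w => f w * g w)%C z (a * g z + f z * b)%C.
Proof.
rewrite !cderiv_AbsRing. intros Hf Hg.
apply (@is_derive_mult C_AbsRing f g z a b Hf Hg). exact Cmult_comm.
Qed.

Lemma cderiv_eq (f : C -> C) (z l l' : C) : cderiv f z l -> l = l' -> cderiv f z l'.
Proof. intros H <-. exact H. Qed.

Lemma cderiv_scal (c : C) (f : C -> C) (z l : C) :
  cderiv f z l -> cderiv (fun w => c * f w)%C z (c * l)%C.
Proof.
intros H. eapply cderiv_eq. apply (cderiv_mult (fun _ => c) f). apply cderiv_const. exact H. ring.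
Qed.

Lemma cderiv_comp (f g : C -> C) (z a b : C) : cderiv f (g z) a -> cderiv g z b ->
  cderiv (fun w => f (g w)) z (b * a)%C.
Proof. rewrite (cderiv_AbsRing g). apply (@is_derive_comp C_AbsRing C_NormedModule). Qed.

Lemma Cmod_sub_comm a b : Cmod (a - b) = Cmod (b - a).
Proof. rewrite <- Cmod_opp. f_equal. ring. Qed.

Lemma Cmod_rev_triangle a b : Cmod a - Cmod b <= Cmod (a - b).
Proof.
pose proof (Cmod_triangle (a - b) b). replace (a - b + b)%C with a in H by ring. lra.
Qed.

Lemma cderiv_Cinv (z : C) : z <> 0 -> cderiv Cinv z (- / (z * z))%C.
Proof.
intros Hz. apply cderiv_eps. intros eps He.
pose proof (proj1 (Cmod_gt_0 z) Hz) as Hm.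
set (m := Cmod z) in *.
(* The first radius keeps |w| > m/2, so the error |w - z|^2 / (|w| m^2) is at most 2 |w - z|^2 /
   m^3; the second radius makes this at most eps |w - z|. *)
exists (Rmin (m / 2) (eps * m ^ 3 / 2)). split.
{ apply Rmin_pos. lra. assert (0 < m ^ 3) by (apply pow_lt; lra). nra. }
intros w Hw.
assert (H1 : Cmod (w - z) < m / 2) by (eapply Rlt_le_trans; [exact Hw|apply Rmin_l]).
assert (H2 : Cmod (w - z) < eps * m ^ 3 / 2) by (eapply Rlt_le_trans; [exact Hw|apply Rmin_r]).
assert (Hwm : m / 2 < Cmod w).
{ pose proof (Cmod_rev_triangle z w). rewrite Cmod_sub_comm in H. fold m in H. lra. }
assert (Hw0 : w <> 0) by (apply Cmod_gt_0; lra).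
replace (/ w - / z - - / (z * z) * (w - z))%C with ((w - z) * ((w - z) * / (w * (z * z))))%C
  by (field; split; assumption).
rewrite !Cmod_mult, Cmod_inv, !Cmod_mult by (repeat apply Cmult_neq_0; assumption).
fold m. rewrite (Rmult_comm eps). apply Rmult_le_compat_l. apply Cmod_ge_0.
assert (0 < m * m) by nra. assert (0 < Cmod w * (m * m)) by nra.
apply Rmult_le_reg_r with (Cmod w * (m * m)); trivial.
rewrite Rmult_assoc, Rinv_l by lra.
assert (eps * m ^ 3 / 2 <= eps * (Cmod w * (m * m))).
{ replace (eps * m ^ 3 / 2) with (eps * (m / 2 * (m * m))) by field.
  apply Rmult_le_compat_l; [lra|]. apply Rmult_le_compat_r; lra. }
lra.
Qed.

Lemma cderiv_inv (g : C -> C) (z b : C) : cderiv g z b -> g z <> 0 ->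
  cderiv (fun w => / g w)%C z (- b / (g z * g z))%C.
Proof.
intros Hg Hz.
replace (- b / (g z * g z))%C with (b * (- / (g z * g z)))%C by (unfold Cdiv; ring).
apply cderiv_comp; trivial. apply cderiv_Cinv, Hz.
Qed.

Lemma cderiv_div (f g : C -> C) (z a b : C) : cderiv f z a -> cderiv g z b -> g z <> 0 ->
  cderiv (fun w => f w / g w)%C z ((a * g z - f z * b) / (g z * g z))%C.
Proof.
intros Hf Hg Hz.
replace ((a * g z - f z * b) / (g z * g z))%C
  with (a * / g z + f z * (- b / (g z * g z)))%C by (field; exact Hz).
apply (cderiv_mult f (fun w => / g w)%C); trivial. apply cderiv_inv; trivial.
Qed.

Lemma cderiv_pow (n : nat) (f : C -> C) (z a : C) : cderiv f z a ->
  cderiv (fun w => f w ^ n)%C z (INR n * a * f z ^ (n - 1))%C.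
Proof.
intros Hf. induction n as [|n IH].
- simpl. replace (0 * a * 1)%C with (RtoC 0) by ring. apply cderiv_const.
- replace (INR (S n) * a * f z ^ (S n - 1))%C
    with (a * f z ^ n + f z * (INR n * a * f z ^ (n - 1)))%C.
  apply (cderiv_mult f (fun w => f w ^ n)%C); trivial.
  rewrite S_INR, RtoC_plus. replace (S n - 1)%nat with n by lia.
  destruct n as [|n]; [simpl; ring|].
  replace (S n - 1)%nat with n by lia. rewrite Cpow_S. ring.
Qed.

Lemma curve_deriv_eps (f : R -> C) (t : R) (l : C) :
  curve_deriv f t l <->
  forall eps, 0 < eps -> exists del, 0 < del /\
    forall u, Rabs (u - t) < del ->
      Cmod (f u - f t - l * RtoC (u - t)) <= eps * Rabs (u - t).
Proof.
assert (E : forall u, @norm R_AbsRing C_R_NormedModule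
    (minus (minus (f u) (f t)) (scal (minus u t : R) l)) =
  Cmod (f u - f t - l * RtoC (u - t))).
{ intros u. rewrite Cmod_norm. f_equal.
  unfold minus, plus, opp, scal; simpl.
  unfold prod_plus, prod_opp, prod_scal, plus, opp, scal; simpl.
  unfold mult, Cminus, Cplus, Copp, Cmult, RtoC; simpl. f_equal; ring. }
split.
- intros [_ H] eps He.
  destruct (H t (fun P HP => HP) (mkposreal eps He)) as [d Hd].
  exists d; split; [apply cond_pos|]; intros w Hw.
  specialize (Hd w Hw). rewrite <- E. exact Hd.
- intros H; split. apply is_linear_scal_l.
  intros x Hx.
  assert (Hxz : t = x) by (apply is_filter_lim_locally_unique, Hx).
  subst x. intros eps.
  destruct (H eps (cond_pos eps)) as [d [Hd Hw]].
  exists (mkposreal d Hd). intros w Hw'.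
  specialize (Hw w Hw'). refine (Rle_trans _ _ _ _ Hw). right. apply E.
Qed.

Lemma curve_deriv_comp (f : C -> C) (g : R -> C) (t : R) (l v : C) :
  cderiv f (g t) l -> curve_deriv g t v -> curve_deriv (fun u => f (g u)) t (l * v)%C.
Proof.
rewrite cderiv_eps, !curve_deriv_eps. intros Hf Hg eps He.
pose proof (Cmod_ge_0 l). pose proof (Cmod_ge_0 v).
set (e1 := eps / 2 / (Cmod v + 1)). set (e2 := eps / 2 / (Cmod l + 1)).
assert (He1 : 0 < e1) by (unfold e1; apply Rdiv_lt_0_compat; lra).
assert (He2 : 0 < e2) by (unfold e2; apply Rdiv_lt_0_compat; lra).
destruct (Hf e1 He1) as [d1 [Hd1 H1]].
destruct (Hg (Rmin 1 e2)) as [d2 [Hd2 H2]]. apply Rmin_pos; lra.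
exists (Rmin d2 (d1 / (Cmod v + 1))). split.
{ apply Rmin_pos; trivial. apply Rdiv_lt_0_compat; lra. }
intros u Hu.
assert (Hu1 : Rabs (u - t) < d2) by (eapply Rlt_le_trans; [exact Hu|apply Rmin_l]).
assert (Hu2 : Rabs (u - t) < d1 / (Cmod v + 1)) by (eapply Rlt_le_trans; [exact Hu|apply Rmin_r]).
specialize (H2 u Hu1).
pose proof (Rabs_pos (u - t)) as Hp.
assert (H2a : Cmod (g u - g t - v * RtoC (u - t)) <= 1 * Rabs (u - t))
  by (eapply Rle_trans; [exact H2|]; apply Rmult_le_compat_r; trivial; apply Rmin_l).
assert (H2b : Cmod (g u - g t - v * RtoC (u - t)) <= e2 * Rabs (u - t))
  by (eapply Rle_trans; [exact H2|]; apply Rmult_le_compat_r; trivial; apply Rmin_r).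
assert (Hgu : Cmod (g u - g t) <= (Cmod v + 1) * Rabs (u - t)).
{ replace (g u - g t)%C with ((g u - g t - v * RtoC (u - t)) + v * RtoC (u - t))%C by ring.
  eapply Rle_trans. apply Cmod_triangle. rewrite Cmod_mult, Cmod_R. lra. }
assert (Hlt : Cmod (g u - g t) < d1).
{ eapply Rle_lt_trans. exact Hgu.
  apply (Rmult_lt_compat_l (Cmod v + 1)) in Hu2; [|lra].
  replace ((Cmod v + 1) * (d1 / (Cmod v + 1))) with d1 in Hu2 by (field; lra). exact Hu2. }
specialize (H1 _ Hlt).
replace (f (g u) - f (g t) - l * v * RtoC (u - t))%C with
  ((f (g u) - f (g t) - l * (g u - g t)) + l * (g u - g t - v * RtoC (u - t)))%C by ring.
eapply Rle_trans. apply Cmod_triangle. rewrite Cmod_mult.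
assert (e1 * Cmod (g u - g t) <= eps / 2 * Rabs (u - t)).
{ replace (eps / 2) with (e1 * (Cmod v + 1)) by (unfold e1; field; lra).
  rewrite Rmult_assoc. apply Rmult_le_compat_l; lra. }
assert (Cmod l * Cmod (g u - g t - v * RtoC (u - t)) <= eps / 2 * Rabs (u - t)).
{ apply Rle_trans with ((Cmod l + 1) * (e2 * Rabs (u - t))).
  - apply Rmult_le_compat; try lra. apply Cmod_ge_0.
  - right. unfold e2. field. lra. }
lra.
Qed.

Lemma curve_deriv_pair (f1 f2 : R -> R) (t l1 l2 : R) :
  is_derive f1 t l1 -> is_derive f2 t l2 -> curve_deriv (fun u => (f1 u, f2 u)) t (l1, l2).
Proof.
intros H1 H2. apply curve_deriv_eps. intros eps He.
assert (K : forall f l, is_derive f t l -> forall e, 0 < e -> exists del, 0 < del /\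
   forall u, Rabs (u - t) < del -> Rabs (f u - f t - l * (u - t)) <= e * Rabs (u - t)).
{ intros f l [_ H] e Hee.
  destruct (H t (fun P HP => HP) (mkposreal e Hee)) as [d Hd].
  exists d; split; [apply cond_pos|]; intros w Hw. specialize (Hd w Hw).
  unfold norm, minus, plus, opp, scal, abs in Hd; simpl in Hd.
  unfold mult, abs in Hd; simpl in Hd.
  replace (f w - f t - l * (w - t)) with (f w + - f t + - ((w + - t) * l)) by ring. exact Hd. }
destruct (K _ _ H1 (eps / 2)) as [d1 [Hd1 K1]]. lra.
destruct (K _ _ H2 (eps / 2)) as [d2 [Hd2 K2]]. lra.
exists (Rmin d1 d2). split. apply Rmin_pos; trivial.
intros u Hu.
specialize (K1 u (Rlt_le_trans _ _ _ Hu (Rmin_l _ _))).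
specialize (K2 u (Rlt_le_trans _ _ _ Hu (Rmin_r _ _))).
replace ((f1 u, f2 u) - (f1 t, f2 t) - (l1, l2) * RtoC (u - t))%C
  with (RtoC (f1 u - f1 t - l1 * (u - t)) + Ci * RtoC (f2 u - f2 t - l2 * (u - t)))%C.
2:{ unfold Cminus, Cplus, Copp, Cmult, RtoC, Ci; simpl. f_equal; ring. }
eapply Rle_trans. apply Cmod_triangle. rewrite Cmod_mult, Cmod_Ci, !Cmod_R. lra.
Qed.

Lemma curve_deriv_fst (f : R -> C) (t : R) (l : C) : curve_deriv f t l -> is_derive (fun u => fst (f u)) t (fst l).
Proof.
intros H. split. apply is_linear_scal_l.
intros x Hx. assert (Hxz : t = x) by (apply is_filter_lim_locally_unique, Hx). subst x.
intros eps. rewrite curve_deriv_eps in H. destruct (H eps (cond_pos eps)) as [d [Hd Hw]].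
exists (mkposreal d Hd). intros w Hw'. specialize (Hw w Hw').
eapply Rle_trans; [|exact Hw].
eapply Rle_trans; [|apply re_le_Cmod].
unfold norm, minus, plus, opp, scal, abs; simpl. unfold mult, abs; simpl.
right. f_equal. ring.
Qed.

(** The imaginary part of f is the real part of -i f. *)
Lemma curve_deriv_snd (f : R -> C) (t : R) (l : C) :
  curve_deriv f t l -> is_derive (fun u => snd (f u)) t (snd l).
Proof.
intros H.
assert (H' : curve_deriv (fun u => (- Ci * f u)%C) t (- Ci * l)%C).
{ apply (curve_deriv_comp (fun w => - Ci * w)%C f); trivial.
  eapply cderiv_eq. apply (cderiv_scal (- Ci)%C (fun w => w)), cderiv_id. ring. }
apply curve_deriv_fst in H'.
replace (snd l) with (fst (- Ci * l)%C) by (simpl; ring).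
apply is_derive_ext with (2 := H'). intros u. simpl. ring.
Qed.

Notation Ccont f x := (@continuous _ C_UniformSpace f x).
Notation Rcont f x := (@continuous R_UniformSpace C_UniformSpace f x).

Section Continuity.
Context {U : UniformSpace}.
Implicit Types (f g : U -> C) (x : U).

Lemma Ccont_pair (f1 f2 : U -> R) x :
  continuous f1 x -> continuous f2 x -> Ccont (fun u => (f1 u, f2 u)) x.
Proof.
intros H1 H2.
apply (continuous_comp_2 f1 f2 (fun a b => (a, b)) x H1 H2).
apply (continuous_ext (fun p => p)); [intros [a b]; reflexivity | apply continuous_id].
Qed.

Lemma Ccont_fst f x : Ccont f x -> continuous (fun u => fst (f u)) x.
Proof. intros H. apply continuous_comp; trivial. apply continuous_fst. Qed.

Lemma Ccont_snd f x : Ccont f x -> continuous (fun u => snd (f u)) x.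
Proof. intros H. apply continuous_comp; trivial. apply continuous_snd. Qed.

Lemma Ccont_plus f g x : Ccont f x -> Ccont g x -> Ccont (fun u => f u + g u)%C x.
Proof.
intros Hf Hg. apply Ccont_pair.
apply (continuous_plus (fun u => fst (f u)) (fun u => fst (g u))); apply Ccont_fst; trivial.
apply (continuous_plus (fun u => snd (f u)) (fun u => snd (g u))); apply Ccont_snd; trivial.
Qed.

Lemma Ccont_opp f x : Ccont f x -> Ccont (fun u => - f u)%C x.
Proof.
intros Hf. apply Ccont_pair.
apply (continuous_opp (fun u => fst (f u))), Ccont_fst; trivial.
apply (continuous_opp (fun u => snd (f u))), Ccont_snd; trivial.
Qed.

Lemma Ccont_minus f g x : Ccont f x -> Ccont g x -> Ccont (fun u => f u - g u)%C x.
Proof.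
intros Hf Hg. apply (Ccont_plus f (fun u => - g u)%C); trivial. apply Ccont_opp; trivial.
Qed.

Lemma Ccont_mult f g x : Ccont f x -> Ccont g x -> Ccont (fun u => f u * g u)%C x.
Proof.
intros Hf Hg.
pose proof (Ccont_fst _ _ Hf). pose proof (Ccont_snd _ _ Hf).
pose proof (Ccont_fst _ _ Hg). pose proof (Ccont_snd _ _ Hg).
apply Ccont_pair.
- apply (continuous_minus (fun u => fst (f u) * fst (g u)) (fun u => snd (f u) * snd (g u)));
  apply (continuous_mult (K := R_AbsRing)); trivial.
- apply (continuous_plus (fun u => fst (f u) * snd (g u)) (fun u => snd (f u) * fst (g u)));
  apply (continuous_mult (K := R_AbsRing)); trivial.
Qed.

Lemma Ccont_comp (h : C -> C) f x : ccontinuous h (f x) -> Ccont f x -> Ccont (fun u => h (f u)) x.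
Proof. intros Hh Hf. apply (continuous_comp f h); trivial. Qed.

Lemma Ccont_inv f x : f x <> 0 -> Ccont f x -> Ccont (fun u => / f u)%C x.
Proof.
intros H0 Hf. apply Ccont_comp; trivial. eapply cderiv_continuous, cderiv_Cinv, H0.
Qed.

Lemma Ccont_pow f n x : Ccont f x -> Ccont (fun u => f u ^ n)%C x.
Proof.
intros Hf. induction n as [|n IH]. apply continuous_const. apply (Ccont_mult f _); trivial.
Qed.

Lemma continuous_Cmod f x : Ccont f x -> continuous (fun u => Cmod (f u)) x.
Proof.
intros H. apply (continuous_comp (fun u => fst (f u) ^ 2 + snd (f u) ^ 2) sqrt).
2: apply continuous_sqrt.
apply (continuous_ext (fun u => fst (f u) * fst (f u) + snd (f u) * snd (f u))).
{ intros u. change (fst (f u) * fst (f u) + snd (f u) * snd (f u) = fst (f u) ^ 2 + snd (f u) ^ 2 :> R). ring. }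
pose proof (Ccont_fst _ _ H). pose proof (Ccont_snd _ _ H).
apply (continuous_plus (V := R_NormedModule)); apply (continuous_mult (K := R_AbsRing)); trivial.
Qed.
End Continuity.


Lemma curve_deriv_cont (f : R -> C) (t : R) (l : C) : curve_deriv f t l -> Rcont f t.
Proof.
intros H. apply (@ex_derive_continuous R_AbsRing C_R_NormedModule). exists l. exact H.
Qed.

Lemma scal_C (k : R) (z : C) : @scal R_AbsRing C_R_NormedModule k z = (RtoC k * z)%C.
Proof.
unfold scal; simpl; unfold prod_scal, scal; simpl; unfold mult, Cmult, RtoC; simpl.
f_equal; ring.
Qed.

Section Integrals.
Implicit Types (f g : R -> C) (a b : R) (c l m : C).

Lemma ex_CInt_cont f a b : a <= b -> (forall t, a <= t <= b -> Rcont f t) ->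
  is_CInt f a b (CInt f a b).
Proof.
intros Hab H. apply (@RInt_correct C_R_CompleteNormedModule).
apply (@ex_RInt_continuous C_R_CompleteNormedModule). intros t.
rewrite Rmin_left, Rmax_right by trivial. apply H.
Qed.

Lemma is_CInt_unique f a b l : is_CInt f a b l -> CInt f a b = l.
Proof. apply (@is_RInt_unique C_R_CompleteNormedModule). Qed.

Lemma is_CInt_scal c f a b l : is_CInt f a b l -> is_CInt (fun t => c * f t)%C a b (c * l)%C.
Proof.
intros H. destruct c as [c1 c2].
pose proof (is_RInt_fct_extend_fst _ _ _ _ H) as H1.
pose proof (is_RInt_fct_extend_snd _ _ _ _ H) as H2.
apply (@is_RInt_fct_extend_pair R_NormedModule R_NormedModule).
- simpl. apply (is_RInt_minus (V := R_NormedModule));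
  apply (is_RInt_scal (V := R_NormedModule)); assumption.
- simpl. apply (is_RInt_plus (V := R_NormedModule));
  apply (is_RInt_scal (V := R_NormedModule)); assumption.
Qed.

Lemma is_CInt_plus f g a b l m : is_CInt f a b l -> is_CInt g a b m ->
  is_CInt (fun t => f t + g t)%C a b (l + m)%C.
Proof. apply (@is_RInt_plus C_R_NormedModule). Qed.

Lemma is_CInt_minus f g a b l m : is_CInt f a b l -> is_CInt g a b m ->
  is_CInt (fun t => f t - g t)%C a b (l - m)%C.
Proof. apply (@is_RInt_minus C_R_NormedModule). Qed.

Lemma is_CInt_ext f g a b l : a <= b -> (forall t, a < t < b -> f t = g t) ->
  is_CInt f a b l -> is_CInt g a b l.
Proof.
intros Hab H. apply is_RInt_ext. intros t. rewrite Rmin_left, Rmax_right by trivial. apply H.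
Qed.

Lemma is_CInt_const c a b : is_CInt (fun _ => c) a b (RtoC (b - a) * c)%C.
Proof.
rewrite <- scal_C. apply (@is_RInt_const C_R_NormedModule).
Qed.

Lemma is_CInt_le_const f a b l M : a <= b -> (forall t, a <= t <= b -> Cmod (f t) <= M) ->
  is_CInt f a b l -> Cmod l <= (b - a) * M.
Proof.
intros Hab H Hl. rewrite Cmod_norm.
apply (@norm_RInt_le_const C_R_NormedModule f a b l M); trivial.
intros t Ht. rewrite <- Cmod_norm. apply H, Ht.
Qed.

Lemma is_CInt_le f (h : R -> R) a b l lh : a <= b ->
  (forall t, a <= t <= b -> Cmod (f t) <= h t) ->
  is_CInt f a b l -> is_RInt h a b lh -> Cmod l <= lh.
Proof.
intros Hab H Hl Hh. rewrite Cmod_norm.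
apply (@norm_RInt_le C_R_NormedModule f h a b l lh); trivial.
intros t Ht. rewrite <- Cmod_norm. apply H, Ht.
Qed.

Lemma is_CInt_deriv f g a b : a <= b ->
  (forall t, a <= t <= b -> curve_deriv f t (g t)) ->
  (forall t, a <= t <= b -> Rcont g t) ->
  is_CInt g a b (f b - f a)%C.
Proof.
intros Hab H1 H2.
apply (@is_RInt_derive C_R_CompleteNormedModule f g a b); intros t;
rewrite Rmin_left, Rmax_right by trivial; [apply H1 | apply H2].
Qed.
End Integrals.

Lemma RtoC_neq (x y : R) : x <> y -> RtoC x <> RtoC y.
Proof. intros H E. apply H, (f_equal fst E). Qed.

(** * Goursat's theorem for triangles *)

Definition seg_pt (a b : C) (t : R) : C := (a + RtoC t * (b - a))%C.

Definition seg_int (f : C -> C) (a b : C) : C :=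
  ((b - a) * CInt (fun t => f (seg_pt a b t)) 0 1)%C.

Lemma seg_pt_ball a b c t M : 0 <= t <= 1 -> Cmod (a - c) <= M -> Cmod (b - c) <= M ->
  Cmod (seg_pt a b t - c) <= M.
Proof.
intros Ht Ha Hb. unfold seg_pt.
replace (a + RtoC t * (b - a) - c)%C with (RtoC (1 - t) * (a - c) + RtoC t * (b - c))%C
  by (rewrite RtoC_minus; ring).
eapply Rle_trans. apply Cmod_triangle. rewrite !Cmod_mult, !Cmod_R, !Rabs_pos_eq by lra. nra.
Qed.

Lemma seg_pt_disc a b t M : 0 <= t <= 1 -> Cmod a <= M -> Cmod b <= M ->
  Cmod (seg_pt a b t) <= M.
Proof.
intros Ht Ha Hb. replace (seg_pt a b t) with (seg_pt a b t - 0)%C by ring.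
apply seg_pt_ball; trivial; unfold Cminus; rewrite Copp_0, Cplus_0_r; trivial.
Qed.

Lemma seg_pt_unit_disc a b t : 0 <= t <= 1 -> unit_disc a -> unit_disc b -> unit_disc (seg_pt a b t).
Proof.
unfold unit_disc. intros Ht Ha Hb.
eapply Rle_lt_trans. apply (seg_pt_disc a b t (Rmax (Cmod a) (Cmod b))); trivial.
apply Rmax_l. apply Rmax_r. apply Rmax_lub_lt; trivial.
Qed.

Lemma seg_pt_deriv a b t : curve_deriv (seg_pt a b) t (b - a)%C.
Proof.
apply curve_deriv_eps. intros eps He. exists 1. split. lra. intros u _.
unfold seg_pt. replace (_ - _)%C with (RtoC 0) by (rewrite RtoC_minus; ring).
rewrite Cmod_0. pose proof (Rabs_pos (u - t)). nra.
Qed.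

Lemma seg_pt_cont a b t : Rcont (seg_pt a b) t.
Proof. eapply curve_deriv_cont, seg_pt_deriv. Qed.

Definition cont_disc (f : C -> C) := forall z, unit_disc z -> ccontinuous f z.

Lemma holo_cont f : holo f -> cont_disc f.
Proof. intros H z Hz. destruct (H z Hz) as [l Hl]. eapply cderiv_continuous, Hl. Qed.

Section Segments.
Context (f : C -> C) (Hf : cont_disc f).

Lemma seg_cont a b t : unit_disc a -> unit_disc b -> 0 <= t <= 1 ->
  Rcont (fun t => f (seg_pt a b t)) t.
Proof.
intros Ha Hb Ht. apply Ccont_comp. apply Hf, seg_pt_unit_disc; trivial. apply seg_pt_cont.
Qed.

Lemma is_seg_int a b : unit_disc a -> unit_disc b ->
  is_CInt (fun t => (b - a) * f (seg_pt a b t))%C 0 1 (seg_int f a b).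
Proof.
intros Ha Hb. apply is_CInt_scal. apply ex_CInt_cont. lra. intros t Ht. apply seg_cont; trivial.
Qed.

Lemma seg_int_unique a b l : is_CInt (fun t => (b - a) * f (seg_pt a b t))%C 0 1 l ->
  unit_disc a -> unit_disc b -> seg_int f a b = l.
Proof.
intros H Ha Hb. apply is_CInt_unique in H. rewrite <- H. symmetry.
apply is_CInt_unique, is_seg_int; trivial.
Qed.

Lemma seg_int_rev a b : unit_disc a -> unit_disc b -> seg_int f b a = (- seg_int f a b)%C.
Proof.
intros Ha Hb. apply seg_int_unique; trivial.
pose proof (is_seg_int a b Ha Hb) as H.
apply (@is_RInt_swap C_R_NormedModule) in H.
pose proof (@is_RInt_comp_lin C_R_NormedModule (fun t => (b - a) * f (seg_pt a b t))%C
   (-1) 1 0 1 (- seg_int f a b)%C) as K.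
replace (-1 * 0 + 1) with 1 in K by ring. replace (-1 * 1 + 1) with 0 in K by ring.
specialize (K H). eapply is_CInt_ext with (3 := K). lra. intros t Ht.
replace (seg_pt b a t) with (seg_pt a b (-1 * t + 1)).
2:{ unfold seg_pt. rewrite RtoC_plus, RtoC_mult. ring. }
rewrite scal_C. ring.
Qed.

Lemma seg_int_mid a b : unit_disc a -> unit_disc b ->
  let m := ((a + b) / 2)%C in unit_disc m /\
  seg_int f a b = (seg_int f a m + seg_int f m b)%C.
Proof.
intros Ha Hb m.
assert (Em : m = seg_pt a b (/ 2)).
{ unfold m, seg_pt. rewrite RtoC_inv by lra. field. }
assert (Hm : unit_disc m) by (rewrite Em; apply seg_pt_unit_disc; trivial; lra).
split; trivial. apply seg_int_unique; trivial.
pose proof (is_seg_int a m Ha Hm) as H1.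
pose proof (is_seg_int m b Hm Hb) as H2.
apply (@is_RInt_Chasles C_R_NormedModule _ 0 (/2) 1).
- pose proof (@is_RInt_comp_lin C_R_NormedModule (fun t => (m - a) * f (seg_pt a m t))%C 2 0 0 (/2) (seg_int f a m)) as K.
  replace (2 * 0 + 0) with 0 in K by ring. replace (2 * / 2 + 0) with 1 in K by field.
  specialize (K H1). eapply is_CInt_ext with (3 := K). lra. intros t Ht.
  replace (seg_pt a m (2 * t + 0)) with (seg_pt a b t).
  2:{ rewrite Em. unfold seg_pt. rewrite RtoC_plus, RtoC_mult, RtoC_inv by lra. field. }
  rewrite scal_C. unfold m. field.
- pose proof (@is_RInt_comp_lin C_R_NormedModule (fun t => (b - m) * f (seg_pt m b t))%C 2 (-1) (/2) 1 (seg_int f m b)) as K.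
  replace (2 * / 2 + -1) with 0 in K by field. replace (2 * 1 + -1) with 1 in K by ring.
  specialize (K H2). eapply is_CInt_ext with (3 := K). lra. intros t Ht.
  replace (seg_pt m b (2 * t + -1)) with (seg_pt a b t).
  2:{ rewrite Em. unfold seg_pt. rewrite RtoC_plus, RtoC_mult, RtoC_inv by lra. field. }
  rewrite scal_C. unfold m. field.
Qed.

Lemma seg_int_bound a b M : unit_disc a -> unit_disc b ->
  (forall t, 0 <= t <= 1 -> Cmod (f (seg_pt a b t)) <= M) ->
  Cmod (seg_int f a b) <= Cmod (b - a) * M.
Proof.
intros Ha Hb HM.
replace (Cmod (b - a) * M) with ((1 - 0) * (Cmod (b - a) * M)) by ring.
eapply is_CInt_le_const; [lra | | apply is_seg_int; trivial].
intros t Ht. simpl. rewrite Cmod_mult. apply Rmult_le_compat_l. apply Cmod_ge_0. apply HM, Ht.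
Qed.

Lemma seg_int_FTC F a b : unit_disc a -> unit_disc b ->
  (forall z, unit_disc z -> cderiv F z (f z)) -> seg_int f a b = (F b - F a)%C.
Proof.
intros Ha Hb HF. apply seg_int_unique; trivial.
replace (F b) with (F (seg_pt a b 1)) by (f_equal; unfold seg_pt; ring).
replace (F a) with (F (seg_pt a b 0)) by (f_equal; unfold seg_pt; ring).
apply (is_CInt_deriv (fun t => F (seg_pt a b t))). lra.
- intros t Ht. rewrite Cmult_comm. apply curve_deriv_comp; [|apply seg_pt_deriv].
  apply HF, seg_pt_unit_disc; trivial.
- intros t Ht. apply Ccont_mult. apply continuous_const. apply seg_cont; trivial.
Qed.
End Segments.

Lemma seg_int_minus f g a b : cont_disc f -> cont_disc g -> unit_disc a -> unit_disc b ->
  seg_int (fun z => f z - g z)%C a b = (seg_int f a b - seg_int g a b)%C.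
Proof.
intros Hf Hg Ha Hb. apply seg_int_unique; trivial.
- intros z Hz. apply Ccont_minus; [apply Hf | apply Hg]; trivial.
- eapply is_CInt_ext; [lra | | apply (is_CInt_minus _ _ _ _ _ _ (is_seg_int f Hf a b Ha Hb) (is_seg_int g Hg a b Ha Hb))].
  intros t _. simpl. ring.
Qed.

(** An affine function has the quadratic primitive [G], so subtracting it changes a segment integral
    by a difference that telescopes around a triangle. It is applied to first-order expansions at a
    point, after which only the o(|w - z|) remainder is left to integrate. *)
Lemma seg_int_affine f A l z a b : cont_disc f -> unit_disc a -> unit_disc b ->
  let G w := (A * w + l / 2 * ((w - z) * (w - z)))%C in
  cont_disc (fun w => f w - (A + l * (w - z)))%C /\
  seg_int (fun w => f w - (A + l * (w - z)))%C a b = (seg_int f a b - (G b - G a))%C.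
Proof.
intros Hf Ha Hb G. set (g w := (A + l * (w - z))%C).
assert (Dz : forall w, cderiv (fun w => w - z)%C w (RtoC 1)).
{ intros w. eapply cderiv_eq. apply (cderiv_minus (fun w => w) (fun _ => z)).
  apply cderiv_id. apply cderiv_const. ring. }
assert (DG : forall w, cderiv G w (g w)).
{ intros w. unfold G. eapply cderiv_eq.
  apply (cderiv_plus (fun w => A * w)%C). apply (cderiv_scal _ (fun w => w)), cderiv_id.
  apply (cderiv_scal _ (fun w => (w - z) * (w - z))%C).
  apply (cderiv_mult (fun w => w - z)%C (fun w => w - z)%C); apply Dz.
  unfold g. field. }
assert (Cg : cont_disc g).
{ intros w _. eapply cderiv_continuous. apply (cderiv_plus (fun _ => A)).
  apply cderiv_const. apply cderiv_scal, Dz. }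
split.
- intros w Hw. apply Ccont_minus; [apply Hf | apply Cg]; trivial.
- rewrite (seg_int_minus f g), (seg_int_FTC g Cg G); auto.
Qed.

Definition tri_int f a b c := (seg_int f a b + seg_int f b c + seg_int f c a)%C.

Record triangle := Tri { va : C; vb : C; vc : C }.
Definition tint f T := tri_int f (va T) (vb T) (vc T).
Definition in_disc r T := Cmod (va T) <= r /\ Cmod (vb T) <= r /\ Cmod (vc T) <= r.
Definition sides_le d T :=
  Cmod (va T - vb T) <= d /\ Cmod (vb T - vc T) <= d /\ Cmod (vc T - va T) <= d.

Definition mid (a b : C) : C := ((a + b) / 2)%C.

(** The last branch needs no test: the four integrals add up to the whole, so if three are below a
    quarter of it in modulus, the fourth is not. The vertices are listed so that the first one moves
    by at most half a side, which makes the first vertices a Cauchy sequence. *)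
Definition bisect (f : C -> C) (T : triangle) : triangle :=
  let (a, b, c) := T in
  let T1 := Tri a (mid a b) (mid c a) in
  let T2 := Tri (mid a b) b (mid b c) in
  let T3 := Tri (mid c a) (mid b c) c in
  let T4 := Tri (mid a b) (mid b c) (mid c a) in
  let q := Cmod (tint f T) / 4 in
  if Rle_dec q (Cmod (tint f T1)) then T1 else
  if Rle_dec q (Cmod (tint f T2)) then T2 else
  if Rle_dec q (Cmod (tint f T3)) then T3 else T4.

Lemma two_neq_0 : RtoC 2 <> 0.
Proof. apply RtoC_neq. lra. Qed.

Lemma Cmod_half a : Cmod (a / 2) = Cmod a / 2.
Proof. rewrite Cmod_div, Cmod_R, Rabs_pos_eq by (try apply two_neq_0; lra). reflexivity. Qed.

Lemma Cmod_mid a b r : Cmod a <= r -> Cmod b <= r -> Cmod (mid a b) <= r.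
Proof.
intros Ha Hb. unfold mid. rewrite Cmod_half.
pose proof (Cmod_triangle a b). lra.
Qed.

Lemma bisect_spec f T r d : cont_disc f -> r < 1 -> in_disc r T -> sides_le d T ->
  in_disc r (bisect f T) /\ sides_le (d / 2) (bisect f T) /\
  Cmod (tint f T) / 4 <= Cmod (tint f (bisect f T)) /\
  Cmod (va (bisect f T) - va T) <= d / 2.
Proof.
intros Hf Hr HT Hs. destruct T as [a b c].
destruct HT as [Ra [Rb Rc]]. destruct Hs as [S1 [S2 S3]]. simpl in *.
assert (Hab := Cmod_mid _ _ _ Ra Rb). assert (Hbc := Cmod_mid _ _ _ Rb Rc).
assert (Hca := Cmod_mid _ _ _ Rc Ra).
assert (Ua : unit_disc a) by (unfold unit_disc; lra).
assert (Ub : unit_disc b) by (unfold unit_disc; lra).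
assert (Uc : unit_disc c) by (unfold unit_disc; lra).
assert (Uab : unit_disc (mid a b)) by (unfold unit_disc; lra).
assert (Ubc : unit_disc (mid b c)) by (unfold unit_disc; lra).
assert (Uca : unit_disc (mid c a)) by (unfold unit_disc; lra).
assert (E : tint f (Tri a b c) =
  (tint f (Tri a (mid a b) (mid c a)) + tint f (Tri (mid a b) b (mid b c)) +
   tint f (Tri (mid c a) (mid b c) c) + tint f (Tri (mid a b) (mid b c) (mid c a)))%C).
{ unfold tint, tri_int; simpl.
  rewrite (proj2 (seg_int_mid f Hf a b Ua Ub)), (proj2 (seg_int_mid f Hf b c Ub Uc)),
    (proj2 (seg_int_mid f Hf c a Uc Ua)).
  fold (mid a b) (mid b c) (mid c a).
  rewrite (seg_int_rev f Hf (mid a b) (mid b c) Uab Ubc),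
    (seg_int_rev f Hf (mid b c) (mid c a) Ubc Uca),
    (seg_int_rev f Hf (mid c a) (mid a b) Uca Uab). ring. }
set (q := Cmod (tint f (Tri a b c)) / 4) in *.
assert (K : forall T',
  in_disc r T' /\ sides_le (d / 2) T' /\ Cmod (va T' - a) <= d / 2 -> q <= Cmod (tint f T') ->
  in_disc r T' /\ sides_le (d / 2) T' /\ q <= Cmod (tint f T') /\ Cmod (va T' - a) <= d / 2)
 by tauto.
assert (D0 : 0 <= d) by (eapply Rle_trans; [apply Cmod_ge_0 | exact S1]).
pose proof two_neq_0 as N2.
assert (S1' : Cmod (b - a) <= d) by (rewrite Cmod_sub_comm; trivial).
assert (S2' : Cmod (c - b) <= d) by (rewrite Cmod_sub_comm; trivial).
assert (S3' : Cmod (a - c) <= d) by (rewrite Cmod_sub_comm; trivial).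
assert (SS : forall u v, (u - v = (b - a) / 2)%C \/ (u - v = (c - b) / 2)%C \/ (u - v = (a - c) / 2)%C \/
   (u - v = (a - b) / 2)%C \/ (u - v = (b - c) / 2)%C \/ (u - v = (c - a) / 2)%C \/ (u - v = 0)%C ->
   Cmod (u - v) <= d / 2).
{ intros u v Huv. decompose [or] Huv; clear Huv;
  match goal with H : _ = _ |- _ => rewrite H end; rewrite ?Cmod_half, ?Cmod_0; lra. }
destruct (Rle_dec q (Cmod (tint f (Tri a (mid a b) (mid c a))))) as [L1|L1].
{ apply K; trivial. repeat split; simpl; trivial; apply SS; unfold mid;
  repeat first [left; solve [field; trivial] | right]; ring. }
destruct (Rle_dec q (Cmod (tint f (Tri (mid a b) b (mid b c))))) as [L2|L2].
{ apply K; trivial. repeat split; simpl; trivial; apply SS; unfold mid;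
  repeat first [left; solve [field; trivial] | right]; ring. }
destruct (Rle_dec q (Cmod (tint f (Tri (mid c a) (mid b c) c)))) as [L3|L3].
{ apply K; trivial. repeat split; simpl; trivial; apply SS; unfold mid;
  repeat first [left; solve [field; trivial] | right]; ring. }
apply K; trivial.
- repeat split; simpl; trivial; apply SS; unfold mid;
  repeat first [left; solve [field; trivial] | right]; ring.
- pose proof (f_equal Cmod E) as E'.
  pose proof (Cmod_triangle (tint f (Tri a (mid a b) (mid c a)) + tint f (Tri (mid a b) b (mid b c)) +
   tint f (Tri (mid c a) (mid b c) c)) (tint f (Tri (mid a b) (mid b c) (mid c a)))) as t1.
  pose proof (Cmod_triangle (tint f (Tri a (mid a b) (mid c a)) + tint f (Tri (mid a b) b (mid b c)))
   (tint f (Tri (mid c a) (mid b c) c))) as t2.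
  pose proof (Cmod_triangle (tint f (Tri a (mid a b) (mid c a))) (tint f (Tri (mid a b) b (mid b c)))) as t3.
  unfold q in *. lra.
Qed.

(** The intervals of centre [u n] and radius [e n = 2 d / 2^n] are nested because
    [e n - e (S n) = d / 2^n]. The limit is the supremum of their left ends and comes with its rate
    of convergence. *)
Lemma dyadic_cauchy (u : nat -> R) d : 0 <= d ->
  (forall n, Rabs (u (S n) - u n) <= d / 2 ^ n) ->
  exists l, forall n, Rabs (u n - l) <= 2 * d / 2 ^ n.
Proof.
intros Hd H.
assert (P2 : forall n, 0 < 2 ^ n) by (intros; apply pow_lt; lra).
set (e n := 2 * d / 2 ^ n).
assert (e0 : forall n, 0 <= e n).
{ intros n. unfold e. apply Rmult_le_pos; [lra|]. left. apply Rinv_0_lt_compat, P2. }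
assert (eS : forall n, e (S n) + d / 2 ^ n = e n).
{ intros n. unfold e. simpl. field. apply Rgt_not_eq, P2. }
assert (K : forall k n, u (n + k)%nat - e (n + k)%nat >= u n - e n /\ u (n + k)%nat + e (n + k)%nat <= u n + e n).
{ induction k as [|k IH]; intros n. rewrite Nat.add_0_r. lra.
  rewrite Nat.add_succ_r. specialize (IH n). specialize (H (n + k)%nat).
  specialize (eS (n + k)%nat). apply Rabs_le_between in H. lra. }
assert (L : forall n m, u n - e n <= u m + e m).
{ intros n m. destruct (Nat.le_ge_cases n m) as [Hnm|Hnm].
  - destruct (K (m - n)%nat n) as [K1 K2]. replace (n + (m - n))%nat with m in * by lia.
    specialize (e0 m). lra.
  - destruct (K (n - m)%nat m) as [K1 K2]. replace (m + (n - m))%nat with n in * by lia.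
    specialize (e0 n). lra. }
destruct (completeness (fun x => exists n, x = u n - e n)) as [l [Hl1 Hl2]].
- exists (u O + e O). intros x [n ->]. apply L.
- exists (u O - e O), O. reflexivity.
- exists l. intros n. fold (e n). apply Rabs_le_between.
  assert (u n - e n <= l) by (apply Hl1; exists n; reflexivity).
  assert (l <= u n + e n) by (apply Hl2; intros x [m ->]; apply L).
  lra.
Qed.

Lemma Cmod_le_Rabs z : Cmod z <= Rabs (fst z) + Rabs (snd z).
Proof.
replace z with (RtoC (fst z) + Ci * RtoC (snd z))%C at 1.
2:{ destruct z; unfold Cplus, Cmult, RtoC, Ci; simpl. f_equal; ring. }
eapply Rle_trans. apply Cmod_triangle. rewrite Cmod_mult, Cmod_Ci, !Cmod_R. lra.
Qed.

Lemma Rabs_fst_le z : Rabs (fst z) <= Cmod z.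
Proof. apply re_le_Cmod. Qed.

Lemma Rabs_snd_le z : Rabs (snd z) <= Cmod z.
Proof. eapply Rle_trans; [apply Rmax_r | apply Rmax_Cmod]. Qed.

Lemma dyadic_small d x : 0 <= d -> 0 < x -> exists n, d / 2 ^ n < x.
Proof.
intros Hd Hx. destruct (pow_lt_1_zero (/ 2)) with (y := x / (d + 1)) as [n Hn].
rewrite Rabs_pos_eq; lra. apply Rdiv_lt_0_compat; lra.
exists n. specialize (Hn n (Nat.le_refl n)).
assert (Hp : 0 < (/ 2) ^ n) by (apply pow_lt; lra).
rewrite Rabs_pos_eq in Hn by lra. rewrite pow_inv in *.
apply (Rmult_lt_compat_l (d + 1)) in Hn; [|lra].
replace ((d + 1) * (x / (d + 1))) with x in Hn by (field; lra).
unfold Rdiv. lra.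
Qed.

Theorem goursat f a b c : holo f -> unit_disc a -> unit_disc b -> unit_disc c ->
  tri_int f a b c = 0.
Proof.
intros Hf Ha Hb Hc.
pose proof (holo_cont f Hf) as Hcont.
set (r := Rmax (Cmod a) (Rmax (Cmod b) (Cmod c))).
assert (Hr : r < 1) by (unfold r; repeat apply Rmax_lub_lt; assumption).
set (d := Cmod (a - b) + Cmod (b - c) + Cmod (c - a)).
pose proof (Cmod_ge_0 (a - b)). pose proof (Cmod_ge_0 (b - c)). pose proof (Cmod_ge_0 (c - a)).
assert (Hd : 0 <= d) by (unfold d; lra).
set (T n := Nat.iter n (bisect f) (Tri a b c)).
assert (P2 : forall n, 0 < 2 ^ n) by (intros; apply pow_lt; lra).
assert (I : forall n, in_disc r (T n) /\ sides_le (d / 2 ^ n) (T n) /\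
   Cmod (tint f (T O)) <= 4 ^ n * Cmod (tint f (T n))).
{ induction n as [|n [I1 [I2 I3]]].
  - simpl. repeat split; simpl; unfold r, d; try lra.
    apply Rmax_l. eapply Rle_trans; [apply Rmax_l | apply Rmax_r].
    eapply Rle_trans; [apply Rmax_r | apply Rmax_r].
  - destruct (bisect_spec f (T n) r _ Hcont Hr I1 I2) as [J1 [J2 [J3 _]]].
    change (bisect f (T n)) with (T (S n)) in *.
    split; [exact J1|split].
    + replace (d / 2 ^ S n) with (d / 2 ^ n / 2). exact J2. simpl. field. apply Rgt_not_eq, P2.
    + eapply Rle_trans. exact I3.
      replace (4 ^ S n) with (4 ^ n * 4) by (simpl; ring). rewrite Rmult_assoc.
      apply Rmult_le_compat_l; [left; apply pow_lt; lra | lra]. }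
assert (J : forall n, Cmod (va (T (S n)) - va (T n)) <= d / 2 ^ n).
{ intros n. destruct (I n) as [I1 [I2 I3]].
  destruct (bisect_spec f (T n) r _ Hcont Hr I1 I2) as [_ [_ [_ J4]]].
  change (bisect f (T n)) with (T (S n)) in *.
  assert (0 <= d / 2 ^ n) by (apply Rmult_le_pos; [|left; apply Rinv_0_lt_compat]; auto). lra. }
destruct (dyadic_cauchy (fun n => fst (va (T n))) d Hd) as [l1 L1].
{ intros n. eapply Rle_trans; [|apply (J n)]. apply (Rabs_fst_le (va (T (S n)) - va (T n))%C). }
destruct (dyadic_cauchy (fun n => snd (va (T n))) d Hd) as [l2 L2].
{ intros n. eapply Rle_trans; [|apply (J n)]. apply (Rabs_snd_le (va (T (S n)) - va (T n))%C). }
set (z := (l1, l2) : C).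
assert (L : forall n, Cmod (va (T n) - z) <= 4 * d / 2 ^ n).
{ intros n. eapply Rle_trans. apply Cmod_le_Rabs. specialize (L1 n). specialize (L2 n).
  simpl. unfold Rminus in *. unfold Rdiv in *. lra. }
assert (Hz : unit_disc z).
{ unfold unit_disc. destruct (dyadic_small (4 * d) (1 - r)) as [n Hn]; [lra|lra|].
  specialize (L n). pose proof (Cmod_rev_triangle z (va (T n))). rewrite Cmod_sub_comm in H2.
  destruct (I n) as [[I1 _] _]. lra. }
destruct (Hf z Hz) as [l Hl].
(* With e = d / 2^n, the first vertex is within 4e of z (2e for each coordinate), hence every vertex
   is within 5e. Each of the three sides contributes its length e times the error 5 eps e, and 4^n
   e^2 = d^2. *)
assert (Hl0 : forall eps, 0 < eps -> Cmod (tint f (T O)) <= 15 * eps * d ^ 2).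
{ intros eps He. destruct (proj1 (cderiv_eps f z l) Hl eps He) as [del [Hdel Hw]].
  destruct (dyadic_small (5 * d) del) as [n Hn]; [lra|trivial|].
  destruct (I n) as [[R1 [R2 R3]] [[S1 [S2 S3]] I3]]. specialize (L n).
  eapply Rle_trans. exact I3.
  set (e := d / 2 ^ n) in *.
  assert (He0 : 0 <= e) by (apply Rmult_le_pos; [|left; apply Rinv_0_lt_compat]; auto).
  replace (4 * d / 2 ^ n) with (4 * e) in L by (unfold e; field; apply Rgt_not_eq, P2).
  replace (5 * d / 2 ^ n) with (5 * e) in Hn by (unfold e; field; apply Rgt_not_eq, P2).
  destruct (T n) as [a' b' c']; simpl in *.
  assert (Ua : unit_disc a') by (unfold unit_disc; lra).
  assert (Ub : unit_disc b') by (unfold unit_disc; lra).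
  assert (Uc : unit_disc c') by (unfold unit_disc; lra).
  assert (Q : Cmod (tri_int f a' b' c') <= 15 * eps * e ^ 2).
  { set (g w := (f z + l * (w - z))%C).
    assert (A : forall u v, unit_disc u -> unit_disc v -> _) by
      (intros u v; apply (seg_int_affine f (f z) l z u v Hcont)).
    assert (E : tri_int f a' b' c' = tri_int (fun w => f w - g w)%C a' b' c').
    { unfold tri_int, g. rewrite (proj2 (A a' b' Ua Ub)), (proj2 (A b' c' Ub Uc)), (proj2 (A c' a' Uc Ua)). ring. }
    rewrite E. unfold tri_int.
    assert (Cfg : cont_disc (fun w => f w - g w)%C) by apply (A a' b' Ua Ub).
    assert (B : forall u v, unit_disc u -> unit_disc v -> Cmod (u - z) <= 5 * e -> Cmod (v - z) <= 5 * e ->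
       Cmod (u - v) <= e -> Cmod (seg_int (fun w => f w - g w)%C u v) <= 5 * eps * e ^ 2).
    { intros u v Hu Hv Bu Bv Buv.
      apply Rle_trans with (Cmod (v - u) * (eps * (5 * e))).
      - apply seg_int_bound; trivial. intros t Ht.
        pose proof (seg_pt_ball u v z t _ Ht Bu Bv) as Bs.
        unfold g. replace (f (seg_pt u v t) - (f z + l * (seg_pt u v t - z)))%C
          with (f (seg_pt u v t) - f z - l * (seg_pt u v t - z))%C by ring.
        eapply Rle_trans. apply Hw. lra. apply Rmult_le_compat_l; lra.
      - rewrite Cmod_sub_comm. replace (5 * eps * e ^ 2) with (e * (eps * (5 * e))) by ring.
        apply Rmult_le_compat_r; trivial. nra. }
    assert (Za : Cmod (a' - z) <= 5 * e) by lra.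
    assert (Zb : Cmod (b' - z) <= 5 * e).
    { replace (b' - z)%C with ((a' - z) - (a' - b'))%C by ring.
      eapply Rle_trans. apply Cmod_triangle. rewrite Cmod_opp. lra. }
    assert (Zc : Cmod (c' - z) <= 5 * e).
    { replace (c' - z)%C with ((a' - z) + (c' - a'))%C by ring.
      eapply Rle_trans. apply Cmod_triangle. lra. }
    eapply Rle_trans. apply Cmod_triangle.
    pose proof (Cmod_triangle (seg_int (fun w => f w - g w)%C a' b') (seg_int (fun w => f w - g w)%C b' c')) as T1.
    pose proof (B a' b' Ua Ub Za Zb S1). pose proof (B b' c' Ub Uc Zb Zc S2). pose proof (B c' a' Uc Ua Zc Za S3).
    lra. }
  change (tint f (Tri a' b' c')) with (tri_int f a' b' c').
  apply Rle_trans with (4 ^ n * (15 * eps * e ^ 2)).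
  - apply Rmult_le_compat_l; trivial. left; apply pow_lt; lra.
  - right. unfold e. replace (4 ^ n) with (2 ^ n * 2 ^ n) by (rewrite <- Rpow_mult_distr; f_equal; ring).
    field. apply Rgt_not_eq, P2. }
apply Cmod_eq_0. apply Rle_antisym; [|apply Cmod_ge_0].
change (tri_int f a b c) with (tint f (T O)).
apply le_epsilon. intros eps He. rewrite Rplus_0_l.
assert (Hdd : 0 <= d ^ 2) by apply pow2_ge_0.
specialize (Hl0 (eps / (15 * (d ^ 2 + 1)))).
eapply Rle_trans. apply Hl0. apply Rdiv_lt_0_compat; lra.
apply Rle_trans with (eps * (d ^ 2 / (d ^ 2 + 1))).
- right. field. lra.
- rewrite <- (Rmult_1_r eps) at 2. apply Rmult_le_compat_l. lra.
  apply Rmult_le_reg_r with (d ^ 2 + 1). lra. unfold Rdiv. rewrite Rmult_assoc, Rinv_l; lra.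
Qed.

(** * Primitives and Cauchy's formula *)

Definition prim (f : C -> C) (z : C) : C := seg_int f 0 z.

Lemma unit_disc_0 : unit_disc 0.
Proof. unfold unit_disc. rewrite Cmod_0. lra. Qed.

Lemma disc_nbhd z w : Cmod (w - z) < 1 - Cmod z -> unit_disc w.
Proof.
unfold unit_disc. intros H. pose proof (Cmod_rev_triangle w z). lra.
Qed.

(** Goursat on the triangle 0, z, w turns the increment of [prim f] into an integral over the
    segment from z to w, on which f is close to f z. *)
Lemma prim_deriv f z : holo f -> unit_disc z -> cderiv (prim f) z (f z).
Proof.
intros Hf Hz. pose proof (holo_cont f Hf) as Hc.
apply cderiv_eps. intros eps He.
destruct (proj1 (ccontinuous_eps f z) (Hc z Hz) eps He) as [d [Hd Hw]].
assert (Hz1 : 0 < 1 - Cmod z) by (unfold unit_disc in Hz; lra).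
exists (Rmin d (1 - Cmod z)). split. apply Rmin_pos; trivial.
intros w Hlt.
assert (Hdw : Cmod (w - z) < d) by (eapply Rlt_le_trans; [exact Hlt | apply Rmin_l]).
assert (Hw1 : unit_disc w) by (apply (disc_nbhd z); eapply Rlt_le_trans; [exact Hlt | apply Rmin_r]).
pose proof (goursat f 0 z w Hf unit_disc_0 Hz Hw1) as G. unfold tri_int in G.
rewrite (seg_int_rev f Hc 0 w unit_disc_0 Hw1) in G.
assert (Cc : cont_disc (fun _ => f z)) by (intros u _; apply continuous_const).
assert (E : (prim f w - prim f z - f z * (w - z))%C = seg_int (fun u => f u - f z)%C z w).
{ rewrite (seg_int_minus f (fun _ => f z)); trivial.
  rewrite (seg_int_FTC (fun _ => f z) Cc (fun u => f z * u)%C); trivial.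
  - unfold prim. transitivity (seg_int f z w - f z * (w - z) -
      (seg_int f 0 z + seg_int f z w + - seg_int f 0 w))%C. ring. rewrite G. ring.
  - intros u _. eapply cderiv_eq. apply (cderiv_scal _ (fun w => w)), cderiv_id. ring. }
rewrite E, Rmult_comm. apply seg_int_bound; trivial.
- intros u Hu. apply Ccont_minus; [apply Hc | apply Cc]; trivial.
- intros t Ht. left. apply Hw.
  eapply Rle_lt_trans; [|exact Hdw]. apply seg_pt_ball; trivial; try lra.
  replace (z - z)%C with (RtoC 0) by ring. rewrite Cmod_0. apply Cmod_ge_0.
Qed.

(** * Circles, contour integrals and the Cauchy kernel *)

Definition ei (t : R) : C := (cos t, sin t).

Lemma circle_ei r t : circle_pt r t = (RtoC r * ei t)%C.
Proof. unfold circle_pt, ei, RtoC, Cmult; simpl. f_equal; ring. Qed.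

Lemma Cmod_ei t : Cmod (ei t) = 1.
Proof.
unfold Cmod, ei; simpl. rewrite !Rmult_1_r.
pose proof (sin2_cos2 t) as H. unfold Rsqr in H.
replace (cos t * cos t + sin t * sin t) with 1 by lra. apply sqrt_1.
Qed.

Lemma ei_conj t : (ei t * Cconj (ei t))%C = 1.
Proof. rewrite <- Cmod2_conj, Cmod_ei. simpl. f_equal. ring. Qed.

Lemma ei_neq_0 t : ei t <> 0.
Proof. apply Cmod_gt_0. rewrite Cmod_ei. lra. Qed.

Lemma ei_inv t : (/ ei t)%C = Cconj (ei t).
Proof.
pose proof (ei_neq_0 t). replace (Cconj (ei t)) with (/ ei t * (ei t * Cconj (ei t)))%C.
rewrite ei_conj. ring. field. trivial.
Qed.

Lemma Cmod_circle r t : 0 <= r -> Cmod (circle_pt r t) = r.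
Proof. intros Hr. rewrite circle_ei, Cmod_mult, Cmod_R, Cmod_ei, Rabs_pos_eq by trivial. ring. Qed.

Lemma circle_disc r t : 0 <= r < 1 -> unit_disc (circle_pt r t).
Proof. intros Hr. unfold unit_disc. rewrite Cmod_circle; lra. Qed.

Lemma ei_deriv t : curve_deriv ei t (Ci * ei t)%C.
Proof.
replace (Ci * ei t)%C with (- sin t, cos t) by (unfold Ci, ei, Cmult; simpl; f_equal; ring).
apply curve_deriv_pair; auto_derive; trivial; ring.
Qed.

Lemma circle_deriv r t : curve_deriv (circle_pt r) t (Ci * circle_pt r t)%C.
Proof.
replace (Ci * circle_pt r t)%C with (- (r * sin t), r * cos t)
  by (unfold Ci, circle_pt, Cmult; simpl; f_equal; ring).
apply curve_deriv_pair; auto_derive; trivial; ring.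
Qed.

Lemma ei_cont t : Rcont ei t.
Proof. eapply curve_deriv_cont, ei_deriv. Qed.

Lemma circle_cont r t : Rcont (circle_pt r) t.
Proof. eapply curve_deriv_cont, circle_deriv. Qed.

Lemma ei_2PI : ei (2 * PI) = ei 0.
Proof. unfold ei. rewrite cos_2PI, sin_2PI, cos_0, sin_0. reflexivity. Qed.

Lemma two_PI_pos : 0 < 2 * PI.
Proof. pose proof PI_RGT_0. lra. Qed.

Lemma holo_circle_cont f r t : holo f -> 0 <= r < 1 -> Rcont (fun t => f (circle_pt r t)) t.
Proof.
intros Hf Hr. apply Ccont_comp. apply holo_cont; trivial. apply circle_disc, Hr. apply circle_cont.
Qed.

(** The primitive takes the same value at both ends of the circle. Here w dt stands for dw / i:
    contour integrals are written in dt throughout, and the factor i is dropped. *)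
Lemma contour_zero f r : holo f -> 0 <= r < 1 ->
  is_CInt (fun t => f (circle_pt r t) * circle_pt r t)%C 0 (2 * PI) (RtoC 0).
Proof.
intros Hf Hr. pose proof two_PI_pos.
assert (H1 : is_CInt (fun t => f (circle_pt r t) * (Ci * circle_pt r t))%C 0 (2 * PI)
   (prim f (circle_pt r (2 * PI)) - prim f (circle_pt r 0))%C).
{ apply (is_CInt_deriv (fun t => prim f (circle_pt r t))). lra.
  - intros t _. apply curve_deriv_comp. apply prim_deriv; trivial. apply circle_disc, Hr.
    apply circle_deriv.
  - intros t _. apply Ccont_mult. apply holo_circle_cont; trivial.
    apply Ccont_mult. apply continuous_const. apply circle_cont. }
rewrite !circle_ei, ei_2PI in H1. apply (is_CInt_scal (- Ci)) in H1.
replace (- Ci * (prim f (r * ei 0) - prim f (r * ei 0)))%C with (RtoC 0) in H1 by ring.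
eapply is_CInt_ext with (3 := H1). lra. intros t _. simpl.
transitivity (- (Ci * Ci) * (f (circle_pt r t) * circle_pt r t))%C. ring.
replace (Ci * Ci)%C with (- (1))%C by (unfold Ci, Cmult, Copp, RtoC; simpl; f_equal; ring). ring.
Qed.

Lemma Cmod_lt_neq (a w : C) : Cmod a < Cmod w -> (w - a)%C <> 0.
Proof.
intros H E. assert (w = a) by (rewrite <- (Cplus_0_r a), <- E; ring). subst. lra.
Qed.

Lemma one_minus_neq_0 (w : C) : Cmod w < 1 -> (1 - w)%C <> 0.
Proof. intros H. apply Cmod_lt_neq. rewrite Cmod_1. exact H. Qed.

Lemma cderiv_one_minus c z : cderiv (fun w => 1 - c * w)%C z (- c)%C.
Proof.
eapply cderiv_eq. apply (cderiv_minus (fun _ => RtoC 1) (fun w => c * w)%C). apply cderiv_const.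
apply (cderiv_scal c (fun w => w)), cderiv_id. ring.
Qed.

(** 1 / (1 - c w) = 1 + w (c / (1 - c w)), and the second term integrates to 0 by [contour_zero].
    That lemma works on circles of radius below 1, so c e^{it} is rewritten as c0 (rho e^{it}) with
    rho strictly between |c| and 1. *)
Lemma kernel_mean c : Cmod c < 1 -> is_CInt (fun t => / (1 - c * ei t))%C 0 (2 * PI) (RtoC (2 * PI)).
Proof.
intros Hc. pose proof (Cmod_ge_0 c) as Hc0. pose proof two_PI_pos.
set (rho := (1 + Cmod c) / 2). set (c0 := (c / RtoC rho)%C).
assert (Hrho : 0 < rho < 1) by (unfold rho; lra).
assert (Nrho : RtoC rho <> 0) by (apply RtoC_neq; lra).
assert (Hc1 : Cmod c0 <= 1).
{ unfold c0. rewrite Cmod_div, Cmod_R, Rabs_pos_eq by (trivial; lra).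
  apply Rmult_le_reg_r with rho. lra. unfold Rdiv. rewrite Rmult_assoc, Rinv_l by lra.
  unfold rho. lra. }
assert (N0 : forall w, unit_disc w -> (1 - c0 * w)%C <> 0).
{ intros w Hw. apply one_minus_neq_0. rewrite Cmod_mult. unfold unit_disc in Hw.
  pose proof (Cmod_ge_0 w). pose proof (Cmod_ge_0 c0). nra. }
assert (Hh : holo (fun w => c0 * / (1 - c0 * w))%C).
{ intros w Hw. eexists. apply (cderiv_scal c0 (fun w => / (1 - c0 * w))%C).
  apply (cderiv_inv (fun w => 1 - c0 * w)%C). apply cderiv_one_minus. apply N0, Hw. }
pose proof (contour_zero _ rho Hh (conj (Rlt_le _ _ (proj1 Hrho)) (proj2 Hrho))) as H1.
pose proof (is_CInt_plus _ _ _ _ _ _ (is_CInt_const 1 0 (2 * PI)) H1) as H2.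
simpl in H2. replace (RtoC (2 * PI - 0) * 1 + 0)%C with (RtoC (2 * PI)) in H2.
2:{ rewrite Rminus_0_r. ring. }
eapply is_CInt_ext with (3 := H2). lra. intros t _. simpl.
assert (Hw : (1 - c0 * circle_pt rho t)%C <> 0) by (apply N0, circle_disc; lra).
rewrite circle_ei in *.
replace (c * ei t)%C with (c0 * (rho * ei t))%C by (unfold c0; field; trivial).
field. trivial.
Qed.

Lemma is_CInt_conj f a b l : is_CInt f a b l -> is_CInt (fun t => Cconj (f t)) a b (Cconj l).
Proof.
intros H. pose proof (is_RInt_fct_extend_fst _ _ _ _ H) as H1.
pose proof (is_RInt_fct_extend_snd _ _ _ _ H) as H2.
apply (@is_RInt_fct_extend_pair R_NormedModule R_NormedModule); simpl; trivial.
apply (is_RInt_opp (V := R_NormedModule)), H2.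
Qed.

(* [w / (w - a)] for [w = r e^{it}] *)
Definition ck (r : R) (a : C) (t : R) : C := (/ (1 - a * / circle_pt r t))%C.

Lemma Cconj_RtoC x : Cconj (RtoC x) = RtoC x.
Proof. unfold Cconj, RtoC; simpl. f_equal. ring. Qed.

Lemma one_minus_div_pos x y : 0 < y -> x < y -> 0 < 1 - x / y.
Proof.
intros Hy Hx. apply Rmult_lt_reg_r with y; trivial.
unfold Rdiv. rewrite Rmult_minus_distr_r, Rmult_assoc, Rinv_l; lra.
Qed.

Lemma circle_neq_0 r t : 0 < r -> circle_pt r t <> 0.
Proof. intros Hr. apply Cmod_gt_0. rewrite Cmod_circle; lra. Qed.

Lemma circle_inv r t : 0 < r -> (/ circle_pt r t)%C = (RtoC (/ r) * Cconj (ei t))%C.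
Proof.
intros Hr. rewrite circle_ei, <- ei_inv, RtoC_inv by lra. field.
split. apply ei_neq_0. apply RtoC_neq; lra.
Qed.

(** On the circle 1/w is conj(e^{it}) / r, so the Cauchy kernel is the conjugate of a kernel covered
    by [kernel_mean]. This gives its integral without a series expansion. *)
Lemma ck_conj r a t : 0 < r -> Cmod a < r -> ck r a t = Cconj (/ (1 - (Cconj a * / r) * ei t))%C.
Proof.
intros Hr Ha. unfold ck. rewrite circle_inv by trivial.
rewrite Cinv_conj.
- f_equal. rewrite Cminus_conj, !Cmult_conj, Cconj_conj, RtoC_inv by lra.
  rewrite Cinv_conj by (apply RtoC_neq; lra).
  rewrite !Cconj_RtoC. ring.
- apply one_minus_neq_0. rewrite !Cmod_mult, Cmod_conj, Cmod_ei, Cmod_inv by (apply RtoC_neq; lra).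
  rewrite Cmod_R, Rabs_pos_eq, Rmult_1_r by lra.
  apply Rmult_lt_reg_r with r; trivial. rewrite Rmult_assoc, Rinv_l; lra.
Qed.

Lemma ck_mean r a : 0 < r -> Cmod a < r -> is_CInt (ck r a) 0 (2 * PI) (RtoC (2 * PI)).
Proof.
intros Hr Ha. pose proof two_PI_pos.
assert (Hc : Cmod (Cconj a * / r) < 1).
{ rewrite !Cmod_mult, Cmod_conj, Cmod_inv, Cmod_R, Rabs_pos_eq by (try apply RtoC_neq; lra).
  apply Rmult_lt_reg_r with r; trivial. rewrite Rmult_assoc, Rinv_l; lra. }
pose proof (is_CInt_conj _ _ _ _ (kernel_mean _ Hc)) as K.
rewrite Cconj_RtoC in K.
eapply is_CInt_ext with (3 := K). lra. intros t _. symmetry. apply ck_conj; trivial.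
Qed.

Definition divided_diff (F F1 : C -> C) (a w : C) : C :=
  if Ceq_dec w a then F1 a else ((F w - F a) * / (w - a))%C.

Lemma Cminus_neq_0 (w a : C) : w <> a -> (w - a)%C <> 0.
Proof. intros H E. apply H. rewrite <- (Cplus_0_r a), <- E. ring. Qed.

(** At the point a itself, F(w) - F(a) - F1(a) (w - a) - (l/2) (w - a)^2 with l = F1'(a) is the
    segment integral of F1 minus its first-order expansion, hence o(|w - a|^2); so the derivative
    there is l/2. The derivative F1 of F is assumed holomorphic, because the holomorphy of
    derivatives is itself deduced from this lemma. *)
Lemma divided_diff_holo F F1 a : holo F1 -> (forall z, unit_disc z -> cderiv F z (F1 z)) ->
  unit_disc a -> holo (divided_diff F F1 a).
Proof.
intros H1 HF Ha w Hw. destruct (classic (w = a)) as [->|Hwa].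
- destruct (H1 a Ha) as [l Hl]. exists (l / 2)%C.
  apply cderiv_eps. intros eps He.
  destruct (proj1 (cderiv_eps F1 a l) Hl eps He) as [d [Hd Hw1]].
  assert (Ha1 : 0 < 1 - Cmod a) by (unfold unit_disc in Ha; lra).
  exists (Rmin d (1 - Cmod a)). split. apply Rmin_pos; trivial.
  intros w Hlt.
  assert (Hdw : Cmod (w - a) < d) by (eapply Rlt_le_trans; [exact Hlt | apply Rmin_l]).
  assert (Hwd : unit_disc w) by (apply (disc_nbhd a); eapply Rlt_le_trans; [exact Hlt | apply Rmin_r]).
  unfold divided_diff. destruct (Ceq_dec a a) as [_|n]; [|congruence].
  destruct (Ceq_dec w a) as [->|n].
  { replace (F1 a - F1 a - l / 2 * (a - a))%C with (RtoC 0) by ring. rewrite Cmod_0.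
    pose proof (Cmod_ge_0 (a - a)). nra. }
  pose proof (Cminus_neq_0 w a n) as n'.
  pose proof (holo_cont F1 H1) as C1. set (g u := (F1 a + l * (u - a))%C).
  destruct (seg_int_affine F1 (F1 a) l a a w C1 Ha Hwd) as [Cg Eg]. fold g in Cg, Eg.
  assert (E : ((F w - F a) * / (w - a) - F1 a - l / 2 * (w - a))%C
     = (seg_int (fun u => F1 u - g u)%C a w * / (w - a))%C).
  { unfold g. rewrite Eg, (seg_int_FTC F1 C1 F) by auto. field. exact n'. }
  rewrite E, Cmod_mult, Cmod_inv by trivial.
  assert (B : Cmod (seg_int (fun u => F1 u - g u)%C a w) <= Cmod (w - a) * (eps * Cmod (w - a))).
  { apply seg_int_bound; trivial.
    - intros t Ht. unfold g.
      assert (Bs : Cmod (seg_pt a w t - a) <= Cmod (w - a)).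
      { apply seg_pt_ball; trivial; try lra.
        replace (a - a)%C with (RtoC 0) by ring. rewrite Cmod_0. apply Cmod_ge_0. }
      replace (F1 (seg_pt a w t) - (F1 a + l * (seg_pt a w t - a)))%C
        with (F1 (seg_pt a w t) - F1 a - l * (seg_pt a w t - a))%C by ring.
      eapply Rle_trans. apply Hw1. lra. apply Rmult_le_compat_l; lra. }
  pose proof (proj1 (Cmod_gt_0 _) n') as Hp.
  apply Rmult_le_reg_r with (Cmod (w - a)); trivial. rewrite Rmult_assoc, Rinv_l by lra. lra.
- pose proof (Cminus_neq_0 w a Hwa) as n'.
  pose proof (proj1 (Cmod_gt_0 _) n') as Hp.
  eexists. eapply (cderiv_ext_loc (fun u => (F u - F a) * / (u - a))%C) with (1 := Hp).
  + intros u Hu. unfold divided_diff. destruct (Ceq_dec u a) as [->|]; trivial.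
    rewrite Cmod_sub_comm in Hu. lra.
  + apply (cderiv_mult (fun u => F u - F a)%C (fun u => / (u - a))%C).
    * apply (cderiv_minus F (fun _ => F a)). apply HF, Hw. apply cderiv_const.
    * apply (cderiv_inv (fun u => u - a)%C); trivial.
      apply (cderiv_minus (fun u => u) (fun _ => a)). apply cderiv_id. apply cderiv_const.
Qed.

(** F(w) w / (w - a) is w times the divided difference plus F(a) times the kernel. The first has
    integral 0 by [contour_zero], the second is given by [ck_mean]. *)
Lemma cauchy_primitive F F1 r a : holo F1 -> (forall z, unit_disc z -> cderiv F z (F1 z)) ->
  0 < r < 1 -> Cmod a < r ->
  is_CInt (fun t => F (circle_pt r t) * ck r a t)%C 0 (2 * PI) (RtoC (2 * PI) * F a)%C.
Proof.
intros H1 HF Hr Ha. pose proof two_PI_pos.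
assert (Ha1 : unit_disc a) by (unfold unit_disc; lra).
assert (Hr' : 0 <= r < 1) by lra.
pose proof (contour_zero _ r (divided_diff_holo F F1 a H1 HF Ha1) Hr') as K1.
pose proof (is_CInt_scal (F a) _ _ _ _ (ck_mean r a (proj1 Hr) Ha)) as K2.
pose proof (is_CInt_plus _ _ _ _ _ _ K1 K2) as K. simpl in K.
replace (0 + F a * RtoC (2 * PI))%C with (RtoC (2 * PI) * F a)%C in K by ring.
eapply is_CInt_ext with (3 := K). lra. intros t _. simpl.
pose proof (circle_neq_0 r t (proj1 Hr)) as N.
assert (N2 : (circle_pt r t - a)%C <> 0) by (apply Cmod_lt_neq; rewrite Cmod_circle; lra).
unfold divided_diff, ck. destruct (Ceq_dec (circle_pt r t) a) as [E|_].
{ exfalso. apply N2. rewrite E. ring. }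
field. split; trivial.
Qed.

(** Second-order Taylor bound for a -> (1 - a eta)^(-n), uniform in eta, by induction from fb - fa =
    (b - a) eta fa fb. It serves twice: with eta = 1/w to differentiate Cauchy integrals, and with
    eta the conjugate of a peak's centre to differentiate the series of peaks termwise. *)
Lemma kernel_taylor (n : nat) (N A : R) : 0 <= N -> 0 <= A -> exists K, 0 <= K /\
  forall eta a b : C, Cmod eta <= N -> (1 - a * eta)%C <> 0 -> (1 - b * eta)%C <> 0 ->
  Cmod (/ (1 - a * eta)) <= A -> Cmod (/ (1 - b * eta)) <= A ->
  Cmod ((/ (1 - b * eta)) ^ n - (/ (1 - a * eta)) ^ n
    - (b - a) * (INR n * eta * (/ (1 - a * eta)) ^ S n)) <= K * Cmod (b - a) ^ 2.
Proof.
intros HN HA. induction n as [|n [K [HK IH]]].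
- exists 0. split. lra. intros. simpl.
  replace (1 - 1 - (b - a) * (0 * eta * (/ (1 - a * eta) * 1)))%C with (RtoC 0) by ring.
  rewrite Cmod_0. lra.
- exists (A * K + INR (S n) * N ^ 2 * A * A ^ (S (S n))).
  assert (HAn : forall k, 0 <= A ^ k) by (intros; apply pow_le; trivial).
  assert (HNn : 0 <= N ^ 2) by (apply pow_le; trivial).
  pose proof (pos_INR (S n)) as Hn.
  split. { apply Rplus_le_le_0_compat. nra. apply Rmult_le_pos; [apply Rmult_le_pos; [apply Rmult_le_pos|]|]; trivial. }
  intros eta a b Heta Na Nb Aa Ab. specialize (IH eta a b Heta Na Nb Aa Ab).
  set (fa := (/ (1 - a * eta))%C) in *. set (fb := (/ (1 - b * eta))%C) in *.
  set (D := (fb ^ n - fa ^ n - (b - a) * (INR n * eta * fa ^ S n))%C) in *.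
  assert (E0 : (fb - fa = (b - a) * eta * fa * fb)%C) by (unfold fa, fb; field; split; trivial).
  assert (E : (fb ^ S n - fa ^ S n - (b - a) * (INR (S n) * eta * fa ^ S (S n)))%C =
    (fb * D + INR (S n) * (b - a) ^ 2 * eta ^ 2 * fb * fa ^ S (S n))%C).
  { unfold D. rewrite S_INR, RtoC_plus. rewrite !Cpow_S.
    set (x := (fa ^ n)%C). set (y := (fb ^ n)%C). simpl. rewrite !Cmult_1_r.
    transitivity (fb * (y - x - (b - a) * (INR n * eta * (fa * x)))
      + ((fb - fa) * (x + (b - a) * INR n * eta * fa * x) - (b - a) * eta * fa * fa * x))%C. ring.
    rewrite E0.
    transitivity (fb * (y - x - (b - a) * (INR n * eta * (fa * x)))
      + ((b - a) * eta * fa * x * (fb - fa) + INR n * (b - a) * (b - a) * eta * eta * fa * fb * fa * x))%C. ring.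
    rewrite E0. ring. }
  rewrite E. eapply Rle_trans. apply Cmod_triangle.
  rewrite !Cmod_mult, !Cmod_pow, Cmod_R, (Rabs_pos_eq (INR (S n))) by trivial.
  rewrite Rmult_plus_distr_r. apply Rplus_le_compat.
  + rewrite Rmult_assoc. apply Rmult_le_compat; trivial; apply Cmod_ge_0.
  + pose proof (Cmod_ge_0 eta). pose proof (Cmod_ge_0 fa). pose proof (Cmod_ge_0 fb).
    assert (Cmod eta ^ 2 <= N ^ 2) by (apply pow_incr; lra).
    assert (Cmod fa ^ S (S n) <= A ^ S (S n)) by (apply pow_incr; lra).
    replace (INR (S n) * N ^ 2 * A * A ^ S (S n) * Cmod (b - a) ^ 2)
      with (INR (S n) * Cmod (b - a) ^ 2 * N ^ 2 * A * A ^ S (S n)) by ring.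
    pose proof (pow2_ge_0 (Cmod (b - a))). pose proof (pow2_ge_0 (Cmod eta)).
    assert (0 <= INR (S n) * Cmod (b - a) ^ 2) by (apply Rmult_le_pos; trivial).
    assert (H7 : 0 <= Cmod fa ^ S (S n)) by (apply pow_le; trivial).
    set (p1 := INR (S n) * Cmod (b - a) ^ 2) in *. set (p2 := Cmod eta ^ 2) in *.
    set (p3 := Cmod fa ^ S (S n)) in *. set (q2 := N ^ 2) in *. set (q3 := A ^ S (S n)) in *.
    clearbody p1 p2 p3 q2 q3.
    apply Rmult_le_compat; trivial; [repeat apply Rmult_le_pos; trivial|].
    apply Rmult_le_compat; trivial; [repeat apply Rmult_le_pos; trivial|].
    apply Rmult_le_compat_l; trivial.
Qed.

Lemma ck_bound r a b t : 0 < r -> Cmod a <= b -> b < r ->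
  (1 - a * / circle_pt r t)%C <> 0 /\ Cmod (ck r a t) <= / (1 - b / r).
Proof.
intros Hr Ha Hb.
assert (B : Cmod (a * / circle_pt r t) <= b / r).
{ rewrite Cmod_mult, Cmod_inv, Cmod_circle by (try apply circle_neq_0; lra).
  apply Rmult_le_compat_r; trivial. left. apply Rinv_0_lt_compat, Hr. }
pose proof (one_minus_div_pos b r Hr Hb) as B1.
assert (N : (1 - a * / circle_pt r t)%C <> 0) by (apply one_minus_neq_0; lra).
split; trivial. unfold ck. rewrite Cmod_inv by trivial.
apply Rinv_le_contravar. lra.
pose proof (Cmod_rev_triangle 1 (a * / circle_pt r t)). rewrite Cmod_1 in H. lra.
Qed.

Lemma ck_cont r a t : 0 < r -> Cmod a < r -> Rcont (ck r a) t.
Proof.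
intros Hr Ha. unfold ck. apply Ccont_inv.
- apply (ck_bound r a (Cmod a) t); trivial. lra.
- apply Ccont_minus. apply continuous_const. apply Ccont_mult. apply continuous_const.
  apply Ccont_inv. apply circle_neq_0; trivial. apply circle_cont.
Qed.

(** Differentiation under the integral sign: [kernel_taylor] bounds the error by K |w - a|^2 times
    the integral [M] of |h|. Used with n = 1, 2, 3 in turn, it climbs from Cauchy's formula to its
    derivatives. *)
Lemma cauchy_transform_deriv (n : nat) (h : R -> C) r a : (forall t, Rcont h t) ->
  0 < r -> Cmod a < r ->
  cderiv (fun z => CInt (fun t => h t * ck r z t ^ n)%C 0 (2 * PI)) a
    (CInt (fun t => INR n * (h t * / circle_pt r t) * ck r a t ^ S n)%C 0 (2 * PI)).
Proof.
intros Hh Hr Ha. pose proof two_PI_pos as Hpi. pose proof (Cmod_ge_0 a).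
assert (Ch : forall z t k, Cmod z < r -> Rcont (fun t => h t * ck r z t ^ k)%C t).
{ intros z t k Hz. apply Ccont_mult. apply Hh. apply Ccont_pow, ck_cont; trivial. }
set (b := (Cmod a + r) / 2). assert (Hb : Cmod a < b < r) by (unfold b; lra).
assert (Hbr : 0 < 1 - b / r) by (apply one_minus_div_pos; lra).
destruct (kernel_taylor n (/ r) (/ (1 - b / r))) as [K [HK HKt]].
{ left. apply Rinv_0_lt_compat, Hr. } { left. apply Rinv_0_lt_compat, Hbr. }
assert (Hn : forall t, continuous (fun t => Cmod (h t)) t) by (intros; apply continuous_Cmod, Hh).
pose proof (RInt_correct (V := R_CompleteNormedModule) (fun t => Cmod (h t)) 0 (2 * PI)
  (ex_RInt_continuous (V := R_CompleteNormedModule) _ _ _ (fun t _ => Hn t))) as IM.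
set (M := RInt _ 0 (2 * PI)) in IM.
assert (HM : 0 <= M).
{ unfold M. apply RInt_ge_0. lra. exists M; exact IM. intros; apply Cmod_ge_0. }
assert (HKM : 0 <= K * M) by (apply Rmult_le_pos; trivial).
apply cderiv_eps. intros eps He.
exists (Rmin (b - Cmod a) (eps / (K * M + 1))). split.
{ apply Rmin_pos. lra. apply Rdiv_lt_0_compat; lra. }
intros w Hw.
assert (Hw1 : Cmod (w - a) < b - Cmod a) by (eapply Rlt_le_trans; [exact Hw|apply Rmin_l]).
assert (Hw2 : Cmod (w - a) < eps / (K * M + 1)) by (eapply Rlt_le_trans; [exact Hw|apply Rmin_r]).
assert (Hwb : Cmod w < b) by (pose proof (Cmod_rev_triangle w a); lra).
assert (Hwr : Cmod w < r) by lra.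
assert (I1 := ex_CInt_cont _ 0 (2 * PI) (Rlt_le _ _ Hpi) (fun t _ => Ch w t n Hwr)).
assert (I2 := ex_CInt_cont _ 0 (2 * PI) (Rlt_le _ _ Hpi) (fun t _ => Ch a t n Ha)).
assert (I3 : is_CInt (fun t => INR n * (h t * / circle_pt r t) * ck r a t ^ S n)%C 0 (2 * PI)
   (CInt (fun t => INR n * (h t * / circle_pt r t) * ck r a t ^ S n)%C 0 (2 * PI))).
{ apply ex_CInt_cont. lra. intros t _. apply Ccont_mult.
  apply Ccont_mult. apply continuous_const. apply Ccont_mult. apply Hh.
  apply Ccont_inv. apply circle_neq_0; trivial. apply circle_cont.
  apply Ccont_pow, ck_cont; trivial. }
pose proof (is_CInt_minus _ _ _ _ _ _ (is_CInt_minus _ _ _ _ _ _ I1 I2)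
  (is_CInt_scal (w - a) _ _ _ _ I3)) as I.
rewrite (Cmult_comm (CInt (fun t => INR n * (h t * / circle_pt r t) * ck r a t ^ S n)%C 0 (2 * PI))).
assert (Hle : Cmod (w - a) * (K * M) <= eps).
{ apply Rle_trans with (eps / (K * M + 1) * (K * M + 1)).
  - apply Rmult_le_compat; try apply Cmod_ge_0; lra.
  - right. field. lra. }
apply Rle_trans with (K * Cmod (w - a) ^ 2 * M).
2:{ pose proof (Cmod_ge_0 (w - a)). simpl. nra. }
eapply is_CInt_le with (3 := I) (h := fun t => K * Cmod (w - a) ^ 2 * Cmod (h t)). lra.
- intros t _. simpl.
  destruct (ck_bound r a b t Hr) as [Na Ba]; try lra.
  destruct (ck_bound r w b t Hr) as [Nw Bw]; try lra.
  specialize (HKt (/ circle_pt r t)%C a w).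
  replace (h t * ck r w t ^ n - h t * ck r a t ^ n -
    (w - a) * (INR n * (h t * / circle_pt r t) * (ck r a t * ck r a t ^ n)))%C
  with (h t * (ck r w t ^ n - ck r a t ^ n - (w - a) * (INR n * / circle_pt r t * ck r a t ^ S n)))%C
  by (rewrite Cpow_S; ring).
  rewrite Cmod_mult, Rmult_comm. apply Rmult_le_compat_r. apply Cmod_ge_0.
  apply HKt; trivial.
  rewrite Cmod_inv, Cmod_circle by (try apply circle_neq_0; lra). lra.
- apply (is_RInt_scal (V := R_NormedModule)), IM.
Qed.

Lemma C_derive_is f z : holo f -> unit_disc z -> cderiv f z (C_derive f z).
Proof. intros Hf Hz. apply C_derive_correct. exact z. apply Hf, Hz. Qed.

Lemma two_PI_neq : RtoC (2 * PI) <> 0.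
Proof. apply RtoC_neq. pose proof two_PI_pos. lra. Qed.

Lemma cauchy_primitive_deriv F F1 r a : holo F1 -> (forall z, unit_disc z -> cderiv F z (F1 z)) ->
  0 < r < 1 -> Cmod a < r ->
  is_CInt (fun t => F (circle_pt r t) * / circle_pt r t * ck r a t ^ 2)%C 0 (2 * PI)
    (RtoC (2 * PI) * F1 a)%C.
Proof.
intros H1 HF Hr Ha. pose proof two_PI_pos as Hpi.
assert (HFh : holo F) by (intros z Hz; exists (F1 z); apply HF, Hz).
assert (Hc : forall t, Rcont (fun t => F (circle_pt r t)) t) by (intros t; apply holo_circle_cont; trivial; lra).
pose proof (cauchy_transform_deriv 1 (fun t => F (circle_pt r t)) r a Hc (proj1 Hr) Ha) as D.
assert (Hd : 0 < r - Cmod a) by lra.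
assert (D' : cderiv (fun z => RtoC (2 * PI) * F z)%C a (RtoC (2 * PI) * F1 a)%C).
{ apply cderiv_scal, HF. unfold unit_disc; lra. }
eapply cderiv_ext_loc with (1 := Hd) (g := fun z => (RtoC (2 * PI) * F z)%C) in D.
- pose proof (cderiv_unique _ _ _ _ D D') as E.
  rewrite <- E. eapply is_CInt_ext; [lra| |apply ex_CInt_cont; [lra|]].
  + intros t _. simpl. ring.
  + intros t _. cbv beta. apply Ccont_mult; [|apply Ccont_pow, ck_cont; trivial; lra].
    apply Ccont_mult. apply continuous_const. apply Ccont_mult. apply Hc.
    apply Ccont_inv. apply circle_neq_0; lra. apply circle_cont.
- intros w Hw. apply is_CInt_unique.
  eapply is_CInt_ext with (3 := cauchy_primitive F F1 r w H1 HF Hr _).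
  Unshelve. lra. intros t _. simpl. ring. pose proof (Cmod_rev_triangle w a). lra.
Qed.

(** Cauchy's formula is available so far for functions with a holomorphic derivative only, so it is
    applied to [prim f]. Then f is a first derivative, with kernel [ck ^ 2], and [C_derive f] a
    second one, with kernel [ck ^ 3]; one more differentiation under the integral shows that the
    latter is differentiable. *)
Theorem holo_C_derive f : holo f -> holo (C_derive f).
Proof.
intros Hf z Hz. pose proof two_PI_pos as Hpi. pose proof (Cmod_ge_0 z).
set (r := (1 + Cmod z) / 2). assert (Hr : 0 < r < 1) by (unfold r, unit_disc in *; lra).
assert (Hzr : Cmod z < r) by (unfold r, unit_disc in *; lra).
assert (HP : forall z, unit_disc z -> cderiv (prim f) z (f z)) by (intros; apply prim_deriv; trivial).
assert (HPh : holo (prim f)) by (intros w Hw; exists (f w); apply HP, Hw).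
set (h t := (prim f (circle_pt r t) * / circle_pt r t)%C).
assert (Hi : forall t, Rcont (fun t => / circle_pt r t)%C t).
{ intros t. apply Ccont_inv. apply circle_neq_0; lra. apply circle_cont. }
assert (Hh : forall t, Rcont h t).
{ intros t. apply Ccont_mult. apply holo_circle_cont; trivial; lra. apply Hi. }
set (h2 t := (INR 2 * (h t * / circle_pt r t))%C).
assert (Hh2 : forall t, Rcont h2 t).
{ intros t. apply Ccont_mult. apply continuous_const. apply Ccont_mult. apply Hh. apply Hi. }
assert (E : forall a, Cmod a < r ->
  (RtoC (2 * PI) * C_derive f a)%C = CInt (fun t => h2 t * ck r a t ^ 3)%C 0 (2 * PI)).
{ intros a Ha. assert (Hd : 0 < r - Cmod a) by lra.
  eapply cderiv_unique.
  - apply cderiv_scal, C_derive_is; trivial. unfold unit_disc; lra.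
  - eapply cderiv_ext_loc with (1 := Hd); [|apply (cauchy_transform_deriv 2 h r a Hh (proj1 Hr) Ha)].
    intros w Hw. apply is_CInt_unique. apply cauchy_primitive_deriv; trivial.
    pose proof (Cmod_rev_triangle w a). lra. }
assert (Hd : 0 < r - Cmod z) by lra.
eexists. eapply cderiv_ext_loc with (1 := Hd);
 [|apply (cderiv_scal (/ RtoC (2 * PI))), (cauchy_transform_deriv 3 h2 r z Hh2 (proj1 Hr) Hzr)].
intros w Hw. cbv beta. rewrite <- E. field. apply two_PI_neq.
pose proof (Cmod_rev_triangle w z). lra.
Qed.

Theorem cauchy_formula f r a : holo f -> 0 < r < 1 -> Cmod a < r ->
  is_CInt (fun t => f (circle_pt r t) * ck r a t)%C 0 (2 * PI) (RtoC (2 * PI) * f a)%C.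
Proof.
intros Hf. apply (cauchy_primitive f (C_derive f)). apply holo_C_derive, Hf.
intros z Hz. apply C_derive_is; trivial.
Qed.

Theorem cauchy_formula_deriv f r a : holo f -> 0 < r < 1 -> Cmod a < r ->
  is_CInt (fun t => f (circle_pt r t) * / circle_pt r t * ck r a t ^ 2)%C 0 (2 * PI)
    (RtoC (2 * PI) * C_derive f a)%C.
Proof.
intros Hf. apply (cauchy_primitive_deriv f (C_derive f)). apply holo_C_derive, Hf.
intros z Hz. apply C_derive_is; trivial.
Qed.

(** * Hardy means, growth of derivatives, zeros *)

Lemma Cmod_sqr (z : C) : Cmod z ^ 2 = fst z ^ 2 + snd z ^ 2.
Proof. apply Cmod2_alt. Qed.

(** For |w| = q, |1/(1 - w)|^2 = (2 Re (1/(1 - w)) - 1) / (1 - q^2). This is the Poisson kernel up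
    to normalisation, and its integral reduces to the real part of [ck_mean]. *)
Lemma ck_sqr_mean r a : 0 < r -> Cmod a < r ->
  is_RInt (fun t => Cmod (ck r a t) ^ 2) 0 (2 * PI) (2 * PI / (1 - (Cmod a / r) ^ 2)).
Proof.
intros Hr Ha. pose proof two_PI_pos. pose proof (Cmod_ge_0 a).
set (q := Cmod a / r).
assert (Hq : 0 <= q < 1).
{ unfold q. split. apply Rmult_le_pos; trivial. left; apply Rinv_0_lt_compat, Hr.
  apply Rmult_lt_reg_r with r; trivial. unfold Rdiv. rewrite Rmult_assoc, Rinv_l; lra. }
assert (Hq2 : 0 < 1 - q ^ 2) by nra.
pose proof (is_RInt_fct_extend_fst _ _ _ _ (ck_mean r a Hr Ha)) as K. simpl in K.
pose proof (is_RInt_scal (V := R_NormedModule) _ _ _ (2 / (1 - q ^ 2)) _ K) as K1.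
pose proof (is_RInt_const (V := R_NormedModule) 0 (2 * PI) (/ (1 - q ^ 2))) as K2.
pose proof (is_RInt_minus (V := R_NormedModule) _ _ _ _ _ _ K1 K2) as K3.
match type of K3 with is_RInt _ _ _ ?L => replace L with (2 * PI / (1 - q ^ 2)) in K3 end.
2:{ unfold minus, plus, opp, scal; simpl; unfold mult; simpl. field. lra. }
eapply is_RInt_ext with (2 := K3). intros t _.
change (2 / (1 - q ^ 2) * fst (ck r a t) - / (1 - q ^ 2) = Cmod (ck r a t) ^ 2).
pose proof (ck_bound r a (Cmod a) t Hr (Rle_refl _) Ha) as [N _].
unfold ck in *. set (w := (a * / circle_pt r t)%C) in *.
assert (Hw : fst w ^ 2 + snd w ^ 2 = q ^ 2).
{ rewrite <- Cmod_sqr. f_equal. unfold w.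
  rewrite Cmod_mult, Cmod_inv, Cmod_circle by (try apply circle_neq_0; lra). reflexivity. }
rewrite Cmod_sqr. destruct w as [x y]. simpl in *.
assert (D : (1 + - x) * ((1 + - x) * 1) + (0 + - y) * ((0 + - y) * 1) <> 0).
{ intros E. apply N. apply Cmod_eq_0. unfold Cmod. simpl. rewrite E. apply sqrt_0. }
set (u := q * (q * 1)) in *.
replace (0 + - y) with (- y) in * by ring.
apply Rmult_eq_reg_r with (((1 + - x) * ((1 + - x) * 1) + - y * (- y * 1)) * (1 - u)).
2:{ apply Rmult_integral_contrapositive_currified; trivial. lra. }
assert (Hu : u = x * (x * 1) + y * (y * 1)) by (symmetry; exact Hw). clearbody u. subst u.
field. split; lra.
Qed.

(** * Real powers and circular means *)

Lemma rpow_nonneg x p : 0 <= rpow x p.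
Proof. unfold rpow. destruct (Req_EM_T x 0). lra. left. apply exp_pos. Qed.

Lemma rpow_pos x p : 0 < x -> rpow x p = Rpower x p.
Proof. intros H. unfold rpow. destruct (Req_EM_T x 0); lra. Qed.

Lemma rpow_0 p : rpow 0 p = 0.
Proof. unfold rpow. destruct (Req_EM_T 0 0); lra. Qed.

Lemma Rpower_ln x p : Rpower x p = exp (p * ln x).
Proof. reflexivity. Qed.

Lemma Rpower_pos x p : 0 < Rpower x p.
Proof. apply exp_pos. Qed.

Lemma Rpower_le_1 x p : 0 < x <= 1 -> 0 <= p -> Rpower x p <= 1.
Proof.
intros Hx Hp. replace 1 with (Rpower 1 p) by (rewrite Rpower_ln, ln_1, Rmult_0_r; apply exp_0).
apply Rle_Rpower_l; lra.
Qed.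

Lemma rpow_le x y p : 0 <= p -> 0 <= x <= y -> rpow x p <= rpow y p.
Proof.
intros Hp Hxy. destruct (Req_EM_T x 0) as [->|n].
- rewrite rpow_0. apply rpow_nonneg.
- rewrite !rpow_pos by lra. apply Rle_Rpower_l; lra.
Qed.

Lemma rpow_mult x y p : 0 <= x -> 0 <= y -> rpow (x * y) p = rpow x p * rpow y p.
Proof.
intros Hx Hy. destruct (Req_EM_T x 0) as [->|nx].
{ rewrite Rmult_0_l, rpow_0. ring. }
destruct (Req_EM_T y 0) as [->|ny].
{ rewrite Rmult_0_r, rpow_0. ring. }
rewrite !rpow_pos by nra. symmetry. apply Rpower_mult_distr; lra.
Qed.

Lemma rpow_small x p : 1 <= p -> 0 <= x <= 1 -> rpow x p <= x.
Proof.
intros Hp Hx. destruct (Req_EM_T x 0) as [->|n]. rewrite rpow_0. lra.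
rewrite rpow_pos by lra. replace p with (1 + (p - 1)) by ring.
rewrite Rpower_plus, Rpower_1 by lra.
pose proof (Rpower_le_1 x (p - 1)). nra.
Qed.

Lemma continuous_rpow_Rabs x p : 1 <= p -> continuous (fun x => rpow (Rabs x) p) x.
Proof.
intros Hp. destruct (Req_EM_T x 0) as [->|n].
- apply filterlim_locally. intros eps.
  assert (Hd : 0 < Rmin 1 eps) by (apply Rmin_pos; [lra | apply cond_pos]).
  exists (mkposreal _ Hd). intros y Hy.
  unfold ball in *; simpl in *; unfold AbsRing_ball, abs, minus, plus, opp in *; simpl in *.
  rewrite Rabs_R0, rpow_0. rewrite Ropp_0, Rplus_0_r in *.
  rewrite (Rabs_pos_eq (rpow _ _)) by apply rpow_nonneg.
  assert (H1 : Rabs y < 1) by (eapply Rlt_le_trans; [exact Hy | apply Rmin_l]).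
  assert (H2 : Rabs y < eps) by (eapply Rlt_le_trans; [exact Hy | apply Rmin_r]).
  pose proof (Rabs_pos y). pose proof (rpow_small (Rabs y) p Hp). lra.
- assert (Hx : 0 < Rabs x) by (apply Rabs_pos_lt, n).
  apply (continuous_ext_loc _ (fun x => exp (p * ln (Rabs x)))).
  + exists (mkposreal _ Hx). intros y Hy.
    unfold ball in *; simpl in *; unfold AbsRing_ball, abs, minus, plus, opp in *; simpl in *.
    rewrite rpow_pos; [reflexivity|]. apply Rabs_pos_lt. intros ->.
    rewrite Rplus_0_l, Rabs_Ropp in Hy. lra.
  + apply continuous_comp; [|apply continuous_exp].
    apply (continuous_scal_r (V := R_NormedModule) p (fun x => ln (Rabs x))).
    apply continuous_comp. apply continuous_Rabs. apply continuous_ln. exact Hx.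
Qed.

Lemma continuous_rpow_Cmod {U : UniformSpace} (f : U -> C) x p : 1 <= p -> Ccont f x ->
  continuous (fun u => rpow (Cmod (f u)) p) x.
Proof.
intros Hp Hf. apply (continuous_ext (fun u => rpow (Rabs (Cmod (f u))) p)).
{ intros u. rewrite Rabs_pos_eq by apply Cmod_ge_0. reflexivity. }
apply (continuous_comp (fun u => Cmod (f u)) (fun y => rpow (Rabs y) p)).
apply continuous_Cmod, Hf. apply continuous_rpow_Rabs, Hp.
Qed.

Lemma RInt_cont (f : R -> R) a b : (forall t, continuous f t) -> is_RInt f a b (RInt f a b).
Proof.
intros H. apply (RInt_correct (V := R_CompleteNormedModule)).
apply (ex_RInt_continuous (V := R_CompleteNormedModule)). intros t _. apply H.
Qed.

Definition circ_mean p (f : C -> C) r := RInt (fun t => rpow (Cmod (f (circle_pt r t))) p) 0 (2 * PI).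

Lemma is_circ_mean p f r : 1 <= p -> holo f -> 0 <= r < 1 ->
  is_RInt (fun t => rpow (Cmod (f (circle_pt r t))) p) 0 (2 * PI) (circ_mean p f r).
Proof.
intros Hp Hf Hr. apply RInt_cont. intros t.
apply (continuous_rpow_Cmod (fun t => f (circle_pt r t))); trivial.
apply holo_circle_cont; trivial.
Qed.

Lemma hardy_mean_circ p f r : 1 <= p -> holo f -> 0 <= r < 1 ->
  hardy_mean p f r = circ_mean p f r / (2 * PI).
Proof.
intros Hp Hf Hr. unfold hardy_mean. apply is_RInt_unique.
pose proof (is_RInt_scal (V := R_NormedModule) _ _ _ (/ (2 * PI)) _ (is_circ_mean p f r Hp Hf Hr)) as K.
match type of K with is_RInt _ _ _ ?L => replace (circ_mean p f r / (2 * PI)) with L end.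
2:{ unfold scal; simpl; unfold mult; simpl. unfold Rdiv. ring. }
eapply is_RInt_ext with (2 := K). intros t _. unfold scal; simpl; unfold mult; simpl. unfold Rdiv. ring.
Qed.

(** The later estimates add up integrals of |f|^p, so membership in H^p is tested on these
    integrals, without normalisation and without p-th roots. *)
Lemma Hp_iff p f : 1 <= p ->
  (Hp p f <-> holo f /\ exists B, forall r, 0 <= r < 1 -> circ_mean p f r <= B).
Proof.
intros Hp1. pose proof two_PI_pos. split.
- intros [Hf [M [HM H1]]]. split; trivial. exists (rpow M p * (2 * PI)). intros r Hr.
  specialize (H1 r Hr). rewrite hardy_mean_circ in H1 by trivial.
  apply Rmult_le_reg_r with (/ (2 * PI)). apply Rinv_0_lt_compat; lra.
  rewrite (Rmult_assoc (rpow M p)), Rinv_r, Rmult_1_r by lra. exact H1.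
- intros [Hf [B HB]]. split; trivial.
  (* The maximum with 1 makes the base of the p-th root positive, as the identities for [Rpower]
     require. *)
  set (B' := Rmax B 1 / (2 * PI)).
  assert (HB' : 0 < B'). { unfold B'. apply Rdiv_lt_0_compat; trivial. pose proof (Rmax_r B 1). lra. }
  exists (Rpower B' (/ p)). split. left. apply Rpower_pos.
  intros r Hr. rewrite rpow_pos by apply Rpower_pos.
  rewrite Rpower_mult, Rinv_l, Rpower_1 by lra.
  rewrite hardy_mean_circ by trivial. unfold B', Rdiv.
  apply Rmult_le_compat_r. left. apply Rinv_0_lt_compat; lra.
  eapply Rle_trans. apply HB, Hr. apply Rmax_l.
Qed.

(* Replaces Hoelder's inequality; [lam] is optimised later. *)
Lemma rpow_young y lam p : 1 <= p -> 0 < lam -> 0 <= y -> y <= lam + Rpower lam (1 - p) * rpow y p.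
Proof.
intros Hp Hl Hy. pose proof (Rpower_pos lam (1 - p)). pose proof (rpow_nonneg y p).
destruct (Rle_dec y lam). nra.
assert (K : Rpower lam (1 - p) * rpow y p >= y); [|nra].
rewrite rpow_pos by lra.
replace (Rpower lam (1 - p)) with (/ Rpower lam (p - 1)).
2:{ rewrite <- Rpower_Ropp. f_equal. ring. }
replace (Rpower y p) with (y * Rpower y (p - 1)).
2:{ rewrite <- (Rpower_1 y) at 1 by lra. rewrite <- Rpower_plus. f_equal. ring. }
assert (Rpower lam (p - 1) <= Rpower y (p - 1)) by (apply Rle_Rpower_l; lra).
pose proof (Rpower_pos lam (p - 1)).
apply Rle_ge. apply Rmult_le_reg_l with (Rpower lam (p - 1)); trivial.
rewrite <- Rmult_assoc, Rinv_r by lra. nra.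
Qed.

Lemma Hp_deriv_growth p f : 1 <= p -> Hp p f -> exists K, 0 <= K /\ forall a, unit_disc a ->
  Cmod (C_derive f a) <= K * Rpower (1 - Cmod a) (- (1 + / p)).
Proof.
intros Hp1 Hf. destruct (proj1 (Hp_iff p f Hp1) Hf) as [Hh [B HB]].
pose proof two_PI_pos as Hpi.
assert (HB0 : 0 <= B).
{ eapply Rle_trans; [|apply (HB 0); lra]. unfold circ_mean.
  apply RInt_ge_0. lra. eexists; apply is_circ_mean; trivial; lra. intros; apply rpow_nonneg. }
exists (4 + 8 * (B / (2 * PI))). split.
{ assert (0 <= B / (2 * PI)) by (apply Rmult_le_pos; trivial; left; apply Rinv_0_lt_compat; lra). lra. }
intros a Ha. unfold unit_disc in Ha. pose proof (Cmod_ge_0 a) as Ha0.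
set (d := 1 - Cmod a). assert (Hd : 0 < d) by (unfold d; lra).
set (r := (1 + Cmod a) / 2). assert (Hr : 0 < r < 1) by (unfold r; lra).
assert (Har : Cmod a < r) by (unfold r; lra).
assert (Hq : d / 2 <= 1 - Cmod a / r).
{ apply Rmult_le_reg_r with r. lra. unfold Rdiv. rewrite Rmult_minus_distr_r.
  rewrite (Rmult_assoc (Cmod a)), Rinv_l by lra. unfold d, r. nra. }
set (q := Cmod a / r) in *.
assert (Hq0 : 0 <= q) by (apply Rmult_le_pos; trivial; left; apply Rinv_0_lt_compat; lra).
(* This choice balances the two terms of [rpow_young]: lam times the square mean of the kernel, of
   order 1/d, and lam^(1-p) times the supremum of its square, of order 1/d^2. Both become d^(-(1 +
   1/p)). *)
set (lam := Rpower d (- / p)). assert (Hlam : 0 < lam) by apply Rpower_pos.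
assert (Hp0 : 0 < p) by lra.
assert (E1 : Rpower lam (1 - p) = Rpower d (1 - / p)).
{ unfold lam. rewrite Rpower_mult. f_equal. field. lra. }
assert (E2 : lam / d = Rpower d (- (1 + / p))).
{ unfold lam, Rdiv. rewrite <- (Rpower_1 d) at 2 by lra. rewrite <- Rpower_Ropp, <- Rpower_plus. f_equal. ring. }
assert (E3 : Rpower lam (1 - p) / d ^ 2 = Rpower d (- (1 + / p))).
{ rewrite E1. unfold Rdiv. rewrite <- (Rpower_pow 2) by lra. rewrite <- Rpower_Ropp, <- Rpower_plus.
  f_equal. simpl. ring. }
pose proof (cauchy_formula_deriv f r a Hh Hr Har) as I.
pose proof (is_RInt_scal (V := R_NormedModule) _ _ _ (2 * lam) _ (ck_sqr_mean r a (proj1 Hr) Har)) as I1.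
assert (Hr' : 0 <= r < 1) by lra.
pose proof (is_RInt_scal (V := R_NormedModule) _ _ _ (2 * (Rpower lam (1 - p) * (2 / d) ^ 2)) _ (is_circ_mean p f r Hp1 Hh Hr')) as I2.
pose proof (is_RInt_plus (V := R_NormedModule) _ _ _ _ _ _ I1 I2) as I3.
assert (L' : Cmod (RtoC (2 * PI) * C_derive f a) <=
   2 * lam * (2 * PI / (1 - q ^ 2)) + 2 * (Rpower lam (1 - p) * (2 / d) ^ 2) * circ_mean p f r).
{ eapply Rle_trans. eapply is_CInt_le with (3 := I) (4 := I3). lra.
  - intros t _.
    change (Cmod (f (circle_pt r t) * / circle_pt r t * ck r a t ^ 2) <=
      2 * lam * Cmod (ck r a t) ^ 2 + 2 * (Rpower lam (1 - p) * (2 / d) ^ 2) * rpow (Cmod (f (circle_pt r t))) p).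
    rewrite !Cmod_mult, Cmod_inv, Cmod_circle, Cmod_pow by (try apply circle_neq_0; lra).
    destruct (ck_bound r a (Cmod a) t (proj1 Hr) (Rle_refl _) Har) as [_ Bk]. fold q in Bk.
    pose proof (Cmod_ge_0 (ck r a t)) as Hk.
    assert (Bk' : Cmod (ck r a t) <= 2 / d).
    { eapply Rle_trans. exact Bk. replace (2 / d) with (/ (d / 2)) by (field; lra).
      apply Rinv_le_contravar; lra. }
    pose proof (rpow_young (Cmod (f (circle_pt r t))) lam p Hp1 Hlam (Cmod_ge_0 _)) as Y.
    assert (Hir : / r <= 2).
    { replace 2 with (/ / 2) by field. apply Rinv_le_contravar; unfold r; lra. }
    assert (0 < / r) by (apply Rinv_0_lt_compat; lra).
    pose proof (Cmod_ge_0 (f (circle_pt r t))).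
    assert (S1 : Cmod (ck r a t) ^ 2 <= (2 / d) ^ 2) by (apply pow_incr; lra).
    pose proof (pow2_ge_0 (Cmod (ck r a t))).
    set (kk := Cmod (ck r a t) ^ 2) in *. set (ff := Cmod (f (circle_pt r t))) in *.
    pose proof (Rpower_pos lam (1 - p)). pose proof (rpow_nonneg ff p).
    set (P := Rpower lam (1 - p)) in *. set (R := rpow ff p) in *.
    assert (0 <= P * R) by nra.
    apply Rle_trans with (2 * (lam + P * R) * kk).
    + apply Rmult_le_compat_r; trivial. nra.
    + assert (P * R * kk <= P * R * (2 / d) ^ 2) by (apply Rmult_le_compat_l; trivial). nra.
  - right. reflexivity. }
rewrite Cmod_mult, Cmod_R, Rabs_pos_eq in L' by lra.
assert (Hq2 : d / 2 <= 1 - q ^ 2) by nra.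
assert (M1 : 2 * PI / (1 - q ^ 2) <= 2 * PI * (2 / d)).
{ apply Rmult_le_compat_l. lra. replace (2 / d) with (/ (d / 2)) by (field; lra).
  apply Rinv_le_contravar; lra. }
assert (M2 : circ_mean p f r <= B) by (apply HB; trivial).
pose proof (Rpower_pos lam (1 - p)) as HP.
assert (Hdd : 0 < (2 / d) ^ 2) by (apply pow_lt, Rdiv_lt_0_compat; lra).
apply Rmult_le_reg_l with (2 * PI). lra.
eapply Rle_trans. exact L'.
apply Rle_trans with (2 * lam * (2 * PI * (2 / d)) + 2 * (Rpower lam (1 - p) * (2 / d) ^ 2) * B).
- apply Rplus_le_compat. apply Rmult_le_compat_l; lra. apply Rmult_le_compat_l; trivial. nra.
- right. replace (2 * lam * (2 * PI * (2 / d))) with (2 * PI * (4 * (lam / d))) by (field; lra).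
  replace (2 * (Rpower lam (1 - p) * (2 / d) ^ 2) * B) with (8 * B * (Rpower lam (1 - p) / d ^ 2)) by (field; lra).
  rewrite E2, E3. field. apply PI_neq0.
Qed.

(** * Local bounds, factorisation at a zero, isolated zeros *)

Lemma divided_diff_0 f z : unit_disc z -> f z = (f 0 + z * divided_diff f (C_derive f) 0 z)%C.
Proof.
intros _. unfold divided_diff. destruct (Ceq_dec z 0) as [->|n]. ring.
field. intros E. apply n. rewrite <- E. ring.
Qed.

(** Cauchy's formula on a larger circle bounds f by an integral of |f| over that circle; no covering
    argument is involved. *)
Lemma holo_bounded_compact f rho : holo f -> 0 <= rho < 1 ->
  exists B, 0 <= B /\ forall z, Cmod z <= rho -> Cmod (f z) <= B.
Proof.
intros Hf Hrho. pose proof two_PI_pos as Hpi.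
set (r := (1 + rho) / 2). assert (Hr : rho < r < 1) by (unfold r; lra).
assert (Hr' : 0 <= r < 1) by lra.
assert (Hc : forall t, continuous (fun t => Cmod (f (circle_pt r t))) t)
  by (intros t; apply (continuous_Cmod (fun t => f (circle_pt r t))), holo_circle_cont; trivial).
pose proof (RInt_cont _ 0 (2 * PI) Hc) as I. set (M := RInt _ 0 (2 * PI)) in I.
assert (HM : 0 <= M).
{ apply RInt_ge_0. lra. eexists; exact I. intros; apply Cmod_ge_0. }
assert (Hq : 0 < 1 - rho / r) by (apply one_minus_div_pos; lra).
assert (Hq' : 0 < / (1 - rho / r)) by (apply Rinv_0_lt_compat, Hq).
exists (M * / (1 - rho / r) / (2 * PI)). split.
{ apply Rmult_le_pos. nra. left; apply Rinv_0_lt_compat; lra. }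
intros z Hz.
assert (Hr2 : 0 < r < 1) by lra. assert (Hzr : Cmod z < r) by lra.
pose proof (cauchy_formula f r z Hf Hr2 Hzr) as J.
pose proof (is_RInt_scal (V := R_NormedModule) _ _ _ (/ (1 - rho / r)) _ I) as I'.
assert (L : Cmod (RtoC (2 * PI) * f z) <= / (1 - rho / r) * M).
{ eapply is_CInt_le with (3 := J) (4 := I'). lra. intros t _.
  change (Cmod (f (circle_pt r t) * ck r z t) <= / (1 - rho / r) * Cmod (f (circle_pt r t))).
  rewrite Cmod_mult, Rmult_comm. apply Rmult_le_compat_r. apply Cmod_ge_0.
  apply (ck_bound r z rho t); lra. }
rewrite Cmod_mult, Cmod_R, Rabs_pos_eq in L by lra.
apply Rmult_le_reg_l with (2 * PI). lra. eapply Rle_trans. exact L. right. field.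
pose proof PI_neq0. repeat split; lra.
Qed.

(** On the circle of radius r the cofactor of z^n is at most B / r^n, so Cauchy's formula gives |f
    z| <= A (|z| / r)^n with A independent of n. *)
Lemma vanish_infinite_order f : holo f ->
  (forall n, exists u, holo u /\ forall z, unit_disc z -> f z = (z ^ n * u z)%C) ->
  forall z, unit_disc z -> f z = 0.
Proof.
intros Hf H z Hz. pose proof two_PI_pos as Hpi. pose proof (Cmod_ge_0 z) as Hz0. unfold unit_disc in Hz.
set (r := (1 + Cmod z) / 2). assert (Hr : Cmod z < r < 1) by (unfold r; lra).
assert (Hr' : 0 <= r < 1) by lra. assert (Hr2 : 0 < r < 1) by lra.
destruct (holo_bounded_compact f r Hf Hr') as [B [HB HBf]].
assert (Hq : 0 < 1 - Cmod z / r) by (apply one_minus_div_pos; lra).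
set (q := Cmod z / r) in *.
assert (Hq0 : 0 <= q) by (apply Rmult_le_pos; trivial; left; apply Rinv_0_lt_compat; lra).
set (A := B * / (1 - q)).
assert (HA : 0 <= A) by (apply Rmult_le_pos; trivial; left; apply Rinv_0_lt_compat; lra).
assert (K : forall n, Cmod (f z) <= A * q ^ n).
{ intros n. destruct (H n) as [u [Hu E]].
  pose proof (cauchy_formula u r z Hu Hr2 (proj1 Hr)) as J.
  assert (Prn : 0 < r ^ n) by (apply pow_lt; lra).
  assert (L : Cmod (RtoC (2 * PI) * u z) <= (2 * PI - 0) * (A / r ^ n)).
  { eapply is_CInt_le_const with (3 := J). lra. intros t _. rewrite Cmod_mult.
    assert (Cmod (u (circle_pt r t)) * r ^ n <= B).
    { rewrite <- (Cmod_circle r t) at 2 by lra. rewrite <- Cmod_pow, <- Cmod_mult, Cmult_comm, <- E.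
      apply HBf. rewrite Cmod_circle; lra. apply circle_disc; trivial. }
    assert (Cmod (u (circle_pt r t)) <= B / r ^ n).
    { apply Rmult_le_reg_r with (r ^ n); trivial. unfold Rdiv. rewrite Rmult_assoc, Rinv_l; lra. }
    replace (A / r ^ n) with (B / r ^ n * / (1 - q)) by (unfold A; field; lra).
    apply Rmult_le_compat; try apply Cmod_ge_0; trivial.
    apply (ck_bound r z (Cmod z) t); lra. }
  rewrite Rminus_0_r, Cmod_mult, Cmod_R, Rabs_pos_eq in L by lra.
  apply Rmult_le_reg_l in L; [|lra].
  rewrite E by exact Hz. rewrite Cmod_mult, Cmod_pow.
  apply Rle_trans with (Cmod z ^ n * (A / r ^ n)).
  - apply Rmult_le_compat_l; trivial. apply pow_le; trivial.
  - right. unfold q, Rdiv. rewrite Rpow_mult_distr, pow_inv. ring. }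
apply Cmod_eq_0. apply Rle_antisym; [|apply Cmod_ge_0]. apply le_epsilon. intros eps He.
rewrite Rplus_0_l.
destruct (pow_lt_1_zero q) with (y := eps / (A + 1)) as [n Hn].
rewrite Rabs_pos_eq; lra. apply Rdiv_lt_0_compat; lra.
specialize (Hn n (Nat.le_refl n)). pose proof (pow_le q n Hq0).
rewrite Rabs_pos_eq in Hn by trivial.
eapply Rle_trans. apply (K n).
apply Rle_trans with ((A + 1) * (eps / (A + 1))). apply Rmult_le_compat; lra. right; field; lra.
Qed.

(** If there were no such factorisation, every cofactor u would vanish at 0 and a further factor z
    could be split off, so that f would have a zero of infinite order. *)
Lemma zero_factor_0 f : holo f -> (exists z, unit_disc z /\ f z <> 0) ->
  exists n u, holo u /\ u 0 <> 0 /\ forall z, unit_disc z -> f z = (z ^ n * u z)%C.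
Proof.
intros Hf [z0 [Hz0 Hfz]].
destruct (classic (exists n u, holo u /\ u 0 <> 0 /\ forall z, unit_disc z -> f z = (z ^ n * u z)%C)) as [H|H]; trivial.
exfalso. apply Hfz. apply vanish_infinite_order; trivial.
induction n as [|n [u [Hu E]]].
- exists f. split; trivial. intros z _. simpl. ring.
- exists (divided_diff u (C_derive u) 0). split.
  + apply divided_diff_holo. apply holo_C_derive, Hu. intros z Hz. apply C_derive_is; trivial. apply unit_disc_0.
  + intros z Hz. rewrite E by trivial. rewrite (divided_diff_0 u z Hz) at 1.
    destruct (classic (u 0 = 0)) as [E0|E0].
    * rewrite E0, Cpow_S. ring.
    * exfalso. apply H. exists n, u. auto.
Qed.

Lemma mobius_denom a z : unit_disc a -> unit_disc z -> (1 - Cconj a * z)%C <> 0.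
Proof.
intros Ha Hz. apply one_minus_neq_0. rewrite Cmod_mult, Cmod_conj. unfold unit_disc in *.
pose proof (Cmod_ge_0 a). pose proof (Cmod_ge_0 z). nra.
Qed.

Lemma mobius_disc a z : unit_disc a -> unit_disc z -> unit_disc (mobius a z).
Proof.
intros Ha Hz. pose proof (mobius_denom a z Ha Hz) as N. unfold mobius, unit_disc in *.
rewrite Cmod_div by trivial. pose proof (proj1 (Cmod_gt_0 _) N) as Hp.
apply Rmult_lt_reg_r with (Cmod (1 - Cconj a * z)); trivial.
unfold Rdiv. rewrite Rmult_assoc, Rinv_l, Rmult_1_l, Rmult_1_r by lra.
pose proof (Cmod_ge_0 (z - a)).
assert (E : Cmod (1 - Cconj a * z) ^ 2 - Cmod (z - a) ^ 2 = (1 - Cmod z ^ 2) * (1 - Cmod a ^ 2)).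
{ rewrite !Cmod_sqr. destruct a, z; simpl. ring. }
pose proof (Cmod_ge_0 a). pose proof (Cmod_ge_0 z).
assert (0 < (1 - Cmod z ^ 2) * (1 - Cmod a ^ 2)) by (apply Rmult_lt_0_compat; nra). nra.
Qed.

Lemma mobius_inv a z : unit_disc a -> unit_disc z -> mobius (- a) (mobius a z) = z.
Proof.
intros Ha Hz. pose proof (mobius_denom a z Ha Hz) as N.
assert (Na : (1 - Cconj a * a)%C <> 0) by (apply mobius_denom; trivial).
unfold mobius. rewrite Copp_conj. field. split; trivial.
replace (1 - Cconj a * z - - Cconj a * (z - a))%C with (1 - Cconj a * a)%C by ring. trivial.
Qed.

Lemma mobius_holo a : unit_disc a -> holo (mobius a).
Proof.
intros Ha z Hz. eexists. unfold mobius. apply (cderiv_div (fun z => z - a)%C (fun z => 1 - Cconj a * z)%C).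
apply (cderiv_minus (fun z => z) (fun _ => a)). apply cderiv_id. apply cderiv_const.
apply cderiv_one_minus. apply mobius_denom; trivial.
Qed.

Lemma unit_disc_opp a : unit_disc a -> unit_disc (- a).
Proof. unfold unit_disc. rewrite Cmod_opp. trivial. Qed.

(** The automorphism [mobius (- a)] carries 0 to a and reduces the statement to [zero_factor_0]. The
    powers of 1 - conj(a) z from the inverse automorphism have no zeros and go into u. *)
Theorem zero_factor f a : holo f -> (exists z, unit_disc z /\ f z <> 0) -> unit_disc a ->
  exists n u, holo u /\ u a <> 0 /\ forall z, unit_disc z -> f z = ((z - a) ^ n * u z)%C.
Proof.
intros Hf [z0 [Hz0 Hfz]] Ha.
destruct (zero_factor_0 (fun w => f (mobius (- a) w))) as [n [u [Hu [Hu0 E]]]].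
- intros w Hw. destruct (mobius_holo (- a) (unit_disc_opp a Ha) w Hw) as [l Hl].
  destruct (Hf _ (mobius_disc _ _ (unit_disc_opp a Ha) Hw)) as [l' Hl'].
  eexists. apply (cderiv_comp f (mobius (- a))); eassumption.
- exists (mobius a z0). split. apply mobius_disc; trivial. rewrite mobius_inv; trivial.
- exists n, (fun z => u (mobius a z) * / (1 - Cconj a * z) ^ n)%C. split; [|split].
  + intros z Hz. destruct (mobius_holo a Ha z Hz) as [l Hl].
    destruct (Hu _ (mobius_disc _ _ Ha Hz)) as [l' Hl'].
    eexists. apply (cderiv_mult (fun z => u (mobius a z)) (fun z => / (1 - Cconj a * z) ^ n)%C).
    apply (cderiv_comp u (mobius a)); eassumption.
    apply (cderiv_inv (fun z => (1 - Cconj a * z) ^ n)%C).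
    apply (cderiv_pow n (fun z => 1 - Cconj a * z)%C). apply cderiv_one_minus.
    apply Cpow_nz, mobius_denom; trivial.
  + apply Cmult_neq_0.
    * replace (mobius a a) with (RtoC 0); trivial. unfold mobius. replace (a - a)%C with (RtoC 0) by ring.
      unfold Cdiv. ring.
    * intros E0. assert (N : ((1 - Cconj a * a) ^ n)%C <> 0) by (apply Cpow_nz, mobius_denom; trivial).
      apply C1_nz. rewrite <- (Cinv_r _ N), E0. ring.
  + intros z Hz. rewrite <- (mobius_inv a z Ha Hz) at 1. rewrite E by (apply mobius_disc; trivial).
    pose proof (mobius_denom a z Ha Hz) as N.
    unfold mobius at 1. unfold Cdiv. rewrite Cpow_mult_l, Cpow_inv by trivial. ring.
Qed.

Lemma zeros_isolated f a : holo f -> (exists z, unit_disc z /\ f z <> 0) -> unit_disc a ->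
  exists d, 0 < d /\ forall w, Cmod (w - a) < d -> w <> a -> unit_disc w /\ f w <> 0.
Proof.
intros Hf Hn Ha. destruct (zero_factor f a Hf Hn Ha) as [n [u [Hu [Hu0 E]]]].
pose proof (proj1 (Cmod_gt_0 _) Hu0) as Hp.
destruct (proj1 (ccontinuous_eps u a) (holo_cont u Hu a Ha) _ Hp) as [d [Hd Hw]].
assert (Ha1 : 0 < 1 - Cmod a) by (unfold unit_disc in Ha; lra).
exists (Rmin d (1 - Cmod a)). split. apply Rmin_pos; trivial.
intros w Hlt Hwa.
assert (Hwd : unit_disc w) by (apply (disc_nbhd a); eapply Rlt_le_trans; [exact Hlt | apply Rmin_r]).
split; trivial. rewrite E by trivial. apply Cmult_neq_0. apply Cpow_nz, Cminus_neq_0, Hwa.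
intros E0. specialize (Hw w (Rlt_le_trans _ _ _ Hlt (Rmin_l _ _))). rewrite E0 in Hw.
replace (0 - u a)%C with (- u a)%C in Hw by ring. rewrite Cmod_opp in Hw. lra.
Qed.

(** Identities found by dividing by g' hold off its isolated zeros; continuity carries them
    across. *)
Lemma punctured_eq f g a : ccontinuous f a -> ccontinuous g a ->
  @locally' C_UniformSpace a (fun w => f w = g w) -> f a = g a.
Proof.
intros Hf Hg H. apply locally'_Cmod in H. destruct H as [d [Hd H]].
destruct (classic (f a = g a)) as [E|E]; trivial. exfalso.
pose proof (proj1 (Cmod_gt_0 _) (Cminus_neq_0 _ _ E)) as Hp.
set (e := Cmod (f a - g a)) in *.
destruct (proj1 (ccontinuous_eps f a) Hf (e / 2)) as [d1 [Hd1 H1]]. lra.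
destruct (proj1 (ccontinuous_eps g a) Hg (e / 2)) as [d2 [Hd2 H2]]. lra.
set (m := Rmin d (Rmin d1 d2) / 2).
assert (Hm : 0 < m /\ m < d /\ m < d1 /\ m < d2).
{ unfold m. pose proof (Rmin_l d (Rmin d1 d2)). pose proof (Rmin_r d (Rmin d1 d2)).
  pose proof (Rmin_l d1 d2). pose proof (Rmin_r d1 d2).
  assert (0 < Rmin d (Rmin d1 d2)) by (repeat apply Rmin_pos; trivial). lra. }
set (w := (a + m)%C).
assert (Em : Cmod (w - a) = m).
{ unfold w. replace (a + m - a)%C with (RtoC m) by ring. rewrite Cmod_R, Rabs_pos_eq; lra. }
assert (Hwa : w <> a).
{ intros E1. rewrite E1 in Em. replace (a - a)%C with (RtoC 0) in Em by ring. rewrite Cmod_0 in Em. lra. }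
specialize (H w). specialize (H1 w). specialize (H2 w). rewrite Em in *.
rewrite H in H1 by (trivial; lra).
assert (e <= Cmod (g w - f a) + Cmod (g w - g a)).
{ unfold e. rewrite (Cmod_sub_comm (g w) (f a)). replace (f a - g a)%C with ((f a - g w) + (g w - g a))%C by ring.
  apply Cmod_triangle. }
assert (Hm' : m < d1 /\ m < d2) by lra. specialize (H1 (proj1 Hm')). specialize (H2 (proj2 Hm')). lra.
Qed.

Lemma disc_FTC f z : holo f -> unit_disc z -> f z = (f 0 + prim (C_derive f) z)%C.
Proof.
intros Hf Hz. unfold prim. rewrite (seg_int_FTC _ (holo_cont _ (holo_C_derive f Hf)) f).
ring. apply unit_disc_0. trivial. intros w Hw. apply C_derive_is; trivial.
Qed.

Lemma nonconstant_deriv f : holo f -> nonconstant f -> exists z, unit_disc z /\ C_derive f z <> 0.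
Proof.
intros Hf Hn. apply NNPP. intros H. apply Hn. exists (f 0). intros z Hz.
rewrite (disc_FTC f z Hf Hz). replace (prim (C_derive f) z) with (RtoC 0). ring.
symmetry. apply Cmod_eq_0. apply Rle_antisym; [|apply Cmod_ge_0].
apply Rle_trans with (Cmod (z - 0) * 0); [|right; ring].
apply seg_int_bound; [apply holo_cont, holo_C_derive, Hf | apply unit_disc_0 | exact Hz |].
intros t Ht. right. transitivity (Cmod 0); [f_equal | apply Cmod_0]. apply NNPP. intros E. apply H.
exists (seg_pt 0 z t). split; trivial. apply seg_pt_unit_disc; trivial. apply unit_disc_0.
Qed.

(** * Superharmonicity *)

(** Here al = |F'|^2, be = |G'|^2, x = |F|^2, y = |G|^2, and (X1, X2), (Y1, Y2) are half the
    gradients of x and y in the radial and angular directions, so that PP = |grad s|^2 / 4. Up to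
    the factor 4 s^(q-3), the first two terms are the Laplacian of s^q, at most 2 q (1 + q) s^2 al,
    and the bracket is the Laplacian of x s^(q-1), at least s^2 al / 10; hence the coefficient 20 q
    (1 + q). The obstacle is the cross term [T]: from T^2 <= x y al be and 4 x y <= s^2, the
    smallness of be gives |2 T| <= k s al. *)
Lemma superharmonic_ineq (q al be x y X1 X2 Y1 Y2 : R) :
  / 2 <= q -> 0 <= al -> 0 <= be -> 0 <= x -> 0 <= y ->
  be <= (/ (10 * (1 + q))) ^ 2 * al ->
  X1 ^ 2 + X2 ^ 2 = x * al -> Y1 ^ 2 + Y2 ^ 2 = y * be ->
  let s := 1 + x + y in
  let PP := (X1 + Y1) ^ 2 + (X2 + Y2) ^ 2 in
  let V := al + be in
  q * s ^ 2 * V + q * (q - 1) * s * PP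
   - 20 * q * (1 + q) * (s ^ 2 * al + (q - 1) * x * s * V + (q - 1) * (q - 2) * x * PP
        + 2 * (q - 1) * s * (X1 * (X1 + Y1) + X2 * (X2 + Y2))) <= 0.
Proof.
intros Hq Hal Hbe Hx Hy Hb HX HY s PP V.
set (k := / (10 * (1 + q))) in *.
assert (Hk : 0 < k <= / 15).
{ split. apply Rinv_0_lt_compat; lra. apply Rinv_le_contravar; lra. }
assert (Hkq : k * (10 * (1 + q)) = 1) by (apply Rinv_l; lra).
clearbody k.
assert (Hs : 1 <= s) by (unfold s; lra).
assert (Hxs : x <= s) by (unfold s; lra).
set (T := X1 * Y1 + X2 * Y2).
assert (HT2 : T ^ 2 <= (x * al) * (y * be)).
{ rewrite <- HX, <- HY. unfold T. assert (0 <= (X1 * Y2 - X2 * Y1) ^ 2) by apply pow2_ge_0. nra. }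
assert (EPP : PP = x * al + 2 * T + y * be) by (unfold PP, T; rewrite <- HX, <- HY; ring).
assert (HPP0 : 0 <= PP) by (unfold PP; pose proof (pow2_ge_0 (X1 + Y1)); pose proof (pow2_ge_0 (X2 + Y2)); lra).
assert (HTb : 2 * T <= x * be + y * al).
{ assert (0 <= x * be) by nra. assert (0 <= y * al) by nra.
  assert ((2 * T) ^ 2 <= (x * be + y * al) ^ 2).
  { pose proof (pow2_ge_0 (x * be - y * al)). nra. }
  nra. }
assert (HV0 : 0 <= V) by (unfold V; lra).
assert (HCS : PP <= s * V).
{ rewrite EPP. unfold s, V. nra. }
assert (HTk : Rabs (2 * T) <= k * s * al).
{ assert (Hks : 0 <= k * s * al) by (repeat apply Rmult_le_pos; lra).
  rewrite <- (Rabs_pos_eq (k * s * al)) by trivial. apply Rsqr_le_abs_0. unfold Rsqr.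
  assert (x * al * (y * be) <= x * y * (k ^ 2 * al ^ 2)).
  { replace (x * al * (y * be)) with (x * y * al * be) by ring.
    replace (x * y * (k ^ 2 * al ^ 2)) with (x * y * al * (k ^ 2 * al)) by ring.
    apply Rmult_le_compat_l; trivial. repeat apply Rmult_le_pos; trivial. }
  assert (4 * (x * y) <= s * s) by (unfold s; pose proof (pow2_ge_0 (x - y)); nra).
  assert (0 <= k ^ 2 * al ^ 2) by (apply Rmult_le_pos; apply pow2_ge_0).
  assert (4 * (x * y) * (k ^ 2 * al ^ 2) <= s * s * (k ^ 2 * al ^ 2)) by (apply Rmult_le_compat_r; trivial).
  replace (k * s * al * (k * s * al)) with (s * s * (k ^ 2 * al ^ 2)) by ring. nra. }
apply Rabs_le_between in HTk.
assert (Hss : 0 <= s ^ 2 * al) by (apply Rmult_le_pos; trivial; apply pow2_ge_0).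
assert (HV : V <= (1 + k ^ 2) * al) by (unfold V; lra).
assert (HE : s ^ 2 * al / 10 <= s ^ 2 * al + (q - 1) * x * s * V + (q - 1) * (q - 2) * x * PP
        + 2 * (q - 1) * s * (X1 * (X1 + Y1) + X2 * (X2 + Y2))).
{ replace (X1 * (X1 + Y1) + X2 * (X2 + Y2)) with (x * al + T) by (unfold T; rewrite <- HX; ring).
  destruct (Rle_dec 1 q) as [H1|H1].
  (* Since (q - 1)(q - 2) = (q - 1)^2 - (q - 1), the possibly negative coefficient q - 2 is absorbed
     by PP <= s V. Only the cross term can still be negative, and it costs at most (q - 1) k <= 1/10
     of s^2 al. *)
  - assert (A1 : 0 <= (q - 1) * x * (s * V - PP)) by (repeat apply Rmult_le_pos; lra).
    assert (A2 : 0 <= (q - 1) ^ 2 * x * PP) by (repeat apply Rmult_le_pos; trivial; nra).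
    assert (A3 : 0 <= (q - 1) * s * (x * al)) by (repeat apply Rmult_le_pos; lra).
    assert (A4 : - ((q - 1) * s * (k * s * al)) <= (q - 1) * s * (2 * T)).
    { assert (0 <= (q - 1) * s) by nra. nra. }
    assert (A5 : (q - 1) * k <= / 10) by nra.
    assert (A6 : (q - 1) * k * (s ^ 2 * al) <= / 10 * (s ^ 2 * al)) by (apply Rmult_le_compat_r; trivial).
    nra.
  - set (m := 1 - q). assert (Hm : 0 < m <= / 2) by (unfold m; lra).
    replace (q - 1) with (- m) by (unfold m; ring). replace (q - 2) with (- (1 + m)) by (unfold m; ring).
    assert (Hxs0 : 0 <= x * s) by nra.
    assert (Hxss : x * s <= s ^ 2) by nra.
    assert (B1 : x * s * V <= x * s * ((1 + k ^ 2) * al)) by (apply Rmult_le_compat_l; trivial).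
    assert (B2 : x * (x * al - k * s * al) <= x * PP).
    { apply Rmult_le_compat_l; trivial. rewrite EPP. nra. }
    assert (B3 : s * (2 * T) <= s * (k * s * al)) by (apply Rmult_le_compat_l; lra).
    (* Without the terms in k, the lower bound divided by al is s^2 - 3 m s x + m (1 + m) x^2 = (1 -
       m)^2 s^2 + m (s - x) ((2 - m) s - (1 + m) x), at least s^2 / 4 because m <= 1/2. The terms in
       k cost at most s^2 / 10. *)
    assert (B4 : 0 <= m * ((s - x) * ((2 - m) * s - (1 + m) * x))).
    { repeat apply Rmult_le_pos; try lra. nra. }
    assert (B5 : (/ 10) * s ^ 2 <= s ^ 2 - m * (x * s * (1 + k ^ 2)) + m * (1 + m) * (x * (x - k * s))
       - 2 * m * (s * x) - m * (k * s ^ 2)).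
    { assert (C1 : k * (m * k + m * (1 + m) + m) <= / 10).
      { assert (0 <= m * k <= / 30) by nra. assert (0 <= m * (1 + m) <= 3 / 4) by nra. nra. }
      assert (C2 : (1 - m) ^ 2 >= / 4) by nra.
      assert (C3 : k * (m * k + m * (1 + m)) * (x * s) <= k * (m * k + m * (1 + m)) * s ^ 2).
      { apply Rmult_le_compat_l; trivial. apply Rmult_le_pos. lra. assert (0 <= m * k) by nra. nra. }
      assert (C4 : k * (m * k + m * (1 + m) + m) * s ^ 2 <= / 10 * s ^ 2)
        by (apply Rmult_le_compat_r; trivial; apply pow2_ge_0).
      assert (C5 : / 4 * s ^ 2 <= (1 - m) ^ 2 * s ^ 2) by (apply Rmult_le_compat_r; [apply pow2_ge_0|lra]).
      assert (C6 : 0 <= s ^ 2) by apply pow2_ge_0.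
      nra. }
    apply (Rmult_le_compat_r al) in B5; trivial.
    assert (D1 : m * (x * s * V) <= m * (x * s * ((1 + k ^ 2) * al))) by (apply Rmult_le_compat_l; lra).
    assert (D2 : m * (1 + m) * (x * (x * al - k * s * al)) <= m * (1 + m) * (x * PP))
      by (apply Rmult_le_compat_l; nra).
    assert (D3 : m * (s * (2 * T)) <= m * (s * (k * s * al))) by (apply Rmult_le_compat_l; lra).
    nra. }
assert (HL : q * s ^ 2 * V + q * (q - 1) * s * PP <= 2 * q * (1 + q) * (s ^ 2 * al)).
{ assert (K1 : (q - 1) * PP <= q * (s * V)).
  { destruct (Rle_dec 1 q).
    - apply Rle_trans with ((q - 1) * (s * V)). apply Rmult_le_compat_l; lra.
      apply Rmult_le_compat_r; nra.
    - assert (0 <= q * (s * V)) by (repeat apply Rmult_le_pos; lra). nra. }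
  assert (K2 : q * s * ((q - 1) * PP) <= q * s * (q * (s * V))) by (apply Rmult_le_compat_l; nra).
  assert (K3 : V <= 2 * al).
  { assert (k ^ 2 <= 1) by nra. assert (k ^ 2 * al <= 1 * al) by (apply Rmult_le_compat_r; trivial). lra. }
  assert (K4 : q * (1 + q) * s ^ 2 * V <= q * (1 + q) * s ^ 2 * (2 * al)).
  { apply Rmult_le_compat_l; trivial. repeat apply Rmult_le_pos; lra. }
  apply Rle_trans with (q * s ^ 2 * V + q * s * (q * (s * V))).
  - replace (q * (q - 1) * s * PP) with (q * s * ((q - 1) * PP)) by ring. lra.
  - replace (q * s ^ 2 * V + q * s * (q * (s * V))) with (q * (1 + q) * s ^ 2 * V) by ring. lra. }
assert (Hqq : 0 <= 20 * q * (1 + q)) by nra.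
apply (Rmult_le_compat_l _ _ _ Hqq) in HE. nra.
Qed.

(** * Squared moduli of holomorphic functions in polar coordinates *)

Definition dot (z w : C) : R := fst z * fst w + snd z * snd w.

Lemma is_derive_eq (f : R -> R) (x l l' : R) : is_derive f x l -> l = l' -> is_derive f x l'.
Proof. intros H <-. exact H. Qed.

Lemma Rmult_deriv (f g : R -> R) (t a b : R) : is_derive f t a -> is_derive g t b ->
  is_derive (fun u => f u * g u) t (a * g t + f t * b).
Proof. intros Hf Hg. apply (is_derive_mult f g t a b Hf Hg). exact Rmult_comm. Qed.

Lemma dot_deriv (f g : R -> C) (t : R) (a b : C) : curve_deriv f t a -> curve_deriv g t b ->
  is_derive (fun u => dot (f u) (g u)) t (dot a (g t) + dot (f t) b).
Proof.
intros Hf Hg.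
pose proof (curve_deriv_fst _ _ _ Hf) as F1. pose proof (curve_deriv_snd _ _ _ Hf) as F2.
pose proof (curve_deriv_fst _ _ _ Hg) as G1. pose proof (curve_deriv_snd _ _ _ Hg) as G2.
eapply is_derive_eq.
- apply (is_derive_plus (V := R_NormedModule)); [exact (Rmult_deriv _ _ _ _ _ F1 G1) | exact (Rmult_deriv _ _ _ _ _ F2 G2)].
- unfold plus, dot; simpl. ring.
Qed.

Lemma continuous_dot {U : UniformSpace} (f g : U -> C) x : Ccont f x -> Ccont g x ->
  continuous (fun u => dot (f u) (g u)) x.
Proof.
intros Hf Hg. unfold dot.
pose proof (Ccont_fst _ _ Hf). pose proof (Ccont_snd _ _ Hf).
pose proof (Ccont_fst _ _ Hg). pose proof (Ccont_snd _ _ Hg).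
apply (continuous_plus (V := R_NormedModule)); apply (continuous_mult (K := R_AbsRing)); trivial.
Qed.

Lemma dot_Cmod z : dot z z = Cmod z ^ 2.
Proof. rewrite Cmod_sqr. unfold dot. ring. Qed.

Lemma circle_deriv_r r t : curve_deriv (fun r => circle_pt r t) r (ei t).
Proof. apply curve_deriv_pair; auto_derive; trivial; ring. Qed.

Lemma circle_disc_abs r t : Rabs r < 1 -> unit_disc (circle_pt r t).
Proof. intros Hr. unfold unit_disc. rewrite circle_ei, Cmod_mult, Cmod_ei, Cmod_R. lra. Qed.

Lemma curve_deriv_eq (f : R -> C) (t : R) (l l' : C) : curve_deriv f t l -> l = l' -> curve_deriv f t l'.
Proof. intros H <-. exact H. Qed.

Lemma curve_deriv_mult (f g : R -> C) (t : R) (a b : C) : curve_deriv f t a -> curve_deriv g t b ->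
  curve_deriv (fun u => f u * g u)%C t (a * g t + f t * b)%C.
Proof.
intros Hf Hg.
pose proof (curve_deriv_fst _ _ _ Hf) as F1. pose proof (curve_deriv_snd _ _ _ Hf) as F2.
pose proof (curve_deriv_fst _ _ _ Hg) as G1. pose proof (curve_deriv_snd _ _ _ Hg) as G2.
eapply curve_deriv_eq.
apply (curve_deriv_pair (fun u => fst (f u) * fst (g u) - snd (f u) * snd (g u))
  (fun u => fst (f u) * snd (g u) + snd (f u) * fst (g u))).
- apply (is_derive_minus (V := R_NormedModule));
  [exact (Rmult_deriv _ _ _ _ _ F1 G1) | exact (Rmult_deriv _ _ _ _ _ F2 G2)].
- apply (is_derive_plus (V := R_NormedModule));
  [exact (Rmult_deriv _ _ _ _ _ F1 G2) | exact (Rmult_deriv _ _ _ _ _ F2 G1)].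
- unfold minus, plus, opp, Cplus, Cmult; simpl. f_equal; ring.
Qed.

Lemma curve_deriv_const (c : C) (t : R) : curve_deriv (fun _ => c) t (RtoC 0).
Proof. apply (@is_derive_const R_AbsRing C_R_NormedModule). Qed.

Notation cont2 f r t := (@continuous (prod_UniformSpace R_UniformSpace R_UniformSpace) R_UniformSpace
  (fun P => f (fst P) (snd P)) (r, t)).
Notation Ccont2 f r t := (@continuous (prod_UniformSpace R_UniformSpace R_UniformSpace) C_UniformSpace
  (fun P => f (fst P) (snd P)) (r, t)).

Section Polar.
Context (F : C -> C) (HF : holo F).

Definition pol r t := F (circle_pt r t).
Definition pol_r r t := (C_derive F (circle_pt r t) * ei t)%C.
Definition pol_rr r t := (C_derive (C_derive F) (circle_pt r t) * ei t * ei t)%C.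
(** The Cauchy-Riemann equations in polar form: the angular derivative of F is i r times its radial
    derivative. Expressing [pol_t] and [pol_tt] through radial derivatives makes the Laplacian an
    algebraic identity. *)
Definition pol_t r t := (Ci * RtoC r * pol_r r t)%C.
Definition pol_tt r t := (- (RtoC r * RtoC r * pol_rr r t) - RtoC r * pol_r r t)%C.

Lemma pol_dr r t : Rabs r < 1 -> curve_deriv (fun r => pol r t) r (pol_r r t).
Proof.
intros Hr. apply (curve_deriv_comp F (fun r => circle_pt r t)).
apply C_derive_is; trivial. apply circle_disc_abs, Hr. apply circle_deriv_r.
Qed.

Lemma pol_r_dr r t : Rabs r < 1 -> curve_deriv (fun r => pol_r r t) r (pol_rr r t).
Proof.
intros Hr. eapply curve_deriv_eq.
apply (curve_deriv_mult (fun r => C_derive F (circle_pt r t)) (fun _ => ei t)).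
apply (curve_deriv_comp (C_derive F) (fun r => circle_pt r t)).
apply C_derive_is. apply holo_C_derive, HF. apply circle_disc_abs, Hr. apply circle_deriv_r.
apply curve_deriv_const. unfold pol_rr. ring.
Qed.

Lemma pol_dt r t : Rabs r < 1 -> curve_deriv (fun t => pol r t) t (pol_t r t).
Proof.
intros Hr. eapply curve_deriv_eq. apply (curve_deriv_comp F (circle_pt r)).
apply C_derive_is; trivial. apply circle_disc_abs, Hr. apply circle_deriv.
unfold pol_t, pol_r. rewrite !circle_ei. ring.
Qed.

Lemma Ci2 : (Ci * Ci)%C = (- (1))%C.
Proof. unfold Ci, Cmult, Copp, RtoC; simpl; f_equal; ring. Qed.

Lemma pol_t_dt r t : Rabs r < 1 -> curve_deriv (fun t => pol_t r t) t (pol_tt r t).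
Proof.
intros Hr. eapply curve_deriv_eq.
apply (curve_deriv_mult (fun _ => Ci * RtoC r)%C (fun t => pol_r r t)). apply curve_deriv_const.
apply (curve_deriv_mult (fun t => C_derive F (circle_pt r t)) ei).
apply (curve_deriv_comp (C_derive F) (circle_pt r)).
apply C_derive_is. apply holo_C_derive, HF. apply circle_disc_abs, Hr. apply circle_deriv.
apply ei_deriv.
unfold pol_tt, pol_r, pol_rr. rewrite !circle_ei. set (D2 := C_derive (C_derive F) _). set (D1 := C_derive F _).
transitivity (Ci * Ci * (r * r * (D2 * ei t * ei t) + r * (D1 * ei t)))%C. ring. rewrite Ci2. ring.
Qed.

Definition sq r t := dot (pol r t) (pol r t).
Definition sq_r r t := 2 * dot (pol r t) (pol_r r t).
Definition sq_rr r t := 2 * (dot (pol_r r t) (pol_r r t) + dot (pol r t) (pol_rr r t)).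
Definition sq_t r t := 2 * dot (pol r t) (pol_t r t).
Definition sq_tt r t := 2 * (dot (pol_t r t) (pol_t r t) + dot (pol r t) (pol_tt r t)).

Lemma dot_comm z w : dot z w = dot w z.
Proof. unfold dot. ring. Qed.

Lemma sq_dr r t : Rabs r < 1 -> is_derive (fun r => sq r t) r (sq_r r t).
Proof.
intros Hr. eapply is_derive_eq. apply (dot_deriv (fun r => pol r t) (fun r => pol r t)); apply pol_dr, Hr.
unfold sq_r. rewrite (dot_comm (pol_r r t)). ring.
Qed.

Lemma sq_dt r t : Rabs r < 1 -> is_derive (fun t => sq r t) t (sq_t r t).
Proof.
intros Hr. eapply is_derive_eq. apply (dot_deriv (fun t => pol r t) (fun t => pol r t)); apply pol_dt, Hr.
unfold sq_t. rewrite (dot_comm (pol_t r t)). ring.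
Qed.

Lemma sq_r_dr r t : Rabs r < 1 -> is_derive (fun r => sq_r r t) r (sq_rr r t).
Proof.
intros Hr. apply is_derive_scal.
apply (dot_deriv (fun r => pol r t) (fun r => pol_r r t)). apply pol_dr, Hr. apply pol_r_dr, Hr.
Qed.

Lemma sq_t_dt r t : Rabs r < 1 -> is_derive (fun t => sq_t r t) t (sq_tt r t).
Proof.
intros Hr. apply is_derive_scal.
apply (dot_deriv (fun t => pol r t) (fun t => pol_t r t)). apply pol_dt, Hr. apply pol_t_dt, Hr.
Qed.

(** The Laplacian of |F|^2 is 4 |F'|^2; the factor r^2 clears the denominators of the polar form. *)
Lemma sq_laplace r t : r ^ 2 * sq_rr r t + r * sq_r r t + sq_tt r t = 4 * r ^ 2 * dot (pol_r r t) (pol_r r t).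
Proof.
unfold sq_rr, sq_r, sq_tt, pol_t, pol_tt. destruct (pol r t), (pol_r r t), (pol_rr r t). unfold dot; simpl. ring.
Qed.

Lemma circle_cont2 r t : @continuous (prod_UniformSpace R_UniformSpace R_UniformSpace) C_UniformSpace
  (fun P => circle_pt (fst P) (snd P)) (r, t).
Proof.
apply Ccont_pair.
- apply (continuous_mult (K := R_AbsRing)). apply continuous_fst.
  apply (continuous_comp snd cos). apply continuous_snd. apply continuous_cos.
- apply (continuous_mult (K := R_AbsRing)). apply continuous_fst.
  apply (continuous_comp snd sin). apply continuous_snd. apply continuous_sin.
Qed.

Lemma ei_cont2 r t : @continuous (prod_UniformSpace R_UniformSpace R_UniformSpace) C_UniformSpace
  (fun P => ei (snd P)) (r, t).
Proof. apply (continuous_comp snd ei). apply continuous_snd. apply ei_cont. Qed.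

Lemma holo_cont2 G r t : holo G -> Rabs r < 1 -> Ccont2 (fun r t => G (circle_pt r t)) r t.
Proof.
intros HG Hr. apply (Ccont_comp G (fun P => circle_pt (fst P) (snd P)) (r, t)).
apply holo_cont; trivial. apply circle_disc_abs, Hr. apply circle_cont2.
Qed.

Lemma pol_cont r t : Rabs r < 1 -> Ccont2 pol r t.
Proof. apply holo_cont2, HF. Qed.

Lemma pol_r_cont r t : Rabs r < 1 -> Ccont2 pol_r r t.
Proof.
intros Hr. apply (Ccont_mult (fun P => C_derive F (circle_pt (fst P) (snd P))) (fun P => ei (snd P))).
apply (holo_cont2 (C_derive F)). apply holo_C_derive, HF. trivial. apply ei_cont2.
Qed.

Lemma pol_rr_cont r t : Rabs r < 1 -> Ccont2 pol_rr r t.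
Proof.
intros Hr. apply (Ccont_mult (fun P => C_derive (C_derive F) (circle_pt (fst P) (snd P)) * ei (snd P))%C
 (fun P => ei (snd P))); [|apply ei_cont2].
apply (Ccont_mult (fun P => C_derive (C_derive F) (circle_pt (fst P) (snd P))) (fun P => ei (snd P)));
 [|apply ei_cont2].
apply (holo_cont2 (C_derive (C_derive F))); trivial. apply holo_C_derive, holo_C_derive, HF.
Qed.

Lemma cont2_scal2 f r t : cont2 f r t -> cont2 (fun r t => 2 * f r t) r t.
Proof.
intros H. apply (continuous_scal_r (V := R_NormedModule) 2 (fun P => f (fst P) (snd P))), H.
Qed.

Lemma sq_cont r t : Rabs r < 1 -> cont2 sq r t.
Proof. intros Hr. apply continuous_dot; apply pol_cont, Hr. Qed.

Lemma sq_r_cont r t : Rabs r < 1 -> cont2 sq_r r t.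
Proof.
intros Hr. apply (cont2_scal2 (fun r t => dot (pol r t) (pol_r r t))).
apply continuous_dot. apply pol_cont, Hr. apply pol_r_cont, Hr.
Qed.

Lemma sq_rr_cont r t : Rabs r < 1 -> cont2 sq_rr r t.
Proof.
intros Hr. apply (cont2_scal2 (fun r t => dot (pol_r r t) (pol_r r t) + dot (pol r t) (pol_rr r t))).
apply (continuous_plus (V := R_NormedModule)); apply continuous_dot;
[apply pol_r_cont, Hr | apply pol_r_cont, Hr | apply pol_cont, Hr | apply pol_rr_cont, Hr].
Qed.

Lemma circle_2PI r : circle_pt r (2 * PI) = circle_pt r 0.
Proof. rewrite !circle_ei, ei_2PI. reflexivity. Qed.

Lemma sq_periodic r : sq r (2 * PI) = sq r 0 /\ sq_t r (2 * PI) = sq_t r 0.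
Proof. unfold sq, sq_t, pol_t, pol, pol_r. rewrite circle_2PI, ei_2PI. split; reflexivity. Qed.
End Polar.

(* [phi0], [phi1], [phi2]: a function of the form s^q - c x s^(q-1) and its first two
   derivatives along a curve with s' = s1, s'' = s2, x' = x1, x'' = x2 *)
Section Profile.
Context (q c : R).
Definition phi0 s x := Rpower s q - c * (x * Rpower s (q - 1)).
Definition phi1 s x s1 x1 :=
  q * (Rpower s (q - 1) * s1) - c * (x1 * Rpower s (q - 1) + x * ((q - 1) * (Rpower s (q - 2) * s1))).
Definition phi2 s x s1 x1 s2 x2 :=
  q * ((q - 1) * (Rpower s (q - 2) * s1) * s1 + Rpower s (q - 1) * s2)
  - c * ((x2 * Rpower s (q - 1) + x1 * ((q - 1) * (Rpower s (q - 2) * s1)))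
         + (x1 * ((q - 1) * (Rpower s (q - 2) * s1))
            + x * ((q - 1) * ((q - 2) * (Rpower s (q - 3) * s1) * s1 + Rpower s (q - 2) * s2)))).

Lemma Rpower_comp_deriv (s : R -> R) (t s1 e : R) : 0 < s t -> is_derive s t s1 ->
  is_derive (fun u => Rpower (s u) e) t (e * (Rpower (s t) (e - 1) * s1)).
Proof.
intros Hs H.
assert (D : is_derive (fun y => Rpower y e) (s t) (e * Rpower (s t) (e - 1))).
{ apply is_derive_Reals. apply derivable_pt_lim_power, Hs. }
eapply is_derive_eq. apply (is_derive_comp (V := R_NormedModule) (fun y => Rpower y e) s t _ _ D H).
unfold scal; simpl; unfold mult; simpl. ring.
Qed.

Lemma phi0_deriv (s x : R -> R) (t s1 x1 : R) : 0 < s t -> is_derive s t s1 -> is_derive x t x1 ->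
  is_derive (fun u => phi0 (s u) (x u)) t (phi1 (s t) (x t) s1 x1).
Proof.
intros Hs Ds Dx. eapply is_derive_eq.
- apply (is_derive_minus (V := R_NormedModule)).
  + apply Rpower_comp_deriv; eassumption.
  + apply is_derive_scal. apply (Rmult_deriv x). exact Dx. apply Rpower_comp_deriv; eassumption.
- unfold phi1, minus, plus, opp; simpl. replace (q - 1 - 1) with (q - 2) by ring. ring.
Qed.

Lemma phi1_deriv (s x s' x' : R -> R) (t s2 x2 : R) : 0 < s t ->
  is_derive s t (s' t) -> is_derive x t (x' t) -> is_derive s' t s2 -> is_derive x' t x2 ->
  is_derive (fun u => phi1 (s u) (x u) (s' u) (x' u)) t (phi2 (s t) (x t) (s' t) (x' t) s2 x2).
Proof.
intros Hs Ds Dx Ds' Dx'. eapply is_derive_eq.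
- apply (is_derive_minus (V := R_NormedModule)).
  + apply is_derive_scal. apply (Rmult_deriv (fun u => Rpower (s u) (q - 1)) s').
    apply Rpower_comp_deriv; eassumption. exact Ds'.
  + apply is_derive_scal. apply (is_derive_plus (V := R_NormedModule)).
    * apply (Rmult_deriv x' (fun u => Rpower (s u) (q - 1))). exact Dx'. apply Rpower_comp_deriv; eassumption.
    * apply (Rmult_deriv x (fun u => (q - 1) * (Rpower (s u) (q - 2) * s' u))). exact Dx.
      apply is_derive_scal. apply (Rmult_deriv (fun u => Rpower (s u) (q - 2)) s').
      apply Rpower_comp_deriv; eassumption. exact Ds'.
- unfold phi2, minus, plus, opp; simpl.
  replace (q - 1 - 1) with (q - 2) by ring. replace (q - 2 - 1) with (q - 3) by ring. ring.
Qed.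
End Profile.

(** The chain rule for the polar Laplacian of the profile. All powers of s are reduced to s^(q-3),
    so that the remaining factor is the expression whose sign [superharmonic_ineq] settles. *)
Lemma phi_laplace (q c s x X1 X2 Y1 Y2 al be r s1 s2 x1 x2 st xt stt xtt : R) : 0 < s ->
  s1 = 2 * (X1 + Y1) -> x1 = 2 * X1 -> st = 2 * r * (X2 + Y2) -> xt = 2 * r * X2 ->
  r ^ 2 * s2 + r * s1 + stt = 4 * r ^ 2 * (al + be) ->
  r ^ 2 * x2 + r * x1 + xtt = 4 * r ^ 2 * al ->
  r ^ 2 * phi2 q c s x s1 x1 s2 x2 + r * phi1 q c s x s1 x1 + phi2 q c s x st xt stt xtt =
  4 * r ^ 2 * Rpower s (q - 3) *
   (q * s ^ 2 * (al + be) + q * (q - 1) * s * ((X1 + Y1) ^ 2 + (X2 + Y2) ^ 2)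
   - c * (s ^ 2 * al + (q - 1) * x * s * (al + be)
        + (q - 1) * (q - 2) * x * ((X1 + Y1) ^ 2 + (X2 + Y2) ^ 2)
        + 2 * (q - 1) * s * (X1 * (X1 + Y1) + X2 * (X2 + Y2)))).
Proof.
intros Hs E1 E2 E3 E4 E5 E6.
assert (P1 : Rpower s (q - 2) = s * Rpower s (q - 3)).
{ rewrite <- (Rpower_1 s) at 2 by trivial. rewrite <- Rpower_plus. f_equal. ring. }
assert (P2 : Rpower s (q - 1) = s * (s * Rpower s (q - 3))).
{ rewrite <- P1. rewrite <- (Rpower_1 s) at 2 by trivial. rewrite <- Rpower_plus. f_equal. ring. }
assert (E5' : stt = 4 * r ^ 2 * (al + be) - r ^ 2 * s2 - r * s1) by lra.
assert (E6' : xtt = 4 * r ^ 2 * al - r ^ 2 * x2 - r * x1) by lra.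
unfold phi2, phi1. rewrite P1, P2, E5', E6', E3, E4, E1, E2. ring.
Qed.

Section Phi_cont.
Context {U : UniformSpace} (q c : R) (s x s1 x1 s2 x2 : U -> R) (P : U).
Hypotheses (Hs0 : 0 < s P) (Hs : continuous s P) (Hx : continuous x P) (Hs1 : continuous s1 P)
  (Hx1 : continuous x1 P) (Hs2 : continuous s2 P) (Hx2 : continuous x2 P).

Lemma continuous_Rpower e : continuous (fun u => Rpower (s u) e) P.
Proof.
apply (continuous_comp (fun u => e * ln (s u)) exp); [|apply continuous_exp].
apply (continuous_scal_r (V := R_NormedModule) e (fun u => ln (s u))).
apply continuous_comp; trivial. apply continuous_ln, Hs0.
Qed.

Lemma cont_Rmult (f g : U -> R) : continuous f P -> continuous g P -> continuous (fun u => f u * g u) P.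
Proof. apply (continuous_mult (K := R_AbsRing)). Qed.

Lemma cont_Rplus (f g : U -> R) : continuous f P -> continuous g P -> continuous (fun u => f u + g u) P.
Proof. apply (continuous_plus (V := R_NormedModule)). Qed.

Lemma cont_Rminus (f g : U -> R) : continuous f P -> continuous g P -> continuous (fun u => f u - g u) P.
Proof. apply (continuous_minus (V := R_NormedModule)). Qed.

Local Ltac cont := cbv beta; lazymatch goal with
 | |- continuous (fun _ => ?e) _ => apply continuous_const
 | |- continuous (fun v => @?f v + @?g v) ?Q => apply (cont_Rplus f g); cont
 | |- continuous (fun v => @?f v - @?g v) ?Q => apply (cont_Rminus f g); cont
 | |- continuous (fun v => @?f v * @?g v) ?Q => apply (cont_Rmult f g); cont
 | |- continuous (fun v => Rpower _ ?e) ?Q => apply (continuous_Rpower e)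
 | _ => assumption
 end.

Lemma phi0_cont : continuous (fun u => phi0 q c (s u) (x u)) P.
Proof. unfold phi0. cont. Qed.

Lemma phi1_cont : continuous (fun u => phi1 q c (s u) (x u) (s1 u) (x1 u)) P.
Proof. unfold phi1. cont. Qed.

Lemma phi2_cont : continuous (fun u => phi2 q c (s u) (x u) (s1 u) (x1 u) (s2 u) (x2 u)) P.
Proof. unfold phi2. cont. Qed.
End Phi_cont.

Lemma continuous_section {V : UniformSpace} (f : R -> R -> V) r t :
  continuous (fun P : R * R => f (fst P) (snd P)) (r, t) -> continuous (fun t => f r t) t.
Proof.
intros H. apply (continuous_comp_2 (fun _ => r) (fun t => t) f).
apply continuous_const. apply continuous_id. exact H.
Qed.

Lemma RInt_param_deriv (u ur : R -> R -> R) :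
  (forall r t, Rabs r < 1 -> is_derive (fun r => u r t) r (ur r t)) ->
  (forall r t, Rabs r < 1 -> cont2 u r t) -> (forall r t, Rabs r < 1 -> cont2 ur r t) ->
  forall r, Rabs r < 1 ->
  is_derive (fun r => RInt (fun t => u r t) 0 (2 * PI)) r (RInt (fun t => ur r t) 0 (2 * PI)).
Proof.
intros Hd Hu Hur r Hr.
assert (Hr1 : 0 < 1 - Rabs r) by lra.
assert (Loc : locally r (fun y : R => Rabs y < 1)).
{ exists (mkposreal _ Hr1). intros y Hy. unfold ball in Hy; simpl in Hy.
  unfold AbsRing_ball, abs, minus, plus, opp in Hy; simpl in Hy.
  pose proof (Rabs_triang_inv y r). unfold Rminus in *. lra. }
eapply is_derive_eq.
- apply is_derive_RInt_param.
  + eapply filter_imp; [|exact Loc]. intros y Hy t _. exists (ur y t). apply Hd, Hy.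
  + intros t _. apply (continuity_2d_pt_ext_loc ur).
    * exists (mkposreal _ Hr1). intros y v Hy _. simpl in Hy. symmetry. apply is_derive_unique, Hd.
      pose proof (Rabs_triang_inv y r). lra.
    * apply continuity_2d_pt_filterlim. apply Hur, Hr.
  + eapply filter_imp; [|exact Loc]. intros y Hy.
    apply (ex_RInt_continuous (V := R_CompleteNormedModule)). intros t _.
    apply (continuous_section u). apply Hu, Hy.
- apply RInt_ext. intros t _. apply is_derive_unique, Hd, Hr.
Qed.

(** * Circular means of the superharmonic function *)

Section Core.
Context (q : R) (Hq : / 2 <= q) (F G : C -> C) (HF : holo F) (HG : holo G).
Let k := / (10 * (1 + q)).
Let c := 20 * q * (1 + q).
Hypothesis (Hsub : forall z, unit_disc z -> Cmod (C_derive G z) <= k * Cmod (C_derive F z)).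

Let s r t := 1 + sq F r t + sq G r t.
Let s1 r t := sq_r F r t + sq_r G r t.
Let s2 r t := sq_rr F r t + sq_rr G r t.
Let st r t := sq_t F r t + sq_t G r t.
Let stt r t := sq_tt F r t + sq_tt G r t.
Let u r t := phi0 q c (s r t) (sq F r t).
Let ur r t := phi1 q c (s r t) (sq F r t) (s1 r t) (sq_r F r t).
Let urr r t := phi2 q c (s r t) (sq F r t) (s1 r t) (sq_r F r t) (s2 r t) (sq_rr F r t).
Let ut r t := phi1 q c (s r t) (sq F r t) (st r t) (sq_t F r t).
Let utt r t := phi2 q c (s r t) (sq F r t) (st r t) (sq_t F r t) (stt r t) (sq_tt F r t).

Lemma sq_nonneg H r t : 0 <= sq H r t.
Proof. unfold sq. rewrite dot_Cmod. apply pow2_ge_0. Qed.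

Local Lemma s_pos r t : 0 < s r t.
Proof. unfold s. pose proof (sq_nonneg F r t). pose proof (sq_nonneg G r t). lra. Qed.

Local Lemma sum_deriv (f g : R -> R) (y a b : R) : is_derive f y a -> is_derive g y b ->
  is_derive (fun v => f v + g v) y (a + b).
Proof. apply (is_derive_plus (V := R_NormedModule)). Qed.

Local Lemma s_deriv (f g : R -> R) (y a b : R) : is_derive f y a -> is_derive g y b ->
  is_derive (fun v => 1 + f v + g v) y (a + b).
Proof.
intros Hf Hg. apply sum_deriv; trivial. eapply is_derive_eq.
apply (sum_deriv (fun _ => 1) f). apply (is_derive_const (V := R_NormedModule)). exact Hf.
unfold zero; simpl. ring.
Qed.

Local Lemma u_dr r t : Rabs r < 1 -> is_derive (fun r => u r t) r (ur r t).
Proof.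
intros Hr. apply (phi0_deriv q c (fun r => s r t) (fun r => sq F r t)). apply s_pos.
apply (s_deriv (fun r => sq F r t) (fun r => sq G r t)); apply sq_dr; trivial.
apply sq_dr; trivial.
Qed.

Local Lemma ur_dr r t : Rabs r < 1 -> is_derive (fun r => ur r t) r (urr r t).
Proof.
intros Hr. apply (phi1_deriv q c (fun r => s r t) (fun r => sq F r t) (fun r => s1 r t) (fun r => sq_r F r t)).
apply s_pos.
apply (s_deriv (fun r => sq F r t) (fun r => sq G r t)); apply sq_dr; trivial.
apply sq_dr; trivial.
apply (sum_deriv (fun r => sq_r F r t) (fun r => sq_r G r t)); apply sq_r_dr; trivial.
apply sq_r_dr; trivial.
Qed.

Local Lemma ut_dt r t : Rabs r < 1 -> is_derive (fun t => ut r t) t (utt r t).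
Proof.
intros Hr. apply (phi1_deriv q c (fun t => s r t) (fun t => sq F r t) (fun t => st r t) (fun t => sq_t F r t)).
apply s_pos.
apply (s_deriv (fun t => sq F r t) (fun t => sq G r t)); apply sq_dt; trivial.
apply sq_dt; trivial.
apply (sum_deriv (fun t => sq_t F r t) (fun t => sq_t G r t)); apply sq_t_dt; trivial.
apply sq_t_dt; trivial.
Qed.

Local Lemma s_cont r t : Rabs r < 1 -> cont2 s r t.
Proof.
intros Hr.
apply (cont_Rplus (r, t) (fun P => 1 + sq F (fst P) (snd P)) (fun P => sq G (fst P) (snd P)));
 [|apply sq_cont; trivial].
apply (cont_Rplus (r, t) (fun P => 1) (fun P => sq F (fst P) (snd P))).
apply continuous_const. apply sq_cont; trivial.
Qed.

Local Lemma s1_cont r t : Rabs r < 1 -> cont2 s1 r t.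
Proof.
intros Hr. apply (cont_Rplus (r, t) (fun P => sq_r F (fst P) (snd P)) (fun P => sq_r G (fst P) (snd P)));
apply sq_r_cont; trivial.
Qed.

Local Lemma s2_cont r t : Rabs r < 1 -> cont2 s2 r t.
Proof.
intros Hr. apply (cont_Rplus (r, t) (fun P => sq_rr F (fst P) (snd P)) (fun P => sq_rr G (fst P) (snd P)));
apply sq_rr_cont; trivial.
Qed.

Local Lemma u_cont r t : Rabs r < 1 -> cont2 u r t.
Proof.
intros Hr. apply (phi0_cont q c (fun P => s (fst P) (snd P)) (fun P => sq F (fst P) (snd P))).
apply s_pos. apply s_cont, Hr. apply sq_cont; trivial.
Qed.

Local Lemma ur_cont r t : Rabs r < 1 -> cont2 ur r t.
Proof.
intros Hr. apply (phi1_cont q c (fun P => s (fst P) (snd P)) (fun P => sq F (fst P) (snd P))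
 (fun P => s1 (fst P) (snd P)) (fun P => sq_r F (fst P) (snd P))).
apply s_pos. apply s_cont, Hr. apply sq_cont; trivial. apply s1_cont, Hr. apply sq_r_cont; trivial.
Qed.

Local Lemma urr_cont r t : Rabs r < 1 -> cont2 urr r t.
Proof.
intros Hr. apply (phi2_cont q c (fun P => s (fst P) (snd P)) (fun P => sq F (fst P) (snd P))
 (fun P => s1 (fst P) (snd P)) (fun P => sq_r F (fst P) (snd P))
 (fun P => s2 (fst P) (snd P)) (fun P => sq_rr F (fst P) (snd P))).
apply s_pos. apply s_cont, Hr. apply sq_cont; trivial. apply s1_cont, Hr. apply sq_r_cont; trivial.
apply s2_cont, Hr. apply sq_rr_cont; trivial.
Qed.

Local Lemma laplace_le r t : Rabs r < 1 -> r ^ 2 * urr r t + r * ur r t + utt r t <= 0.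
Proof.
intros Hr.
set (al := dot (pol_r F r t) (pol_r F r t)). set (be := dot (pol_r G r t) (pol_r G r t)).
unfold urr, ur, utt.
rewrite (phi_laplace q c (s r t) (sq F r t)
  (dot (pol F r t) (pol_r F r t)) (dot (pol F r t) (Ci * pol_r F r t))
  (dot (pol G r t) (pol_r G r t)) (dot (pol G r t) (Ci * pol_r G r t)) al be r).
- assert (Hal : 0 <= al) by (unfold al; rewrite dot_Cmod; apply pow2_ge_0).
  assert (Hbe : 0 <= be) by (unfold be; rewrite dot_Cmod; apply pow2_ge_0).
  assert (Hk : 0 < k) by (apply Rinv_0_lt_compat; lra).
  assert (Hab : be <= k ^ 2 * al).
  { unfold al, be. rewrite !dot_Cmod. unfold pol_r. rewrite !Cmod_mult, !Cmod_ei, !Rmult_1_r.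
    rewrite <- Rpow_mult_distr. apply pow_incr. split. apply Cmod_ge_0.
    apply Hsub, circle_disc_abs, Hr. }
  (* Lagrange's identity, since w and i w are orthogonal of equal length; it gives X1^2 + X2^2 = x
     al and its analogue for G. *)
  assert (A : forall z w, dot z w ^ 2 + dot z (Ci * w) ^ 2 = dot z z * dot w w).
  { intros [] []. unfold dot; simpl. ring. }
  pose proof (superharmonic_ineq q al be (sq F r t) (sq G r t) _ _ _ _ Hq Hal Hbe
    (sq_nonneg F r t) (sq_nonneg G r t) Hab (A (pol F r t) (pol_r F r t)) (A (pol G r t) (pol_r G r t))) as K.
  cbv zeta in K. fold c in K. change (1 + sq F r t + sq G r t) with (s r t) in K.
  assert (0 <= 4 * r ^ 2 * Rpower (s r t) (q - 3)).
  { apply Rmult_le_pos. pose proof (pow2_ge_0 r). lra. left. apply Rpower_pos. }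
  match type of K with ?X <= 0 => set (X0 := X) in *; clearbody X0 end. nra.
- apply s_pos.
- unfold s1, sq_r. ring.
- unfold sq_r. ring.
- unfold st, sq_t, pol_t. destruct (pol F r t), (pol_r F r t), (pol G r t), (pol_r G r t). unfold dot; simpl. ring.
- unfold sq_t, pol_t. destruct (pol F r t), (pol_r F r t). unfold dot; simpl. ring.
- unfold s1, s2, stt, al, be. pose proof (sq_laplace F r t). pose proof (sq_laplace G r t). lra.
- unfold al. apply sq_laplace.
Qed.

Let m r := RInt (fun t => u r t) 0 (2 * PI).
Let m1 r := RInt (fun t => ur r t) 0 (2 * PI).

Local Lemma sect (f : R -> R -> R) r : (forall t, cont2 f r t) ->
  is_RInt (fun t => f r t) 0 (2 * PI) (RInt (fun t => f r t) 0 (2 * PI)).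
Proof. intros H. apply RInt_cont. intros t. apply continuous_section, H. Qed.

(** [utt] is the angular derivative of [ut], which has period 2 PI. *)
Local Lemma utt_int r : Rabs r < 1 -> is_RInt (fun t => utt r t) 0 (2 * PI) 0.
Proof.
intros Hr.
assert (E : minus (ut r (2 * PI)) (ut r 0) = 0).
{ destruct (sq_periodic F r) as [E1 E2]. destruct (sq_periodic G r) as [E3 E4].
  unfold ut, s, st. rewrite E1, E2, E3, E4. unfold minus, plus, opp; simpl. ring. }
enough (K : is_RInt (fun t => utt r t) 0 (2 * PI) (minus (ut r (2 * PI)) (ut r 0)))
  by (rewrite E in K; exact K).
clear E. apply (is_RInt_derive (fun t => ut r t) (fun t => utt r t)).
- intros t _. apply ut_dt, Hr.
- intros t _.
  assert (cf : forall H, holo H -> continuous (fun t => pol H r t : C_UniformSpace) t).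
  { intros H HH. eapply curve_deriv_cont. apply pol_dt; trivial. }
  assert (ct : forall H, holo H -> continuous (fun t => pol_t H r t : C_UniformSpace) t).
  { intros H HH. eapply curve_deriv_cont. apply pol_t_dt; trivial. }
  assert (c1 : forall H, holo H -> continuous (fun t => pol_r H r t : C_UniformSpace) t).
  { intros H HH. apply (continuous_section (pol_r H)), pol_r_cont; trivial. }
  assert (c2 : forall H, holo H -> continuous (fun t => pol_rr H r t : C_UniformSpace) t).
  { intros H HH. apply (continuous_section (pol_rr H)), pol_rr_cont; trivial. }
  assert (c3 : forall H, holo H -> continuous (fun t => pol_tt H r t : C_UniformSpace) t).
  { intros H HH. apply Ccont_minus.
    - apply Ccont_opp. apply Ccont_mult. apply continuous_const. apply c2, HH.
    - apply Ccont_mult. apply continuous_const. apply c1, HH. }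
  assert (cn : forall H, holo H -> continuous (fun t => sq H r t) t).
  { intros H HH. apply (continuous_section (sq H)), sq_cont; trivial. }
  assert (cnt : forall H, holo H -> continuous (fun t => sq_t H r t) t).
  { intros H HH. apply (cont_Rmult t (fun _ => 2)). apply continuous_const.
    apply (continuous_dot (fun t => pol H r t) (fun t => pol_t H r t)); [exact (cf H HH) | exact (ct H HH)]. }
  assert (cntt : forall H, holo H -> continuous (fun t => sq_tt H r t) t).
  { intros H HH. apply (cont_Rmult t (fun _ => 2)). apply continuous_const.
    apply (cont_Rplus t (fun t => dot (pol_t H r t) (pol_t H r t)) (fun t => dot (pol H r t) (pol_tt H r t))).
    - apply (continuous_dot (fun t => pol_t H r t) (fun t => pol_t H r t)); exact (ct H HH).
    - apply (continuous_dot (fun t => pol H r t) (fun t => pol_tt H r t)); [exact (cf H HH) | exact (c3 H HH)]. }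
  apply (phi2_cont q c (fun t => s r t) (fun t => sq F r t) (fun t => st r t) (fun t => sq_t F r t)
    (fun t => stt r t) (fun t => sq_tt F r t)).
  + apply s_pos.
  + apply (cont_Rplus t (fun t => 1 + sq F r t)); [|apply cn, HG].
    apply (cont_Rplus t (fun _ => 1)). apply continuous_const. apply cn, HF.
  + apply cn, HF.
  + apply cont_Rplus; apply cnt; trivial.
  + apply cnt, HF.
  + apply cont_Rplus; apply cntt; trivial.
  + apply cntt, HF.
Qed.

(** Integrating [laplace_le] over a period removes [utt] and, after division by y > 0, leaves (y
    m1)' <= 0. As y m1 vanishes at y = 0, m1 <= 0 and m decreases. *)
Local Lemma m_le r : 0 <= r < 1 -> m r <= m 0.
Proof.
intros Hr. pose proof two_PI_pos as Hpi.
assert (Dm : forall y, Rabs y < 1 -> is_derive m y (m1 y)).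
{ apply RInt_param_deriv. apply u_dr. apply u_cont. apply ur_cont. }
assert (Dm1 : forall y, Rabs y < 1 -> is_derive m1 y (RInt (fun t => urr y t) 0 (2 * PI))).
{ apply RInt_param_deriv. apply ur_dr. apply ur_cont. apply urr_cont. }
assert (I : forall y, 0 < y < 1 -> m1 y + y * RInt (fun t => urr y t) 0 (2 * PI) <= 0).
{ intros y Hy. assert (Hy' : Rabs y < 1) by (rewrite Rabs_pos_eq; lra).
  pose proof (sect ur y (fun t => ur_cont y t Hy')) as J1. fold (m1 y) in J1.
  pose proof (sect urr y (fun t => urr_cont y t Hy')) as J2.
  pose proof (utt_int y Hy') as J3.
  set (M := RInt _ _ _) in *.
  pose proof (is_RInt_plus (V := R_NormedModule) _ _ _ _ _ _
    (is_RInt_plus (V := R_NormedModule) _ _ _ _ _ _ (is_RInt_scal (V := R_NormedModule) _ _ _ (y ^ 2) _ J2)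
      (is_RInt_scal (V := R_NormedModule) _ _ _ y _ J1)) J3) as J.
  pose proof (is_RInt_const (V := R_NormedModule) 0 (2 * PI) 0) as Z.
  pose proof (is_RInt_le _ _ _ _ _ _ (Rlt_le _ _ Hpi) J Z (fun t _ => laplace_le y t Hy')) as L.
  unfold plus, scal in L; simpl in L; unfold mult in L; simpl in L.
  nra. }
assert (Nle : forall y, 0 < y < 1 -> m1 y <= 0).
{ intros y Hy.
  destruct (MVT_cor2 (fun y => y * m1 y) (fun y => m1 y + y * RInt (fun t => urr y t) 0 (2 * PI)) 0 y) as [z [Ez Hz]].
  - lra.
  - intros z Hz. apply is_derive_Reals. eapply is_derive_eq.
    apply (Rmult_deriv (fun y => y) m1). apply (is_derive_id (K := R_AbsRing)).
    apply Dm1. rewrite Rabs_pos_eq; lra. unfold one; simpl. ring.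
  - pose proof (I z). assert (0 < z < 1) by lra. rewrite Rmult_0_l in Ez. nra. }
destruct (Req_EM_T r 0) as [->|n]. lra.
destruct (MVT_cor2 m m1 0 r) as [z [Ez Hz]].
- lra.
- intros z Hz. apply is_derive_Reals, Dm. rewrite Rabs_pos_eq; lra.
- pose proof (Nle z). assert (0 < z < 1) by lra. nra.
Qed.

Lemma subordinate_mean_le r : 0 <= r < 1 ->
  circ_mean (2 * q) G r <= 2 * c * Rpower (2 * c) q * circ_mean (2 * q) F r + 2 * m 0.
Proof.
intros Hr. pose proof (m_le r Hr) as Hm. pose proof two_PI_pos as Hpi.
assert (Hr' : Rabs r < 1) by (rewrite Rabs_pos_eq; lra).
assert (Hp1 : 1 <= 2 * q) by lra.
assert (Hc : 1 <= c) by (unfold c; nra).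
pose proof (sect u r (fun t => u_cont r t Hr')) as Ju. fold (m r) in Ju.
pose proof (is_circ_mean (2 * q) F r Hp1 HF Hr) as JF.
pose proof (is_circ_mean (2 * q) G r Hp1 HG Hr) as JG.
pose proof (is_RInt_plus (V := R_NormedModule) _ _ _ _ _ _
  (is_RInt_scal (V := R_NormedModule) _ _ _ (2 * c * Rpower (2 * c) q) _ JF)
  (is_RInt_scal (V := R_NormedModule) _ _ _ 2 _ Ju)) as J.
assert (L : circ_mean (2 * q) G r <= 2 * c * Rpower (2 * c) q * circ_mean (2 * q) F r + 2 * m r).
2:{ lra. }
refine (is_RInt_le _ _ _ _ _ _ (Rlt_le _ _ Hpi) JG J _). intros t _.
change (rpow (Cmod (G (circle_pt r t))) (2 * q) <=
  2 * c * Rpower (2 * c) q * rpow (Cmod (F (circle_pt r t))) (2 * q) + 2 * u r t).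
assert (R2 : forall y, 0 <= y -> rpow y (2 * q) = rpow (y ^ 2) q).
{ intros y Hy. destruct (Req_EM_T y 0) as [->|n].
  - replace (0 ^ 2) with 0 by ring. rewrite !rpow_0. reflexivity.
  - assert (0 < y ^ 2) by (apply pow_lt; lra). rewrite !rpow_pos by lra.
    rewrite <- (Rpower_pow 2) by lra. rewrite Rpower_mult. f_equal. }
rewrite !R2 by apply Cmod_ge_0. rewrite <- !dot_Cmod.
change (dot (G (circle_pt r t)) (G (circle_pt r t))) with (sq G r t).
change (dot (F (circle_pt r t)) (F (circle_pt r t))) with (sq F r t).
pose proof (sq_nonneg F r t) as Hx. pose proof (sq_nonneg G r t) as Hy. pose proof (s_pos r t) as Hs.
unfold u, phi0. assert (Es : s r t = 1 + sq F r t + sq G r t) by reflexivity.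
set (S := s r t) in *. clearbody S. set (x := sq F r t) in *. clearbody x. set (y := sq G r t) in *. clearbody y.
assert (E1 : Rpower S q = S * Rpower S (q - 1)).
{ rewrite <- (Rpower_1 S) at 2 by trivial. rewrite <- Rpower_plus. f_equal. ring. }
assert (A1 : rpow y q <= Rpower S q).
{ rewrite <- rpow_pos by lra. apply rpow_le; lra. }
pose proof (rpow_nonneg x q). pose proof (Rpower_pos (2 * c) q). pose proof (Rpower_pos S (q - 1)).
(* If S >= 2 c x, the subtracted term is at most S^q / 2, so S^q is at most twice the profile.
   Otherwise S^q <= (2 c)^q x^q, and since x <= S this bounds the subtracted term as well. *)
destruct (Rle_dec (2 * c * x) S) as [H2|H2].
- assert (2 * (c * (x * Rpower S (q - 1))) <= Rpower S q).
  { rewrite E1. replace (2 * (c * (x * Rpower S (q - 1)))) with (2 * c * x * Rpower S (q - 1)) by ring.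
    apply Rmult_le_compat_r; lra. }
  assert (0 <= 2 * c * Rpower (2 * c) q * rpow x q) by (repeat apply Rmult_le_pos; lra). lra.
- assert (Hx0 : 0 < x) by nra.
  assert (B1 : Rpower S q <= Rpower (2 * c) q * rpow x q).
  { rewrite rpow_pos by trivial. rewrite Rpower_mult_distr by lra. apply Rle_Rpower_l; lra. }
  assert (B2 : x * Rpower S (q - 1) <= Rpower S q) by (rewrite E1; apply Rmult_le_compat_r; lra).
  assert (B3 : c * (x * Rpower S (q - 1)) <= c * (Rpower (2 * c) q * rpow x q))
    by (apply Rmult_le_compat_l; lra).
  pose proof (Rpower_pos S q). lra.
Qed.
End Core.

Theorem Hp_subordinate p F G K : 1 <= p -> Hp p F -> holo G ->
  (forall z, unit_disc z -> Cmod (C_derive G z) <= K * Cmod (C_derive F z)) -> Hp p G.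
Proof.
intros Hp1 HpF HG HK. destruct (proj1 (Hp_iff p F Hp1) HpF) as [HF [B HB]].
apply Hp_iff; trivial. split; trivial. pose proof two_PI_pos as Hpi.
set (q := p / 2). assert (Hq : / 2 <= q) by (unfold q; lra).
assert (Ep : 2 * q = p) by (unfold q; field).
set (k := / (10 * (1 + q))). assert (Hk : 0 < k) by (apply Rinv_0_lt_compat; lra).
(* [K] is an arbitrary real number; |K| + 1 is positive and still dominates it. Multiplying G by d
   makes the constant small enough for [subordinate_mean_le]. *)
set (d := k / (Rabs K + 1)). pose proof (Rabs_pos K) as HaK.
assert (Hd : 0 < d) by (apply Rdiv_lt_0_compat; lra).
set (G' z := (RtoC d * G z)%C).
assert (DG' : forall z, unit_disc z -> cderiv G' z (d * C_derive G z)%C).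
{ intros z Hz. apply cderiv_scal, C_derive_is; trivial. }
assert (HG' : holo G') by (intros z Hz; eexists; apply DG', Hz).
assert (Hsub : forall z, unit_disc z -> Cmod (C_derive G' z) <= k * Cmod (C_derive F z)).
{ intros z Hz. rewrite (is_C_derive_unique _ _ _ (DG' z Hz)), Cmod_mult, Cmod_R, Rabs_pos_eq by lra.
  specialize (HK z Hz). pose proof (Cmod_ge_0 (C_derive F z)). pose proof (Rle_abs K).
  apply Rle_trans with (d * ((Rabs K + 1) * Cmod (C_derive F z))).
  - apply Rmult_le_compat_l; nra.
  - right. unfold d. field. lra. }
pose proof (subordinate_mean_le q Hq F G' HF HG' Hsub) as L.
set (c := 20 * q * (1 + q)) in *. rewrite Ep in L.
set (M := RInt _ 0 (2 * PI)) in L. clearbody M.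
assert (Hc : 0 < c) by (unfold c; nra).
pose proof (Rpower_pos (2 * c) q) as HR. pose proof (Rpower_pos d p) as HRd.
exists ((2 * c * Rpower (2 * c) q * B + 2 * M) / Rpower d p). intros r Hr.
apply Rmult_le_reg_r with (Rpower d p); trivial. unfold Rdiv. rewrite Rmult_assoc, Rinv_l, Rmult_1_r by lra.
apply Rle_trans with (circ_mean p G' r).
- right. symmetry. apply is_RInt_unique.
  pose proof (is_RInt_scal (V := R_NormedModule) _ _ _ (Rpower d p) _ (is_circ_mean p G r Hp1 HG Hr)) as J.
  rewrite (Rmult_comm (circ_mean p G r)).
  eapply is_RInt_ext with (2 := J). intros t _.
  change (Rpower d p * rpow (Cmod (G (circle_pt r t))) p = rpow (Cmod (G' (circle_pt r t))) p).
  unfold G'. rewrite Cmod_mult, Cmod_R, Rabs_pos_eq by lra.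
  rewrite rpow_mult by (try apply Cmod_ge_0; lra). rewrite (rpow_pos d) by trivial. reflexivity.
- eapply Rle_trans. apply L, Hr. apply Rplus_le_compat_r. apply Rmult_le_compat_l.
  repeat apply Rmult_le_pos; lra. apply HB, Hr.
Qed.

(** * Sums of peaking functions *)

(** Weights of total 1, so that [wsum] below is an average: common bounds on the terms, or on their
    p-th means, survive up to constants. *)
Definition wt (n : nat) : R := (/ 2) ^ S n.

Lemma wt_pos n : 0 < wt n.
Proof. apply pow_lt. lra. Qed.

Lemma is_series_Rscal (c : R) (v : nat -> R) l : is_series v l -> is_series (fun n => c * v n) (c * l).
Proof. apply (is_series_scal (V := R_NormedModule) c). Qed.

Lemma wt_series B : is_series (fun n => B * wt n) B.
Proof.
assert (H0 : Rabs (/ 2) < 1) by (rewrite Rabs_pos_eq; lra).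
pose proof (is_series_geom (/ 2) H0) as H. replace (/ (1 - / 2)) with 2 in H by field.
apply (is_series_Rscal (B / 2)) in H. replace (B / 2 * 2) with B in H by field.
apply is_series_ext with (2 := H). intros n. unfold wt. simpl. field.
Qed.

Definition CSer (u : nat -> C) : C := (Series (fun n => fst (u n)), Series (fun n => snd (u n))).

Definition wt_bounded (B : R) (u : nat -> C) := forall n, Cmod (u n) <= B * wt n.

Lemma wt_dominated_series (v : nat -> R) B : (forall n, Rabs (v n) <= B * wt n) ->
  ex_series v /\ Rabs (Series v) <= B.
Proof.
intros H.
pose proof (wt_series B) as I.
assert (Ea : ex_series (fun n => Rabs (v n))).
{ apply (ex_series_le (V := R_CompleteNormedModule) _ (fun n => B * wt n)).
  - intros n. unfold norm; simpl. unfold abs; simpl. rewrite Rabs_Rabsolu. apply H.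
  - exists B. exact I. }
split. apply ex_series_Rabs, Ea.
eapply Rle_trans. apply Series_Rabs, Ea.
rewrite <- (is_series_unique _ _ I). apply Series_le.
- intros n. split. apply Rabs_pos. apply H.
- exists B; exact I.
Qed.

Section CSer.
Implicit Types (u v : nat -> C) (B : R).

Lemma wt_bounded_fst B u : wt_bounded B u -> forall n, Rabs (fst (u n)) <= B * wt n.
Proof. intros H n. eapply Rle_trans; [apply Rabs_fst_le | apply H]. Qed.

Lemma wt_bounded_snd B u : wt_bounded B u -> forall n, Rabs (snd (u n)) <= B * wt n.
Proof. intros H n. eapply Rle_trans; [apply Rabs_snd_le | apply H]. Qed.

(** The factor 2 comes from adding the bounds of the real and the imaginary series. *)
Lemma CSer_bound B u : wt_bounded B u -> Cmod (CSer u) <= 2 * B.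
Proof.
intros H. eapply Rle_trans. apply Cmod_le_Rabs. simpl.
pose proof (proj2 (wt_dominated_series _ _ (wt_bounded_fst _ _ H))).
pose proof (proj2 (wt_dominated_series _ _ (wt_bounded_snd _ _ H))). lra.
Qed.

Lemma CSer_ext u v : (forall n, u n = v n) -> CSer u = CSer v.
Proof. intros H. unfold CSer. f_equal; apply Series_ext; intros n; rewrite H; reflexivity. Qed.

Lemma CSer_plus B B' u v : wt_bounded B u -> wt_bounded B' v ->
  CSer (fun n => u n + v n)%C = (CSer u + CSer v)%C.
Proof.
intros Hu Hv. unfold CSer, Cplus; simpl. f_equal; apply Series_plus.
apply (wt_dominated_series _ _ (wt_bounded_fst _ _ Hu)). apply (wt_dominated_series _ _ (wt_bounded_fst _ _ Hv)).
apply (wt_dominated_series _ _ (wt_bounded_snd _ _ Hu)). apply (wt_dominated_series _ _ (wt_bounded_snd _ _ Hv)).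
Qed.

Lemma CSer_scal (c : C) B u : wt_bounded B u -> CSer (fun n => c * u n)%C = (c * CSer u)%C.
Proof.
intros Hu. destruct c as [c1 c2]. unfold CSer, Cmult; simpl.
pose proof (proj1 (wt_dominated_series _ _ (wt_bounded_fst _ _ Hu))) as E1.
pose proof (proj1 (wt_dominated_series _ _ (wt_bounded_snd _ _ Hu))) as E2.
rewrite <- !Series_scal_l. f_equal.
- rewrite <- Series_minus; trivial; apply (ex_series_scal (V := R_NormedModule)); trivial.
- rewrite <- Series_plus; trivial; apply (ex_series_scal (V := R_NormedModule)); trivial.
Qed.

Lemma CSer_incr B u : wt_bounded B u -> CSer u = (u O + CSer (fun n => u (S n)))%C.
Proof.
intros Hu. unfold CSer, Cplus; simpl. f_equal; apply Series_incr_1.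
apply (wt_dominated_series _ _ (wt_bounded_fst _ _ Hu)). apply (wt_dominated_series _ _ (wt_bounded_snd _ _ Hu)).
Qed.

Lemma wt_bounded_plus B B' u v : wt_bounded B u -> wt_bounded B' v ->
  wt_bounded (B + B') (fun n => u n + v n)%C.
Proof.
intros Hu Hv n. eapply Rle_trans. apply Cmod_triangle. specialize (Hu n). specialize (Hv n). lra.
Qed.

Lemma wt_bounded_scal (c : C) B u : wt_bounded B u -> wt_bounded (Cmod c * B) (fun n => c * u n)%C.
Proof.
intros Hu n. rewrite Cmod_mult, Rmult_assoc. apply Rmult_le_compat_l. apply Cmod_ge_0. apply Hu.
Qed.

Lemma wt_bounded_wt B u : (forall n, Cmod (u n) <= B) -> wt_bounded B (fun n => RtoC (wt n) * u n)%C.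
Proof.
intros H n. pose proof (wt_pos n). rewrite Cmod_mult, Cmod_R, Rabs_pos_eq, Rmult_comm by lra.
apply Rmult_le_compat_r. lra. apply H.
Qed.

(** A single term regarded as a series of its own; this lets [CSer_plus] split the dominant term off
    a sum. *)
Lemma CSer_single N (c : C) : CSer (fun n => if Nat.eq_dec n N then c else RtoC 0) = c.
Proof.
assert (K : forall (x : R) N, Series (fun n => if Nat.eq_dec n N then x else 0) = x).
{ clear. intros x N. revert x. induction N as [|N IH]; intros x; rewrite Series_incr_1.
  - simpl. rewrite (Series_ext _ (fun n => 0 * 0)). rewrite Series_scal_l. ring. intros n; simpl; ring.
  - apply ex_series_incr_1. apply (ex_series_ext (fun n => 0)). intros n; reflexivity.
    exists 0. apply is_series_ext with (2 := wt_series 0). intros m. apply Rmult_0_l.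
  - destruct (Nat.eq_dec 0 (S N)); [lia|]. rewrite Rplus_0_l. etransitivity; [|apply (IH x)].
    apply Series_ext. intros j. destruct (Nat.eq_dec (S j) (S N)), (Nat.eq_dec j N); trivial; lia.
  - apply (ex_series_ext (fun n => if Nat.eq_dec n (S N) then x else 0)); trivial.
    apply (wt_dominated_series _ (Rabs x * / wt (S N))). intros j.
    destruct (Nat.eq_dec j (S N)) as [->|].
    + rewrite Rmult_assoc, Rinv_l by (apply Rgt_not_eq, wt_pos). lra.
    + rewrite Rabs_R0. pose proof (Rabs_pos x). pose proof (wt_pos j).
      pose proof (Rinv_0_lt_compat _ (wt_pos (S N))). apply Rmult_le_pos; [apply Rmult_le_pos|]; lra. }
unfold CSer. rewrite (Series_ext _ (fun n => if Nat.eq_dec n N then fst c else 0)).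
rewrite (Series_ext (fun n => snd _) (fun n => if Nat.eq_dec n N then snd c else 0)).
rewrite !K. destruct c; reflexivity.
intros n; destruct (Nat.eq_dec n N); reflexivity.
intros n; destruct (Nat.eq_dec n N); reflexivity.
Qed.
End CSer.

(** The partial sum of [wsum] over n < N, written as iterated midpoints so that its p-th means
    follow from [rpow_midpoint] without Minkowski's inequality. *)
Fixpoint avg (Phi : nat -> C -> C) (N : nat) (z : C) : C :=
  match N with
  | O => 0
  | S N => ((Phi O z + avg (fun n => Phi (S n)) N z) * / 2)%C
  end.

Definition wsum (Phi : nat -> C -> C) (z : C) : C := CSer (fun n => RtoC (wt n) * Phi n z)%C.

Lemma wsum_incr Phi B z : (forall n, Cmod (Phi n z) <= B) ->
  wsum Phi z = ((Phi O z + wsum (fun n => Phi (S n)) z) * / 2)%C.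
Proof.
intros H. unfold wsum. rewrite (CSer_incr B) by (apply wt_bounded_wt, H).
rewrite (CSer_ext (fun n => RtoC (wt (S n)) * Phi (S n) z)%C
  (fun n => / 2 * (RtoC (wt n) * Phi (S n) z))%C).
- rewrite (CSer_scal _ B) by (apply (wt_bounded_wt B (fun n => Phi (S n) z)); intros; apply H).
  replace (RtoC (wt 0)) with (/ 2)%C. ring. unfold wt. simpl. rewrite Rmult_1_r, RtoC_inv by lra. reflexivity.
- intros n. replace (wt (S n)) with (/ 2 * wt n) by (unfold wt; simpl; ring).
  rewrite RtoC_mult, RtoC_inv by lra. ring.
Qed.

Lemma wsum_avg N : forall Phi B z, (forall n, Cmod (Phi n z) <= B) ->
  Cmod (wsum Phi z - avg Phi N z) <= 2 * B * (/ 2) ^ N.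
Proof.
induction N as [|N IH]; intros Phi B z H.
- simpl. replace (wsum Phi z - 0)%C with (wsum Phi z) by ring. rewrite Rmult_1_r.
  apply CSer_bound, wt_bounded_wt, H.
- rewrite (wsum_incr Phi B z H). simpl avg.
  replace ((Phi O z + wsum (fun n => Phi (S n)) z) * / 2 - (Phi O z + avg (fun n => Phi (S n)) N z) * / 2)%C
   with (/ 2 * (wsum (fun n => Phi (S n)) z - avg (fun n => Phi (S n)) N z))%C by ring.
  rewrite Cmod_mult. specialize (IH (fun n => Phi (S n)) B z (fun n => H (S n))).
  rewrite Cmod_inv, Cmod_R, Rabs_pos_eq by (try apply two_neq_0; lra). simpl. lra.
Qed.

Lemma bernoulli u p : 1 <= p -> 0 <= u -> 1 + p * (u - 1) <= rpow u p.
Proof.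
intros Hp Hu. destruct (Req_EM_T u 0) as [->|n]. rewrite rpow_0. lra.
rewrite rpow_pos by lra. replace p with (1 + (p - 1)) at 2 by ring.
rewrite Rpower_plus, Rpower_1 by lra.
assert (H1 : 1 + (p - 1) * ln u <= Rpower u (p - 1)).
{ rewrite Rpower_ln. destruct (Req_EM_T ((p - 1) * ln u) 0) as [->|n1].
  rewrite exp_0. lra. left. apply exp_ineq1. exact n1. }
assert (H2 : u - 1 <= u * ln u).
{ assert (K : ln (/ u) <= / u - 1).
  { assert (0 < / u) by (apply Rinv_0_lt_compat; lra).
    pose proof (exp_ineq1_le (ln (/ u))). rewrite exp_ln in H0 by trivial. lra. }
  rewrite ln_Rinv in K by lra. assert (u * / u = 1) by (apply Rinv_r; lra). nra. }
nra.
Qed.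

(** The tangent to u -> u^p at the midpoint c lies below the graph, by [bernoulli] after scaling by
    c; the linear parts at x and y cancel. *)
Lemma rpow_midpoint x y p : 1 <= p -> 0 <= x -> 0 <= y ->
  rpow ((x + y) / 2) p <= (rpow x p + rpow y p) / 2.
Proof.
intros Hp Hx Hy. set (c := (x + y) / 2).
destruct (Req_EM_T c 0) as [E|n].
{ rewrite E, rpow_0. pose proof (rpow_nonneg x p). pose proof (rpow_nonneg y p). lra. }
assert (Hc : 0 < c) by (unfold c in *; lra).
assert (K : forall u, 0 <= u -> rpow c p * (1 + p * (u / c - 1)) <= rpow u p).
{ intros u Hu. replace u with (c * (u / c)) at 2 by (field; lra).
  assert (0 <= u / c) by (apply Rmult_le_pos; trivial; left; apply Rinv_0_lt_compat; lra).
  rewrite rpow_mult by lra. apply Rmult_le_compat_l. apply rpow_nonneg. apply bernoulli; trivial. }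
pose proof (K x Hx). pose proof (K y Hy).
assert (E : x / c + y / c = 2) by (unfold c; field; unfold c in Hc; lra).
pose proof (rpow_nonneg c p).
assert (rpow c p * (1 + p * (x / c - 1)) + rpow c p * (1 + p * (y / c - 1)) = 2 * rpow c p).
{ replace (y / c) with (2 - x / c) by lra. ring. }
lra.
Qed.

Lemma circ_mean_convex p (H f g : C -> C) r : 1 <= p -> holo f -> holo g -> holo H -> 0 <= r < 1 ->
  (forall z, Cmod z = r -> Cmod (H z) <= (Cmod (f z) + Cmod (g z)) / 2) ->
  circ_mean p H r <= (circ_mean p f r + circ_mean p g r) / 2.
Proof.
intros Hp Hf Hg HH Hr Hle. pose proof two_PI_pos as Hpi.
pose proof (is_RInt_scal (V := R_NormedModule) _ _ _ (/ 2) _ (is_RInt_plus (V := R_NormedModule) _ _ _ _ _ _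
  (is_circ_mean p f r Hp Hf Hr) (is_circ_mean p g r Hp Hg Hr))) as J.
unfold Rdiv at 1. rewrite (Rmult_comm _ (/ 2)).
refine (is_RInt_le _ _ _ _ _ _ (Rlt_le _ _ Hpi) (is_circ_mean p H r Hp HH Hr) J _).
intros t _.
change (rpow (Cmod (H (circle_pt r t))) p <=
  / 2 * (rpow (Cmod (f (circle_pt r t))) p + rpow (Cmod (g (circle_pt r t))) p)).
rewrite Rmult_comm. eapply Rle_trans; [|apply rpow_midpoint; trivial; apply Cmod_ge_0].
apply rpow_le. lra. split. apply Cmod_ge_0. apply Hle, Cmod_circle. lra.
Qed.

Lemma avg_holo N : forall Phi, (forall n, holo (Phi n)) -> holo (avg Phi N).
Proof.
induction N as [|N IH]; intros Phi H z Hz.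
- exists (RtoC 0). apply cderiv_const.
- destruct (H O z Hz) as [l1 H1]. destruct (IH (fun n => Phi (S n)) (fun n => H (S n)) z Hz) as [l2 H2].
  eexists. apply (cderiv_mult (fun z => Phi O z + avg (fun n => Phi (S n)) N z)%C (fun _ => / 2)%C).
  apply (cderiv_plus (Phi O)); eassumption. apply cderiv_const.
Qed.

Lemma Cmod_half_sum a b : Cmod ((a + b) * / 2) <= (Cmod a + Cmod b) / 2.
Proof.
change ((a + b) * / 2)%C with ((a + b) / 2)%C. rewrite Cmod_half. pose proof (Cmod_triangle a b). lra.
Qed.

Lemma circ_mean_const0 p r : circ_mean p (fun _ => 0) r = 0.
Proof.
unfold circ_mean. rewrite (RInt_ext _ (fun _ => 0)).
rewrite RInt_const. unfold scal; simpl; unfold mult; simpl. ring.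
intros t _. rewrite Cmod_0. apply rpow_0.
Qed.

Lemma avg_mean p r Q N : 1 <= p -> 0 <= r < 1 -> 0 <= Q ->
  forall Phi, (forall n, holo (Phi n)) -> (forall n, circ_mean p (Phi n) r <= Q) ->
  circ_mean p (avg Phi N) r <= Q.
Proof.
intros Hp Hr HQ. induction N as [|N IH]; intros Phi H1 H2.
- change (avg Phi 0) with (fun _ : C => RtoC 0). rewrite circ_mean_const0. trivial.
- eapply Rle_trans. apply (circ_mean_convex p _ (Phi O) (avg (fun n => Phi (S n)) N)); trivial.
  apply avg_holo; intros; apply H1. apply (avg_holo (S N)); trivial.
  intros z _. apply Cmod_half_sum.
  specialize (IH (fun n => Phi (S n)) (fun n => H1 (S n)) (fun n => H2 (S n))). specialize (H2 O). lra.
Qed.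

(** For each r, N is taken so large that [wsum] and [avg] differ by at most 1 on the circle of
    radius r. Then |wsum| <= |avg| + 1, the midpoint of 2 |avg| and 2, so [circ_mean_convex]
    applies; N depends on r, but the resulting bound does not. *)
Lemma wsum_Hp p Phi Q : 1 <= p -> (forall n, holo (Phi n)) -> holo (wsum Phi) -> 0 <= Q ->
  (forall n r, 0 <= r < 1 -> circ_mean p (Phi n) r <= Q) ->
  (forall r, 0 <= r < 1 -> exists B, forall n z, Cmod z <= r -> Cmod (Phi n z) <= B) ->
  Hp p (wsum Phi).
Proof.
intros Hp1 H1 H2 HQ H3 H4. apply Hp_iff; trivial. split; trivial.
pose proof two_PI_pos as Hpi.
exists ((Rpower 2 p * Q + Rpower 2 p * (2 * PI)) / 2). intros r Hr.
destruct (H4 r Hr) as [B HB].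
assert (HB0 : 0 <= B).
{ eapply Rle_trans; [|apply (HB O 0)]. apply Cmod_ge_0. rewrite Cmod_0. lra. }
destruct (dyadic_small (2 * B) 1) as [N HN]; try lra.
assert (EN : 2 * B * (/ 2) ^ N <= 1).
{ rewrite pow_inv. unfold Rdiv in HN. lra. }
assert (Hdbl : forall f, holo f -> circ_mean p (fun z => 2 * f z)%C r = Rpower 2 p * circ_mean p f r).
{ intros f Hf. apply is_RInt_unique.
  pose proof (is_RInt_scal (V := R_NormedModule) _ _ _ (Rpower 2 p) _ (is_circ_mean p f r Hp1 Hf Hr)) as J.
  eapply is_RInt_ext with (2 := J). intros t _.
  change (Rpower 2 p * rpow (Cmod (f (circle_pt r t))) p = rpow (Cmod (2 * f (circle_pt r t))) p).
  rewrite Cmod_mult, Cmod_R, Rabs_pos_eq, rpow_mult by (try apply Cmod_ge_0; lra).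
  rewrite (rpow_pos 2) by lra. reflexivity. }
assert (Hone : circ_mean p (fun _ => 1) r = 2 * PI).
{ unfold circ_mean. rewrite (RInt_ext _ (fun _ => 1)).
  rewrite RInt_const. unfold scal; simpl; unfold mult; simpl. ring.
  intros t _. rewrite Cmod_1, rpow_pos by lra. rewrite Rpower_ln, ln_1, Rmult_0_r. apply exp_0. }
assert (h1 : holo (fun _ => RtoC 1)) by (intros z _; eexists; apply cderiv_const).
pose proof (avg_holo N Phi H1) as ha.
eapply Rle_trans.
- apply (circ_mean_convex p _ (fun z => 2 * avg Phi N z)%C (fun _ => 2 * 1)%C); trivial.
  + intros z Hz. destruct (ha z Hz) as [l Hl]. eexists. apply cderiv_scal. exact Hl.
  + intros z _; eexists; apply cderiv_const.
  + intros z Hz. rewrite !Cmod_mult, Cmod_1, Cmod_R, Rabs_pos_eq by lra.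
    assert (K : Cmod (wsum Phi z - avg Phi N z) <= 2 * B * (/ 2) ^ N)
      by (apply wsum_avg; intros; apply HB; lra).
    pose proof (Cmod_rev_triangle (wsum Phi z) (avg Phi N z)). lra.
- rewrite (Hdbl (avg Phi N)) by trivial. rewrite (Hdbl (fun _ => RtoC 1)) by trivial. rewrite Hone.
  assert (circ_mean p (avg Phi N) r <= Q) by (apply avg_mean; auto).
  pose proof (Rpower_pos 2 p). nra.
Qed.

(** * Peaking functions and the gliding hump *)

Definition peak (p : R) (a : C) (z : C) : C :=
  (RtoC (Rpower (1 - Cmod a) (2 - / p)) * (/ (1 - z * Cconj a)) ^ 2)%C.

Lemma peak_denom a z : unit_disc a -> Cmod z <= 1 -> (1 - z * Cconj a)%C <> 0 /\
  Cmod (/ (1 - z * Cconj a)) <= / (1 - Cmod a * Cmod z).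
Proof.
unfold unit_disc. intros Ha Hz. pose proof (Cmod_ge_0 a). pose proof (Cmod_ge_0 z).
assert (E : Cmod (z * Cconj a) = Cmod a * Cmod z) by (rewrite Cmod_mult, Cmod_conj; ring).
assert (L : Cmod a * Cmod z < 1) by nra.
assert (N : (1 - z * Cconj a)%C <> 0) by (apply one_minus_neq_0; lra).
split; trivial. rewrite Cmod_inv by trivial. apply Rinv_le_contravar. lra.
pose proof (Cmod_rev_triangle 1 (z * Cconj a)). rewrite Cmod_1 in *. lra.
Qed.

Lemma peak_coef p a : 1 <= p -> unit_disc a -> 0 < Rpower (1 - Cmod a) (2 - / p) <= 1.
Proof.
unfold unit_disc. intros Hp Ha. pose proof (Cmod_ge_0 a). split. apply Rpower_pos.
apply Rpower_le_1. lra. assert (/ p <= / 1) by (apply Rinv_le_contravar; lra). lra.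
Qed.

Lemma kernel_pow_deriv (n : nat) (e z : C) : (1 - z * e)%C <> 0 ->
  cderiv (fun z => (/ (1 - z * e)) ^ n)%C z (INR n * e * (/ (1 - z * e)) ^ S n)%C.
Proof.
intros N. eapply cderiv_eq. apply (cderiv_pow n (fun z => / (1 - z * e))%C).
apply (cderiv_inv (fun z => 1 - z * e)%C); trivial.
apply (cderiv_minus (fun _ => RtoC 1) (fun z => z * e)%C). apply cderiv_const.
apply (cderiv_mult (fun z => z) (fun _ => e)). apply cderiv_id. apply cderiv_const.
destruct n as [|n]. simpl. ring.
replace (S n - 1)%nat with n by lia. rewrite !Cpow_S. field. trivial.
Qed.

Lemma peak_holo p a : unit_disc a -> holo (peak p a).
Proof.
intros Ha z Hz. eexists. apply cderiv_scal, kernel_pow_deriv.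
apply peak_denom; trivial. unfold unit_disc in Hz; lra.
Qed.

(** With d = 1 - |a| and psi = |1/(1 - z conj a)| <= 1/d, one has |peak|^p = d psi^2 (d psi)^(2p-2)
    <= d psi^2, so every p reduces to the square mean of a Cauchy kernel. The exponent 2 - 1/p in
    [peak] is the one for which these means stay bounded while the derivative at a keeps the
    extremal order (1 - |a|)^(-(1 + 1/p)). *)
Lemma peak_mean p a r : 1 <= p -> unit_disc a -> 0 <= r < 1 -> circ_mean p (peak p a) r <= 2 * PI.
Proof.
intros Hp Ha Hr. pose proof two_PI_pos as Hpi. pose proof (Cmod_ge_0 a) as Ha0.
pose proof (is_circ_mean p _ r Hp (peak_holo p a Ha) Hr) as J1. unfold unit_disc in Ha.
set (d := 1 - Cmod a). assert (Hd : 0 < d) by (unfold d; lra).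
(* Moving r from the variable to the pole turns the integrand on the circle of radius r into
   [ck 1 b] in modulus. *)
set (b := (a * r)%C). assert (Eb : Cmod b = Cmod a * r).
{ unfold b. rewrite Cmod_mult, Cmod_R, Rabs_pos_eq; lra. }
assert (Hb : Cmod b < 1) by nra.
pose proof (is_RInt_scal (V := R_NormedModule) _ _ _ d _ (ck_sqr_mean 1 b Rlt_0_1 Hb)) as J2.
apply Rle_trans with (d * (2 * PI / (1 - (Cmod b / 1) ^ 2))).
- refine (is_RInt_le _ _ _ _ _ _ (Rlt_le _ _ Hpi) J1 J2 _). intros t _.
  change (rpow (Cmod (peak p a (circle_pt r t))) p <= d * Cmod (ck 1 b t) ^ 2).
  destruct (peak_denom a (circle_pt r t) Ha) as [N Bd]. rewrite Cmod_circle; lra.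
  assert (Ec : Cmod (ck 1 b t) = Cmod (/ (1 - circle_pt r t * Cconj a))).
  { rewrite ck_conj by (trivial; lra). rewrite Cmod_conj. f_equal. f_equal. f_equal.
    unfold b. rewrite Cmult_conj. rewrite Cconj_RtoC.
    rewrite circle_ei. field. }
  rewrite Ec. unfold peak. fold d.
  rewrite Cmod_mult, Cmod_pow, Cmod_R, Rabs_pos_eq by (left; apply Rpower_pos).
  assert (Hpsi : 0 < Cmod (/ (1 - circle_pt r t * Cconj a))).
  { rewrite Cmod_inv by trivial. apply Rinv_0_lt_compat, Cmod_gt_0, N. }
  assert (Hle : Cmod (/ (1 - circle_pt r t * Cconj a)) <= / d).
  { eapply Rle_trans. exact Bd. rewrite Cmod_circle by lra. apply Rinv_le_contravar. trivial. unfold d. nra. }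
  set (psi := Cmod (/ (1 - circle_pt r t * Cconj a))) in *. clearbody psi.
  assert (Hpsi2 : 0 < psi ^ 2) by (apply pow_lt; trivial).
  rewrite rpow_pos by (apply Rmult_lt_0_compat; trivial; apply Rpower_pos).
  rewrite <- Rpower_mult_distr by (trivial; apply Rpower_pos).
  rewrite <- (Rpower_pow 2 psi) by trivial. rewrite !Rpower_mult.
  replace ((2 - / p) * p) with (1 + (2 * p - 2)) by (field; lra).
  replace (INR 2 * p) with (INR 2 + (2 * p - 2)) by (simpl; ring).
  rewrite !Rpower_plus, Rpower_1 by trivial.
  assert (L : Rpower psi (2 * p - 2) <= Rpower (/ d) (2 * p - 2)) by (apply Rle_Rpower_l; lra).
  assert (E : Rpower d (2 * p - 2) * Rpower (/ d) (2 * p - 2) = 1).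
  { rewrite Rpower_mult_distr by (trivial; apply Rinv_0_lt_compat; trivial).
    rewrite Rinv_r by lra. rewrite Rpower_ln, ln_1, Rmult_0_r. apply exp_0. }
  pose proof (Rpower_pos psi (INR 2)). pose proof (Rpower_pos d (2 * p - 2)).
  apply Rle_trans with (d * Rpower psi (INR 2) * (Rpower d (2 * p - 2) * Rpower (/ d) (2 * p - 2))).
  2:{ rewrite E. lra. }
  replace (d * Rpower d (2 * p - 2) * (Rpower psi (INR 2) * Rpower psi (2 * p - 2)))
   with (d * Rpower psi (INR 2) * (Rpower d (2 * p - 2) * Rpower psi (2 * p - 2))) by ring.
  apply Rmult_le_compat_l. nra. apply Rmult_le_compat_l; lra.
- rewrite Eb. replace (Cmod a * r / 1) with (Cmod a * r) by field.
  assert (H1 : d <= 1 - (Cmod a * r) ^ 2).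
  { assert (Cmod a * r <= Cmod a) by nra. assert (0 <= Cmod a * r) by nra. unfold d. nra. }
  apply Rmult_le_reg_r with (1 - (Cmod a * r) ^ 2). lra.
  replace (d * (2 * PI / (1 - (Cmod a * r) ^ 2)) * (1 - (Cmod a * r) ^ 2)) with (d * (2 * PI)) by (field; lra).
  rewrite (Rmult_comm d). apply Rmult_le_compat_l; lra.
Qed.

Definition peak1 (p : R) (a : C) (z : C) : C :=
  (RtoC (Rpower (1 - Cmod a) (2 - / p)) * (2 * Cconj a * (/ (1 - z * Cconj a)) ^ 3))%C.

Lemma Rpower_inv_base x e : 0 < x -> Rpower (/ x) e = Rpower x (- e).
Proof. intros Hx. rewrite !Rpower_ln, ln_Rinv by trivial. f_equal. ring. Qed.

Lemma inv_cube_Rpower x : 0 < x -> / x ^ 3 = Rpower x (-3).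
Proof.
intros Hx. rewrite <- (Rpower_pow 3) by trivial. rewrite <- Rpower_Ropp. f_equal. simpl; ring.
Qed.

Section PeakSum.
Context (p : R) (Hp1 : 1 <= p) (a : nat -> C) (Ha : forall n, unit_disc (a n)).

(** Termwise differentiation: on a disc of radius rho < 1 the Taylor constant of [kernel_taylor] is
    the same for all n, since the coefficients and the |a n| are at most 1. *)
Lemma peak_sum_deriv z : unit_disc z ->
  cderiv (wsum (fun n => peak p (a n))) z (wsum (fun n => peak1 p (a n)) z).
Proof.
intros Hz. unfold unit_disc in Hz. pose proof (Cmod_ge_0 z) as Hz0.
set (rho := (1 + Cmod z) / 2). assert (Hrho : Cmod z < rho < 1) by (unfold rho; lra).
assert (H1r : 0 < 1 - rho) by lra.
assert (HA : 0 <= / (1 - rho)) by (left; apply Rinv_0_lt_compat; lra).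
destruct (kernel_taylor 2 1 (/ (1 - rho))) as [K [HK HKt]]; trivial. lra.
replace (INR 2) with 2 in HKt by (simpl; ring).
assert (Bd : forall n w, Cmod w <= rho -> (1 - w * Cconj (a n))%C <> 0 /\
   Cmod (/ (1 - w * Cconj (a n))) <= / (1 - rho)).
{ intros n w Hw. destruct (peak_denom (a n) w (Ha n)) as [N1 N2]. lra. split; trivial.
  eapply Rle_trans. exact N2. apply Rinv_le_contravar. trivial.
  specialize (Ha n). unfold unit_disc in Ha. pose proof (Cmod_ge_0 w). pose proof (Cmod_ge_0 (a n)). nra. }
assert (Bp : forall w, Cmod w <= rho -> forall n, Cmod (peak p (a n) w) <= (/ (1 - rho)) ^ 2).
{ intros w Hw n. destruct (Bd n w Hw) as [N1 N2]. unfold peak.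
  pose proof (peak_coef p (a n) Hp1 (Ha n)) as [C1 C2].
  rewrite Cmod_mult, Cmod_pow, Cmod_R, Rabs_pos_eq by lra.
  rewrite <- (Rmult_1_l ((/ (1 - rho)) ^ 2)).
  apply Rmult_le_compat; try lra. apply pow_le, Cmod_ge_0. apply pow_incr. split; [apply Cmod_ge_0|trivial]. }
assert (Bp1 : forall n, Cmod (peak1 p (a n) z) <= 2 * (/ (1 - rho)) ^ 3).
{ intros n. destruct (Bd n z) as [N1 N2]. lra. unfold peak1.
  pose proof (peak_coef p (a n) Hp1 (Ha n)) as [C1 C2]. specialize (Ha n). unfold unit_disc in Ha.
  pose proof (Cmod_ge_0 (a n)).
  rewrite !Cmod_mult, Cmod_pow, !Cmod_R, !Rabs_pos_eq, Cmod_conj by lra.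
  assert (P3 : Cmod (/ (1 - z * Cconj (a n))) ^ 3 <= (/ (1 - rho)) ^ 3)
    by (apply pow_incr; split; [apply Cmod_ge_0|trivial]).
  assert (P0 : 0 <= Cmod (/ (1 - z * Cconj (a n))) ^ 3) by (apply pow_le, Cmod_ge_0).
  set (t3 := Cmod (/ (1 - z * Cconj (a n))) ^ 3) in *. set (T3 := (/ (1 - rho)) ^ 3) in *.
  apply Rle_trans with (1 * (2 * Cmod (a n) * t3)); [apply Rmult_le_compat_r; trivial; nra | nra]. }
apply cderiv_eps. intros eps He.
exists (Rmin (rho - Cmod z) (eps / (2 * K + 1))). split.
{ apply Rmin_pos. lra. apply Rdiv_lt_0_compat; lra. }
intros w Hw.
assert (Hw1 : Cmod (w - z) < rho - Cmod z) by (eapply Rlt_le_trans; [exact Hw|apply Rmin_l]).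
assert (Hw2 : Cmod (w - z) < eps / (2 * K + 1)) by (eapply Rlt_le_trans; [exact Hw|apply Rmin_r]).
assert (Hwr : Cmod w <= rho) by (pose proof (Cmod_rev_triangle w z); lra).
assert (Hzr : Cmod z <= rho) by lra.
set (D n := (peak p (a n) w - peak p (a n) z - (w - z) * peak1 p (a n) z)%C).
assert (E : (wsum (fun n => peak p (a n)) w - wsum (fun n => peak p (a n)) z
   - wsum (fun n => peak1 p (a n)) z * (w - z))%C = CSer (fun n => RtoC (wt n) * D n)%C).
{ pose proof (wt_bounded_wt _ _ (Bp w Hwr)) as W1. pose proof (wt_bounded_wt _ _ (Bp z Hzr)) as W2.
  pose proof (wt_bounded_wt _ _ Bp1) as W3.
  pose proof (wt_bounded_scal (- (1)) _ _ W2) as W2'. pose proof (wt_bounded_scal (- (w - z))%C _ _ W3) as W3'.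
  rewrite (CSer_ext _ (fun n => RtoC (wt n) * peak p (a n) w + - (1) * (RtoC (wt n) * peak p (a n) z)
    + - (w - z) * (RtoC (wt n) * peak1 p (a n) z))%C).
  2:{ intros n. unfold D. ring. }
  rewrite (CSer_plus _ _ _ _ (wt_bounded_plus _ _ _ _ W1 W2') W3').
  rewrite (CSer_plus _ _ _ _ W1 W2'). rewrite (CSer_scal _ _ _ W2), (CSer_scal _ _ _ W3).
  unfold wsum. ring. }
rewrite E. clear E.
assert (DB : forall n, Cmod (D n) <= K * Cmod (w - z) ^ 2).
{ intros n. destruct (Bd n z Hzr) as [Nz Az]. destruct (Bd n w Hwr) as [Nw Aw].
  pose proof (peak_coef p (a n) Hp1 (Ha n)) as [C1 C2].
  unfold D, peak, peak1.
  replace (_ - _ - _)%C with (RtoC (Rpower (1 - Cmod (a n)) (2 - / p)) *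
   ((/ (1 - w * Cconj (a n))) ^ 2 - (/ (1 - z * Cconj (a n))) ^ 2
    - (w - z) * (2 * Cconj (a n) * (/ (1 - z * Cconj (a n))) ^ 3)))%C by ring.
  rewrite Cmod_mult, Cmod_R, Rabs_pos_eq by lra.
  rewrite <- (Rmult_1_l (K * _)). apply Rmult_le_compat; try lra. apply Cmod_ge_0.
  apply HKt; trivial. rewrite Cmod_conj. specialize (Ha n). unfold unit_disc in Ha. lra. }
eapply Rle_trans. apply CSer_bound, wt_bounded_wt, DB.
pose proof (Cmod_ge_0 (w - z)) as H0.
apply Rle_trans with (Cmod (w - z) * ((2 * K + 1) * (eps / (2 * K + 1)))).
- replace (2 * (K * Cmod (w - z) ^ 2)) with (Cmod (w - z) * (2 * K * Cmod (w - z))) by ring.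
  apply Rmult_le_compat_l; trivial. apply Rmult_le_compat; lra.
- right. field. lra.
Qed.

Lemma peak_sum_Hp : Hp p (wsum (fun n => peak p (a n))).
Proof.
pose proof two_PI_pos as Hpi.
apply wsum_Hp with (2 * PI); trivial; try lra.
- intros n. apply peak_holo, Ha.
- intros z Hz. eexists. apply peak_sum_deriv, Hz.
- intros n r Hr. apply peak_mean; trivial.
- intros r Hr. exists ((/ (1 - r)) ^ 2). intros n z Hz.
  destruct (peak_denom (a n) z (Ha n)) as [N1 N2]. lra. unfold peak.
  pose proof (peak_coef p (a n) Hp1 (Ha n)) as [C1 C2].
  rewrite Cmod_mult, Cmod_pow, Cmod_R, Rabs_pos_eq by lra.
  rewrite <- (Rmult_1_l ((/ (1 - r)) ^ 2)).
  apply Rmult_le_compat; try lra. apply pow_le, Cmod_ge_0. apply pow_incr. split; [apply Cmod_ge_0|].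
  eapply Rle_trans. exact N2. apply Rinv_le_contravar. lra.
  specialize (Ha n). unfold unit_disc in Ha. pose proof (Cmod_ge_0 z). pose proof (Cmod_ge_0 (a n)). nra.
Qed.

(** The separation makes every other peak contribute at most 2^-N / 500 of the extremal size to the
    derivative at [a N]. The power of 4 beats the weight 2^-(N+1) of the N-th peak, and 1000 leaves
    room for the constants. *)
Context (Hhalf : forall n, / 2 <= Cmod (a n))
  (Hsep : forall n, 1 - Cmod (a (S n)) <= (1 - Cmod (a n)) * / (1000 * 4 ^ S n)).

Let d n := 1 - Cmod (a n).

Local Lemma d_pos n : 0 < d n.
Proof. specialize (Ha n). unfold unit_disc in Ha. unfold d. lra. Qed.

Local Lemma pow4_pos n : 0 < 4 ^ n.
Proof. apply pow_lt. lra. Qed.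

Local Lemma pow4_ge n : 1 <= 4 ^ n.
Proof. apply pow_R1_Rle. lra. Qed.

Local Lemma d_dec n : d (S n) <= d n.
Proof.
pose proof (Hsep n) as H. fold (d n) (d (S n)) in H. pose proof (d_pos n). pose proof (pow4_ge (S n)).
assert (/ (1000 * 4 ^ S n) <= / 1) by (apply Rinv_le_contravar; lra). nra.
Qed.

Local Lemma d_mono n j : d (n + j) <= d n.
Proof.
induction j as [|j IH]. rewrite Nat.add_0_r. lra.
rewrite Nat.add_succ_r. eapply Rle_trans. apply d_dec. exact IH.
Qed.

Local Lemma d_quot_le_1 n m : (n <= m)%nat -> d m / d n <= 1.
Proof.
intros H. pose proof (d_pos n). apply Rmult_le_reg_r with (d n); trivial.
unfold Rdiv. rewrite Rmult_assoc, Rinv_l, Rmult_1_l, Rmult_1_r by lra.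
replace m with (n + (m - n))%nat by lia. apply d_mono.
Qed.

Local Lemma d_ratio n m : (n < m)%nat -> d m / d n <= / (1000 * 4 ^ S n).
Proof.
intros H. pose proof (d_pos n). apply Rmult_le_reg_r with (d n); trivial.
unfold Rdiv. rewrite Rmult_assoc, Rinv_l, Rmult_1_r by lra. rewrite Rmult_comm.
replace m with (S n + (m - S n))%nat by lia. eapply Rle_trans. apply d_mono. apply Hsep.
Qed.

Local Lemma d_ratio' n m : (n < m)%nat -> d m / d n <= / (1000 * 4 ^ m).
Proof.
intros H. destruct m as [|m]. lia.
pose proof (d_pos n). pose proof (d_pos m). pose proof (d_pos (S m)).
apply Rle_trans with (d (S m) / d m); [|apply d_ratio; lia].
apply Rmult_le_compat_l. lra. apply Rinv_le_contravar; trivial.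
replace m with (n + (m - n))%nat by lia. apply d_mono.
Qed.

(** The N-th term alone is at least wt N times W / 8, that is 2^-N W / 16. The other terms add up to
    at most 2 (2^-N / 500) W, which leaves more than 2^-N W / 32. *)
Lemma peak_sum_lower N :
  (/ 2) ^ N / 32 * Rpower (d N) (- (1 + / p)) <= Cmod (wsum (fun n => peak1 p (a n)) (a N)).
Proof.
pose proof (Ha N) as HaN. pose proof (d_pos N) as HdN. unfold unit_disc in HaN.
assert (Hp0 : 0 < / p <= 1).
{ split. apply Rinv_0_lt_compat; lra. rewrite <- Rinv_1. apply Rinv_le_contravar; lra. }
set (W := Rpower (d N) (- (1 + / p))). assert (HW : 0 < W) by apply Rpower_pos.
set (t n := peak1 p (a n) (a N)).
assert (Hmax : forall m, d m <= 1 - Cmod (a m) * Cmod (a N) /\ d N <= 1 - Cmod (a m) * Cmod (a N)).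
{ intros m. specialize (Ha m). unfold unit_disc in Ha. pose proof (Cmod_ge_0 (a m)). pose proof (Cmod_ge_0 (a N)).
  unfold d. split; nra. }
assert (Hup : forall m D, 0 < D -> D <= 1 - Cmod (a m) * Cmod (a N) ->
  Cmod (t m) <= 2 * Rpower (d m) (2 - / p) * / D ^ 3).
{ intros m D HD HD1. destruct (peak_denom (a m) (a N) (Ha m)) as [N1 N2]. lra.
  unfold t, peak1. rewrite !Cmod_mult, Cmod_pow, !Cmod_R, Cmod_conj, !Rabs_pos_eq by (try (left; apply Rpower_pos); lra).
  fold (d m). pose proof (Rpower_pos (d m) (2 - / p)).
  assert (P3 : Cmod (/ (1 - a N * Cconj (a m))) ^ 3 <= / D ^ 3).
  { rewrite <- pow_inv. apply pow_incr. split. apply Cmod_ge_0. eapply Rle_trans. exact N2.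
    apply Rinv_le_contravar; trivial. }
  assert (P0 : 0 <= Cmod (/ (1 - a N * Cconj (a m))) ^ 3) by (apply pow_le, Cmod_ge_0).
  specialize (Ha m). unfold unit_disc in Ha. pose proof (Cmod_ge_0 (a m)).
  set (t3 := Cmod (/ (1 - a N * Cconj (a m))) ^ 3) in *.
  set (P := Rpower (d m) (2 - / p)) in *.
  replace (2 * P * / D ^ 3) with (P * (2 * / D ^ 3)) by ring.
  apply Rmult_le_compat_l. lra. apply Rle_trans with (2 * 1 * t3); nra. }
assert (Hoff : forall m, m <> N -> Cmod (t m) <= (/ 2) ^ N / 500 * W).
{ intros m Hm. pose proof (d_pos m) as Hdm.
  assert (P24 : / 4 ^ N <= (/ 2) ^ N).
  { rewrite <- pow_inv. apply pow_incr. lra. }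
  assert (Inv4 : forall k, / (1000 * 4 ^ k) = / 1000 * / 4 ^ k).
  { intros k. rewrite Rinv_mult. reflexivity. }
  destruct (Compare_dec.lt_dec m N) as [HmN|HmN].
  (* An earlier peak is much wider than d N, so its derivative is at most 2 (d m)^(-(1 + 1/p)) <= 2
     (d N / d m) W. *)
  - eapply Rle_trans. apply (Hup m (d m) Hdm). apply Hmax.
    rewrite inv_cube_Rpower by trivial.
    rewrite Rmult_assoc, <- Rpower_plus.
    replace (2 - / p + -3) with (- (1 + / p)) by ring.
    assert (K : Rpower (d m) (- (1 + / p)) <= d N / d m * W).
    { replace (d N / d m) with (Rpower (d N / d m) 1) by (apply Rpower_1, Rdiv_lt_0_compat; trivial).
      apply Rle_trans with (Rpower (d N / d m) (1 + / p) * W).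
      - right. unfold W, Rdiv. rewrite <- Rpower_mult_distr by (trivial; apply Rinv_0_lt_compat; trivial).
        rewrite Rpower_inv_base, Rmult_comm by trivial.
        rewrite <- Rmult_assoc, <- Rpower_plus.
        replace (- (1 + / p) + (1 + / p)) with 0 by ring. rewrite Rpower_O by trivial. ring.
      - apply Rmult_le_compat_r. lra.
        assert (Hq1 : d N / d m <= 1) by (apply d_quot_le_1; lia).
        assert (Hq0 : 0 < d N / d m) by (apply Rdiv_lt_0_compat; trivial).
        rewrite Rpower_plus, Rpower_1 by trivial.
        pose proof (Rpower_le_1 (d N / d m) (/ p)). nra. }
    pose proof (d_ratio' m N HmN) as Rt. rewrite Inv4 in Rt.
    assert (d N / d m * W <= (/ 1000 * (/ 2) ^ N) * W) by (apply Rmult_le_compat_r; lra). lra.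
  (* A later peak has a tiny coefficient, and its kernel at [a N] is at most 1 / d N: the term is at
     most 2 (d m / d N) W because 2 - 1/p >= 1. *)
  - eapply Rle_trans. apply (Hup m (d N) HdN). apply Hmax.
    rewrite inv_cube_Rpower by trivial.
    assert (K : Rpower (d m) (2 - / p) * Rpower (d N) (-3) <= d m / d N * W).
    { assert (Hq1 : d m / d N <= 1) by (apply d_quot_le_1; lia).
      assert (Hq0 : 0 < d m / d N) by (apply Rdiv_lt_0_compat; trivial).
      apply Rle_trans with (Rpower (d m / d N) (1 + (1 - / p)) * W).
      - right. unfold W, Rdiv. rewrite <- Rpower_mult_distr by (trivial; apply Rinv_0_lt_compat; trivial).
        rewrite Rpower_inv_base by trivial. rewrite Rmult_assoc, <- Rpower_plus. f_equal; f_equal; ring.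
      - apply Rmult_le_compat_r. lra. rewrite Rpower_plus, Rpower_1 by trivial.
        pose proof (Rpower_le_1 (d m / d N) (1 - / p)). nra. }
    assert (HNm : (N < m)%nat) by lia. pose proof (d_ratio N m HNm) as Rt. rewrite Inv4 in Rt.
    assert (P4S : / 4 ^ S N <= / 4 ^ N).
    { apply Rinv_le_contravar. apply pow4_pos. simpl. pose proof (pow4_pos N). lra. }
    assert (d m / d N * W <= (/ 1000 * (/ 2) ^ N) * W) by (apply Rmult_le_compat_r; lra).
    rewrite Rmult_assoc. lra. }
(* 2 |a N| >= 1 by [Hhalf], and 1 - |a N|^2 <= 2 d N, whose cube gives the factor 1/8. *)
assert (Hmain : W / 8 <= Cmod (t N)).
{ unfold t, peak1. rewrite !Cmod_mult, Cmod_pow, !Cmod_R, Cmod_conj, !Rabs_pos_eq by (try (left; apply Rpower_pos); lra).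
  fold (d N).
  assert (E : (1 - a N * Cconj (a N))%C = RtoC (1 - Cmod (a N) ^ 2)).
  { rewrite <- Cmod2_conj, RtoC_minus. reflexivity. }
  pose proof (Hhalf N) as Hh.
  assert (Hpos : 0 < 1 - Cmod (a N) ^ 2) by nra.
  rewrite E, Cmod_inv, Cmod_R, Rabs_pos_eq by (try apply RtoC_neq; lra).
  assert (Hl : / (2 * d N) <= / (1 - Cmod (a N) ^ 2)).
  { apply Rinv_le_contravar. trivial. unfold d. nra. }
  assert (Hl3 : (/ (2 * d N)) ^ 3 <= (/ (1 - Cmod (a N) ^ 2)) ^ 3).
  { apply pow_incr. split; trivial. left. apply Rinv_0_lt_compat. lra. }
  assert (EW : W = Rpower (d N) (2 - / p) * (/ d N) ^ 3).
  { unfold W. rewrite pow_inv. rewrite <- (Rpower_pow 3) by trivial. rewrite <- Rpower_Ropp, <- Rpower_plus.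
    f_equal. simpl. ring. }
  pose proof (Rpower_pos (d N) (2 - / p)) as HP. set (P := Rpower (d N) (2 - / p)) in *.
  replace (W / 8) with (P * (2 * / 2 * (/ (2 * d N)) ^ 3)).
  2:{ rewrite EW. field. lra. }
  apply Rmult_le_compat_l. lra. apply Rmult_le_compat; try lra.
  apply pow_le. left. apply Rinv_0_lt_compat. lra. }
set (u n := if Nat.eq_dec n N then RtoC 0 else t n).
assert (Hu : forall n, Cmod (u n) <= (/ 2) ^ N / 500 * W).
{ intros n. unfold u. destruct (Nat.eq_dec n N) as [_|Hn].
  - rewrite Cmod_0. apply Rmult_le_pos; [|lra]. pose proof (pow_lt (/ 2) N). lra.
  - apply Hoff, Hn. }
assert (E : wsum (fun n => peak1 p (a n)) (a N) = (RtoC (wt N) * t N + CSer (fun n => RtoC (wt n) * u n))%C).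
{ unfold wsum. rewrite <- (CSer_single N (RtoC (wt N) * t N)%C) at 1.
  rewrite <- (CSer_plus (Cmod (t N)) _ _ _) with (2 := wt_bounded_wt _ _ Hu).
  - apply CSer_ext. intros n. unfold u. fold (t n). destruct (Nat.eq_dec n N) as [->|]; ring.
  - intros n. destruct (Nat.eq_dec n N) as [->|].
    + rewrite Cmod_mult, Cmod_R, Rabs_pos_eq by (left; apply wt_pos). lra.
    + rewrite Cmod_0. apply Rmult_le_pos. apply Cmod_ge_0. left; apply wt_pos. }
rewrite E.
pose proof (CSer_bound _ _ (wt_bounded_wt _ _ Hu)) as B2.
pose proof (Cmod_rev_triangle (RtoC (wt N) * t N) (- CSer (fun n => RtoC (wt n) * u n))%C) as Tr.
replace (RtoC (wt N) * t N - - CSer (fun n => RtoC (wt n) * u n))%C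
  with (RtoC (wt N) * t N + CSer (fun n => RtoC (wt n) * u n))%C in Tr by ring.
rewrite Cmod_opp, Cmod_mult, Cmod_R, Rabs_pos_eq in Tr by (left; apply wt_pos).
assert (Ewt : wt N = / 2 * (/ 2) ^ N) by reflexivity.
assert (H2N : 0 < (/ 2) ^ N) by (apply pow_lt; lra).
assert (wt N * (W / 8) <= wt N * Cmod (t N)) by (apply Rmult_le_compat_l; trivial; left; apply wt_pos).
assert (0 < (/ 2) ^ N * W) by (apply Rmult_lt_0_compat; trivial).
rewrite Ewt in *. lra.
Qed.
End PeakSum.

(** [K] may depend on F, so one F has to defeat all constants. Since k is bounded on smaller discs,
    an unbounded k takes large values arbitrarily close to the circle, and the centres of the peaks
    can be chosen there; evaluating at [a N] forces 2^N / 32 <= K for all N. *)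
Theorem multiplier_bounded p k : 1 <= p -> holo k ->
  (forall F, Hp p F -> exists K, forall a, unit_disc a ->
     Cmod (C_derive F a) * Cmod (k a) <= K * Rpower (1 - Cmod a) (- (1 + / p))) ->
  exists M, forall z, unit_disc z -> Cmod (k z) <= M.
Proof.
intros Hp1 Hk Hgr. apply NNPP. intros Hunb.
assert (Hfar : forall M rho, 0 <= rho < 1 -> exists z, unit_disc z /\ rho < Cmod z /\ M <= Cmod (k z)).
{ intros M rho Hrho. destruct (holo_bounded_compact k rho Hk Hrho) as [B [_ HB]].
  apply NNPP. intros H. apply Hunb. exists (Rmax M B). intros z Hz.
  destruct (Rle_dec (Cmod z) rho) as [H1|H1].
  - eapply Rle_trans. apply HB, H1. apply Rmax_r.
  - destruct (Rle_dec M (Cmod (k z))) as [H2|H2].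
    + exfalso. apply H. exists z. repeat split; trivial. lra.
    + eapply Rle_trans; [|apply Rmax_l]. lra. }
(* The condition on rho is kept as a premise, which makes the choice function total on pairs (M,
   rho). *)
destruct (functional_choice (fun (P : R * R) z => 0 <= snd P < 1 ->
   unit_disc z /\ snd P < Cmod z /\ fst P <= Cmod (k z))) as [sel Hsel].
{ intros [M rho]. simpl. destruct (classic (0 <= rho < 1)) as [H|H].
  - destruct (Hfar M rho H) as [z Hz]. exists z. intros _. exact Hz.
  - exists (RtoC 0). intros H'. contradiction. }
(* The first coordinate is the lower bound 4^n for |k| (1 for n = 0); the second is the radius to be
   exceeded, chosen so that [Hsep] holds at the next index. *)
set (a := fix a n := match n with
  | O => sel (1, / 2)
  | S n => sel (4 ^ S n, 1 - (1 - Cmod (a n)) * / (1000 * 4 ^ S n)) end).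
assert (Hinv : forall n, 0 < / (1000 * 4 ^ S n) <= / 1000).
{ intros n. assert (1 <= 4 ^ S n) by (apply pow_R1_Rle; lra). split. apply Rinv_0_lt_compat; lra.
  apply Rinv_le_contravar; lra. }
assert (Ha : forall n, unit_disc (a n) /\ / 2 <= Cmod (a n) /\ 4 ^ n <= Cmod (k (a n)) /\
   1 - Cmod (a (S n)) <= (1 - Cmod (a n)) * / (1000 * 4 ^ S n)).
{ assert (Step : forall n, unit_disc (a n) -> / 2 <= Cmod (a n) ->
    unit_disc (a (S n)) /\ 1 - (1 - Cmod (a n)) * / (1000 * 4 ^ S n) < Cmod (a (S n)) /\ 4 ^ S n <= Cmod (k (a (S n)))).
  { intros n U1 U2. unfold unit_disc in U1. specialize (Hinv n).
    apply (Hsel (4 ^ S n, 1 - (1 - Cmod (a n)) * / (1000 * 4 ^ S n))).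
    cbn [snd]. set (e := / (1000 * 4 ^ S n)) in *. clearbody e. split; nra. }
  assert (I : forall n, unit_disc (a n) /\ / 2 <= Cmod (a n) /\ 4 ^ n <= Cmod (k (a n))).
  { induction n as [|n [I1 [I2 I3]]].
    - destruct (Hsel (1, / 2)) as [S1 [S2 S3]]. simpl. lra. simpl in S2, S3.
      change (a O) with (sel (1, / 2)). repeat split; trivial. lra.
    - destruct (Step n I1 I2) as [S1 [S2 S3]]. split; [exact S1|]. split; [|exact S3].
      specialize (Hinv n). unfold unit_disc in I1. set (e := / (1000 * 4 ^ S n)) in *. clearbody e. nra. }
  intros n. destruct (I n) as [I1 [I2 I3]]. repeat split; trivial.
  destruct (Step n I1 I2) as [_ [S2 _]]. lra. }
assert (HU : forall n, unit_disc (a n)) by (intros; apply Ha).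
destruct (Hgr _ (peak_sum_Hp p Hp1 a HU)) as [K HK].
assert (Hall : forall N, 2 ^ N / 32 <= K).
{ intros N. specialize (HK (a N) (HU N)).
  rewrite (is_C_derive_unique _ _ _ (peak_sum_deriv p Hp1 a HU (a N) (HU N))) in HK.
  pose proof (peak_sum_lower p Hp1 a HU (fun n => proj1 (proj2 (Ha n)))
    (fun n => proj2 (proj2 (proj2 (Ha n)))) N) as L.
  cbv beta zeta in L. set (W := Rpower _ _) in *. assert (HW : 0 < W) by apply Rpower_pos.
  destruct (Ha N) as [_ [_ [Hk4 _]]].
  assert (H2N : 0 < (/ 2) ^ N) by (apply pow_lt; lra).
  apply Rmult_le_reg_r with W; trivial. eapply Rle_trans; [|exact HK].
  apply Rle_trans with ((/ 2) ^ N / 32 * W * 4 ^ N).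
  - right. replace (4 ^ N) with (2 ^ N * 2 ^ N) by (rewrite <- Rpow_mult_distr; f_equal; ring).
    rewrite pow_inv. field. apply pow_nonzero; lra.
  - apply Rmult_le_compat; trivial. apply Rmult_le_pos; lra. apply pow_le; lra. }
destruct (Pow_x_infinity 2) with (b := 32 * K + 1) as [N HN]. rewrite Rabs_pos_eq; lra.
specialize (HN N (Nat.le_refl N)). rewrite Rabs_pos_eq in HN by (apply pow_le; lra).
specialize (Hall N). lra.
Qed.

(** * The operators [Tg] and their optimal domains *)

(** [Tg] integrates junk values of f at poles on the segment, and this lemma discards them. Let s be
    the supremum of the x such that the integral over [0, x] exists and is 0: the punctured
    neighbourhood of s shows that s itself qualifies, and that one can go beyond s unless s = 1. *)
Lemma is_CInt_isolated (w : R -> C) :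
  (forall t0, 0 <= t0 <= 1 -> exists d, 0 < d /\ forall t, Rabs (t - t0) < d -> t <> t0 -> w t = 0) ->
  is_CInt w 0 1 (RtoC 0).
Proof.
intros H.
assert (Z : forall a b, a <= b -> (forall t, a < t < b -> w t = 0) -> is_CInt w a b (RtoC 0)).
{ intros a b Hab Hz. pose proof (is_CInt_const 0 a b) as K. rewrite Cmult_0_r in K.
  eapply is_CInt_ext with (3 := K); trivial. intros t Ht. symmetry. apply Hz, Ht. }
assert (Ch : forall a b, is_CInt w 0 a (RtoC 0) -> is_CInt w a b (RtoC 0) -> is_CInt w 0 b (RtoC 0)).
{ intros a b H1 H2. pose proof (@is_RInt_Chasles C_R_NormedModule _ _ _ _ _ _ H1 H2) as K.
  replace (plus (RtoC 0 : C_R_NormedModule) (RtoC 0)) with (RtoC 0 : C_R_NormedModule) in K; trivial.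
  change (RtoC 0 = (0 + 0)%C). ring. }
set (E x := 0 <= x <= 1 /\ is_CInt w 0 x (RtoC 0)).
assert (E0 : E 0) by (split; [lra | apply Z; [lra | intros; lra]]).
destruct (completeness E) as [s [Hs1 Hs2]].
- exists 1. intros x [Hx _]. lra.
- exists 0. exact E0.
- assert (Hs : 0 <= s <= 1).
  { split. apply Hs1, E0. apply Hs2. intros x [Hx _]. lra. }
  destruct (H s Hs) as [d [Hd Hw]].
  assert (Es : is_CInt w 0 s (RtoC 0)).
  { destruct (classic (exists x, E x /\ s - d < x)) as [[x [[Hx Ex] Hxs]]|Hno].
    - assert (x <= s) by (apply Hs1; split; trivial).
      apply (Ch x); trivial. apply Z; trivial. intros t Ht. apply Hw; [|lra].
      rewrite Rabs_left; lra.
    - exfalso. assert (s <= s - d); [|lra]. apply Hs2. intros x Ex.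
      destruct (Rle_dec x (s - d)); trivial. exfalso. apply Hno. exists x. split; trivial. lra. }
  destruct (Req_EM_T s 1) as [->|n]; trivial. exfalso.
  set (x := Rmin 1 (s + d / 2)).
  assert (Hx : s < x /\ x <= 1 /\ x <= s + d / 2).
  { unfold x. split. apply Rmin_glb_lt; lra. split; [apply Rmin_l | apply Rmin_r]. }
  assert (E x).
  { split. lra. apply (Ch s); trivial. apply Z. lra. intros t Ht. apply Hw; [|lra]. rewrite Rabs_right; lra. }
  assert (x <= s) by (apply Hs1; trivial). lra.
Qed.

Lemma seg_pt_0 z t : seg_pt 0 z t = (RtoC t * z)%C.
Proof. unfold seg_pt. ring. Qed.

(** The two integrands differ only at isolated parameters of the segment. For z = 0 the segment is a
    single point, possibly a pole, but the factor z makes both integrands 0. *)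
Lemma Tg_prim g f h z : holo h -> unit_disc z ->
  (forall z0, unit_disc z0 -> @locally' C_UniformSpace z0 (fun z => h z = (f z * C_derive g z)%C)) ->
  Tg g f z = prim h z.
Proof.
intros Hh Hz H.
pose proof (is_seg_int h (holo_cont h Hh) 0 z unit_disc_0 Hz) as I.
change (seg_int h 0 z) with (prim h z) in I.
unfold Tg. apply is_CInt_unique.
set (v := fun t : R => (z * (f (t * z) * C_derive g (t * z)))%C).
assert (I0 : is_CInt (fun t => v t - (z - 0) * h (seg_pt 0 z t))%C 0 1 (RtoC 0)).
{ apply is_CInt_isolated. intros t0 Ht0.
  destruct (Ceq_dec z 0) as [->|nz].
  { exists 1. split. lra. intros t _ _. unfold v. ring. }
  pose proof (proj1 (Cmod_gt_0 _) nz) as Hzp.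
  assert (Ht0z : unit_disc (RtoC t0 * z)%C).
  { rewrite <- seg_pt_0. apply seg_pt_unit_disc; trivial. apply unit_disc_0. }
  destruct (proj1 (locally'_Cmod _ _) (H _ Ht0z)) as [d [Hd Hw]].
  exists (d / Cmod z). split. apply Rdiv_lt_0_compat; trivial.
  intros t Ht Htt. unfold v. rewrite seg_pt_0, Hw. ring.
  - replace (t * z - t0 * z)%C with (RtoC (t - t0) * z)%C by (rewrite RtoC_minus; ring).
    rewrite Cmod_mult, Cmod_R. apply (Rmult_lt_compat_r (Cmod z)) in Ht; trivial.
    unfold Rdiv in Ht. rewrite Rmult_assoc, Rinv_l in Ht; lra.
  - intros E. apply Htt.
    assert (E' : (RtoC (t - t0) * z)%C = 0) by (rewrite RtoC_minus; transitivity (t * z - t0 * z)%C; [ring|rewrite E; ring]).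
    destruct (Req_EM_T (t - t0) 0) as [E1|n1]; [lra|]. exfalso.
    revert E'. apply Cmult_neq_0; trivial. apply RtoC_neq, n1. }
pose proof (is_CInt_plus _ _ _ _ _ _ I0 I) as K. rewrite Cplus_0_l in K.
eapply is_CInt_ext with (3 := K). lra. intros t _. simpl. fold (v t). ring.
Qed.

Lemma Hp_ext p f g : 1 <= p -> (forall z, unit_disc z -> f z = g z) -> Hp p f -> Hp p g.
Proof.
intros Hp1 E H. apply (Hp_iff p f Hp1) in H. destruct H as [Hf [B HB]].
apply Hp_iff; trivial. split.
- intros z Hz. destruct (Hf z Hz) as [l Hl]. exists l.
  assert (Hd : 0 < 1 - Cmod z) by (unfold unit_disc in Hz; lra).
  eapply cderiv_ext_loc with (1 := Hd) (3 := Hl). intros w Hw. apply E, (disc_nbhd z), Hw.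
- exists B. intros r Hr. replace (circ_mean p g r) with (circ_mean p f r). apply HB, Hr.
  apply RInt_ext. intros t _. rewrite E; trivial. apply circle_disc, Hr.
Qed.

Lemma prim_holo f : holo f -> holo (prim f).
Proof. intros Hf z Hz. exists (f z). apply prim_deriv; trivial. Qed.

Lemma C_derive_prim f z : holo f -> unit_disc z -> C_derive (prim f) z = f z.
Proof. intros Hf Hz. apply is_C_derive_unique, prim_deriv; trivial. Qed.

Lemma holo_mult f g : holo f -> holo g -> holo (fun z => f z * g z)%C.
Proof.
intros Hf Hg z Hz. destruct (Hf z Hz) as [a Ha]. destruct (Hg z Hz) as [b Hb].
eexists. apply (cderiv_mult f g); eassumption.
Qed.

Lemma locally'_disc (z0 : C) (P : C -> Prop) : unit_disc z0 ->
  (forall z, unit_disc z -> P z) -> @locally' C_UniformSpace z0 P.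
Proof.
intros Hz0 H. apply locally'_Cmod. exists (1 - Cmod z0). split. unfold unit_disc in Hz0; lra.
intros w Hw _. apply H, (disc_nbhd z0), Hw.
Qed.

(** * Multipliers between optimal domains *)

Lemma Tg_deriv g k z : holo g -> holo k -> unit_disc z -> cderiv (Tg g k) z (k z * C_derive g z)%C.
Proof.
intros Hg Hk Hz. pose proof (holo_mult k _ Hk (holo_C_derive g Hg)) as Hh.
assert (Hd : 0 < 1 - Cmod z) by (unfold unit_disc in Hz; lra).
eapply cderiv_ext_loc with (1 := Hd) (3 := prim_deriv _ z Hh Hz).
intros w Hw. symmetry. apply (Tg_prim g k); trivial. apply (disc_nbhd z), Hw.
intros z0 Hz0. apply locally'_disc; trivial.
Qed.

Lemma Tg_rel_deriv g1 g2 k c z : holo g1 -> holo k ->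
  (forall z, unit_disc z -> g2 z = (Tg g1 k z + c)%C) -> unit_disc z ->
  C_derive g2 z = (k z * C_derive g1 z)%C.
Proof.
intros Hg Hk E Hz. apply is_C_derive_unique.
assert (Hd : 0 < 1 - Cmod z) by (unfold unit_disc in Hz; lra).
eapply cderiv_ext_loc with (1 := Hd) (f := fun z => (Tg g1 k z + c)%C).
- intros w Hw. symmetry. apply E, (disc_nbhd z), Hw.
- eapply cderiv_eq. apply (cderiv_plus (Tg g1 k) (fun _ => c)). apply Tg_deriv; trivial.
  apply cderiv_const. ring.
Qed.

(** If h extends f g1', then h k extends f g2', and |h k| <= M |h| makes [prim (h k)] subordinate to
    [prim h], which represents [Tg g1 f]. *)
Lemma opt_dom_incl p g1 g2 k c f : 1 <= p -> holo g1 -> Hinf k ->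
  (forall z, unit_disc z -> g2 z = (Tg g1 k z + c)%C) -> opt_dom g1 p f -> opt_dom g2 p f.
Proof.
intros Hp1 Hg [Hk [M HM]] E [Hm [[h [Hh Hhf]] HT]].
pose proof (holo_mult h k Hh Hk) as Hhk.
assert (Hloc : forall z0, unit_disc z0 ->
  @locally' C_UniformSpace z0 (fun z => (h z * k z)%C = (f z * C_derive g2 z)%C)).
{ intros z0 Hz0. generalize (filter_and _ _ (Hhf z0 Hz0) (locally'_disc z0 _ Hz0 (fun z Hz => Hz))).
  apply filter_imp. intros z [E1 Hz].
  rewrite (Tg_rel_deriv g1 g2 k c z Hg Hk E Hz), E1. ring. }
split; [exact Hm|split].
- exists (fun z => (h z * k z)%C). split; [exact Hhk | exact Hloc].
- apply (Hp_ext p (prim (fun z => h z * k z)%C)); trivial.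
  { intros z Hz. symmetry. exact (Tg_prim g2 f _ z Hhk Hz Hloc). }
  apply (Hp_subordinate p (prim h) _ M); trivial.
  + apply (Hp_ext p (Tg g1 f)); trivial. intros z Hz. apply (Tg_prim g1 f); trivial.
  + apply prim_holo, Hhk.
  + intros z Hz. rewrite !C_derive_prim by trivial. rewrite Cmod_mult, Rmult_comm.
    apply Rmult_le_compat_r. apply Cmod_ge_0. apply HM, Hz.
Qed.

(** The supply of test functions: every F in H^p arises, up to its constant term, as [Tg g f] for
    some f in the domain. Meromorphy comes from factoring g' as (z - z0)^n u at each point. *)
Lemma opt_dom_quotient p g F : 1 <= p -> holo g -> (exists z, unit_disc z /\ C_derive g z <> 0) ->
  Hp p F -> opt_dom g p (fun z => C_derive F z / C_derive g z)%C.
Proof.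
intros Hp1 Hg Hnc HF. assert (HFh : holo F) by apply HF.
pose proof (holo_C_derive g Hg) as Hg'. pose proof (holo_C_derive F HFh) as HF'.
assert (Hloc : forall z0, unit_disc z0 -> @locally' C_UniformSpace z0
  (fun z => C_derive F z = (C_derive F z / C_derive g z * C_derive g z)%C)).
{ intros z0 Hz0. destruct (zeros_isolated _ z0 Hg' Hnc Hz0) as [d [Hd Hw]].
  apply locally'_Cmod. exists d. split; trivial. intros w H1 H2. field. apply Hw; trivial. }
split; [|split].
- intros z0 Hz0. destruct (zero_factor _ z0 Hg' Hnc Hz0) as [n [u [Hu [Hu0 E]]]].
  exists n, (fun z => C_derive F z / u z)%C.
  destruct (zeros_isolated u z0 Hu (ex_intro _ z0 (conj Hz0 Hu0)) Hz0) as [d [Hd Hw]].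
  assert (Hw' : forall w, Cmod (w - z0) < d -> unit_disc w /\ u w <> 0).
  { intros w H1. destruct (classic (w = z0)) as [->|n1]. split; trivial. apply Hw; trivial. }
  split.
  + apply locally_Cmod. exists d. split; trivial. intros w H1. destruct (Hw' w H1) as [Uw Nw].
    destruct (HF' w Uw) as [a Ha]. destruct (Hu w Uw) as [b Hb].
    eexists. apply (cderiv_div (C_derive F) u); eassumption.
  + apply locally'_Cmod. exists d. split; trivial. intros w H1 H2. destruct (Hw' w H1) as [Uw Nw].
    rewrite E by trivial. field. split; trivial. apply Cpow_nz, Cminus_neq_0, H2.
- exists (C_derive F). split; [exact HF' | exact Hloc].
- apply (Hp_ext p (prim (C_derive F))); trivial.
  { intros z Hz. symmetry. exact (Tg_prim g _ _ z HF' Hz Hloc). }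
  (* [prim (C_derive F)] is F - F(0); subordination with constant 1 disposes of the constant without
     a triangle inequality in H^p. *)
  apply (Hp_subordinate p F _ 1); trivial. apply prim_holo, HF'.
  intros z Hz. rewrite C_derive_prim by trivial. lra.
Qed.

Lemma holo_id : holo (fun z => z).
Proof. intros z _. exists (RtoC 1). apply cderiv_id. Qed.

Lemma Hp_id p : 1 <= p -> Hp p (fun z => z).
Proof.
intros Hp1. pose proof two_PI_pos as Hpi. apply Hp_iff; trivial. split. apply holo_id.
exists (2 * PI). intros r Hr.
pose proof (is_RInt_const (V := R_NormedModule) 0 (2 * PI) 1) as J.
replace (2 * PI) with (scal (2 * PI - 0) 1 : R) at 1 by (unfold scal; simpl; unfold mult; simpl; ring).
refine (is_RInt_le _ _ _ _ _ _ (Rlt_le _ _ Hpi) (is_circ_mean p _ r Hp1 holo_id Hr) J _).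
intros t _. cbv beta. rewrite Cmod_circle by lra. pose proof (rpow_small r p). lra.
Qed.

Lemma opt_dom_multiplier p g1 g2 : 1 <= p -> holo g1 -> holo g2 -> nonconstant g1 ->
  (forall f, opt_dom g1 p f -> opt_dom g2 p f) ->
  exists k, Hinf k /\ forall z, unit_disc z -> g2 z = (Tg g1 k z + g2 0)%C.
Proof.
intros Hp1 Hg1 Hg2 Hnc Hinc.
pose proof (nonconstant_deriv g1 Hg1 Hnc) as Hn1.
pose proof (holo_C_derive g1 Hg1) as Hg1'. pose proof (holo_C_derive g2 Hg2) as Hg2'.
(* The test function 1/g1', obtained from F(z) = z. That its product with g2' is holomorphic says
   that g2'/g1' has a holomorphic extension k. *)
destruct (Hinc _ (opt_dom_quotient p g1 _ Hp1 Hg1 Hn1 (Hp_id p Hp1))) as [_ [[k [Hk Hkf]] _]].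
assert (Did : forall z, C_derive (fun z => z) z = 1).
{ intros z. apply is_C_derive_unique, cderiv_id. }
assert (Ek : forall z0, unit_disc z0 -> @locally' C_UniformSpace z0
   (fun z => k z = (C_derive g2 z / C_derive g1 z)%C /\ C_derive g1 z <> 0 /\ unit_disc z)).
{ intros z0 Hz0. destruct (zeros_isolated _ z0 Hg1' Hn1 Hz0) as [d [Hd Hw]].
  assert (L : @locally' C_UniformSpace z0 (fun z => unit_disc z /\ C_derive g1 z <> 0)).
  { apply locally'_Cmod. exists d. split; trivial. }
  generalize (filter_and _ _ (Hkf z0 Hz0) L). apply filter_imp. intros z [E [Uz Nz]].
  split; [|split]; trivial. rewrite E, Did. field. trivial. }
assert (Eg : forall z, unit_disc z -> C_derive g2 z = (k z * C_derive g1 z)%C).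
{ intros z Hz. apply (punctured_eq _ (fun z => k z * C_derive g1 z)%C). apply holo_cont; trivial.
  apply (holo_cont _ (holo_mult k _ Hk Hg1')); trivial.
  generalize (Ek z Hz). apply filter_imp. intros w [E [N _]].
  apply (eq_trans (y := (C_derive g2 w / C_derive g1 w * C_derive g1 w)%C)); [field; trivial | rewrite <- E; trivial]. }
exists k. split.
- split; trivial. apply (multiplier_bounded p k Hp1 Hk).
  intros F HF. assert (HFh : holo F) by apply HF. pose proof (holo_C_derive F HFh) as HF'.
  (* The function F'/g1' lies in the second domain, so the primitive of F' k is in H^p; its
     derivative growth is the hypothesis of [multiplier_bounded]. *)
  destruct (Hinc _ (opt_dom_quotient p g1 F Hp1 Hg1 Hn1 HF)) as [_ [_ HT]].
  pose proof (holo_mult _ _ HF' Hk) as HFk.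
  assert (HP : Hp p (prim (fun z => C_derive F z * k z)%C)).
  { apply (Hp_ext p _ _ Hp1) with (2 := HT). intros z Hz. apply Tg_prim; trivial.
    intros z0 Hz0. generalize (Ek z0 Hz0). apply filter_imp. intros w [E [N _]].
    apply (eq_trans (y := (C_derive F w * (C_derive g2 w / C_derive g1 w))%C)); [rewrite <- E; trivial | field; trivial]. }
  destruct (Hp_deriv_growth p _ Hp1 HP) as [K [_ HK]]. exists K. intros a Ha.
  specialize (HK a Ha). rewrite C_derive_prim, Cmod_mult in HK by trivial. exact HK.
- intros z Hz. rewrite (disc_FTC g2 z Hg2 Hz) at 1.
  rewrite (Tg_prim g1 k (C_derive g2) z Hg2' Hz). ring.
  intros z0 Hz0. apply locally'_disc; trivial.
Qed.

Theorem theorem2p3 (p : R) (hp : 1 <= p) (g1 g2 : C -> C)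
  (hg1 : BMOA g1) (hg2 : BMOA g2)
  (nc1 : nonconstant g1) (nc2 : nonconstant g2) :
  ((forall f : C -> C, opt_dom g1 p f <-> opt_dom g2 p f) <->
   (exists k1 k2 : C -> C,
      Hinf k1 /\ Hinf k2 /\
      (forall z : C, unit_disc z -> g1 z = (Tg g2 k1 z + g1 0)%C) /\
      (forall z : C, unit_disc z -> g2 z = (Tg g1 k2 z + g2 0)%C)))
  /\
  (forall k1 k2 : C -> C,
      Hinf k1 -> Hinf k2 ->
      (forall z : C, unit_disc z -> g1 z = (Tg g2 k1 z + g1 0)%C) ->
      (forall z : C, unit_disc z -> g2 z = (Tg g1 k2 z + g2 0)%C) ->
      forall z : C, unit_disc z -> k1 z <> 0 /\ k2 z = (1 / k1 z)%C).
Proof.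
assert (Hg1 : holo g1) by apply hg1. assert (Hg2 : holo g2) by apply hg2.
split; [split|].
- intros H.
  destruct (opt_dom_multiplier p g2 g1 hp Hg2 Hg1 nc2 (fun f => proj2 (H f))) as [k1 [Hk1 E1]].
  destruct (opt_dom_multiplier p g1 g2 hp Hg1 Hg2 nc1 (fun f => proj1 (H f))) as [k2 [Hk2 E2]].
  exists k1, k2. exact (conj Hk1 (conj Hk2 (conj E1 E2))).
- intros [k1 [k2 [Hk1 [Hk2 [E1 E2]]]]] f. split.
  + exact (opt_dom_incl p g1 g2 k2 (g2 0) f hp Hg1 Hk2 E2).
  + exact (opt_dom_incl p g2 g1 k1 (g1 0) f hp Hg2 Hk1 E1).
- intros k1 k2 [Hk1 _] [Hk2 _] E1 E2 z Hz.
  pose proof (holo_C_derive g1 Hg1) as Hg1'.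
  (* g1' = k1 g2' = k1 k2 g1' gives k1 k2 = 1 off the zeros of g1', which are isolated; continuity
     extends this to the zeros. *)
  assert (K : (k1 z * k2 z)%C = 1).
  { apply (punctured_eq (fun z => k1 z * k2 z)%C (fun _ => RtoC 1)).
    - apply (holo_cont _ (holo_mult k1 k2 Hk1 Hk2)); trivial.
    - apply continuous_const.
    - destruct (zeros_isolated _ z Hg1' (nonconstant_deriv g1 Hg1 nc1) Hz) as [d [Hd Hw]].
      apply locally'_Cmod. exists d. split; trivial. intros w W1 W2. destruct (Hw w W1 W2) as [Uw Nw].
      pose proof (Tg_rel_deriv g2 g1 k1 _ w Hg2 Hk1 E1 Uw) as D1.
      rewrite (Tg_rel_deriv g1 g2 k2 _ w Hg1 Hk2 E2 Uw) in D1.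
      apply (eq_trans (y := (k1 w * (k2 w * C_derive g1 w) / C_derive g1 w)%C)). field; trivial.
      rewrite <- D1. field. trivial. }
  assert (N : k1 z <> 0).
  { intros E. rewrite E, Cmult_0_l in K. symmetry in K. exact (C1_nz K). }
  split; trivial. rewrite <- K. field. trivial.
Qed.
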